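(* There is a universal constant $c>0$ such that for all integers $d,\tau\ge1$ and reals $\mu,\sigma_2>0$ the following holds for all sufficiently large $N$. For any (possibly randomized) algorithm with two-point feedback making $N$ oracle calls and returning $\hat x_N\in\mathbb{R}^d$, there exists a two-point instance with parameters $(d,\tau,\mu,\sigma_2)$ such that $$\mathbb{E}\|\hat x_N-x^*\|^2\ge c\,\frac{(d+\tau)\sigma_2^2}{\mu^2N}.$$ Consequently, to get to the $\varepsilon$-neighborhood of the solution (that is, $\mathbb{E}\|\hat x_N-x^*\|^2\le\varepsilon$) with two-point feedback one needs at least $N=\Omega\left(\frac{(d+\tau)\sigma_2^2}{\mu^2\varepsilon}\right)$ two-point oracle calls (as $\varepsilon\to0$, with a universal constant in $\Omega$).
   Context: Norms are Euclidean. A two-point instance with parameters $(d,\tau,\mu,\sigma_2)$ consists of a complete separable metric space $\mathsf{Z}$ with its Borel $\sigma$-algebra, a stationary Markov chain $\{Z_i\}$ on it with kernel $\mathrm{Q}$ and unique invariant distribution $\pi$ satisfying $\sup_{z,z'}\frac12\|\mathrm{Q}^k(z,\cdot)-\mathrm{Q}^k(z',\cdot)\|_{\mathsf{TV}}\le(1/4)^{\lfloor k/\tau\rfloor}$ for all $k\in\mathbb{N}$, and a function $F:\mathbb{R}^d\times\mathsf{Z}\to\mathbb{R}$ with $f(x)=\mathbb{E}_{Z\sim\pi}[F(x,Z)]$ such that: for some $L>0$, for every $Z\in\mathsf{Z}$, $F(\cdot,Z)$ is differentiable with $L$-Lipschitz gradient; $f$ is $\mu$-strongly convex ($\frac\mu2\|x-y\|^2\le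 f(x)-f(y)-\langle\nabla f(y),x-y\rangle$ for all $x,y$); $\mathbb{E}_\pi[\nabla F(x,Z)]=\nabla f(x)$ and $\mathbb{E}_\pi\|\nabla F(x,Z)-\nabla f(x)\|^2\le\sigma_2^2$ for all $x\in\mathbb{R}^d$. $x^*$ is the minimizer of $f$. Two-point feedback: the $k$-th oracle call, at a pair of points $x_k,y_k$ chosen by the algorithm from its previous observations and internal randomness, returns $F(x_k,Z_k)$ and $F(y_k,Z_k)$. *)

(* Defs.v *)
From HB Require Import structures.
From mathcomp Require Import all_boot all_order all_algebra.
From mathcomp Require Import all_classical all_reals all_analysis.
Set Implicit Arguments.
Unset Strict Implicit.
Unset Printing Implicit Defensive.
Import Order.TTheory GRing.Theory Num.Theory.
Import numFieldNormedType.Exports.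
Local Open Scope classical_set_scope.
Local Open Scope ring_scope.

Section euclidean.
Context {R : realType} {d : nat}.
Implicit Types (u v x : 'rV[R]_d) (f : 'rV[R]_d -> R).

Definition dotp u v : R := \sum_(i < d) u 0 i * v 0 i.

(* The library norm on matrices is the sup norm. *)
Definition enorm u : R := Num.sqrt (dotp u u).

Definition grad f x : 'rV[R]_d := \row_(i < d) 'D_(delta_mx 0 i) f x.

Definition strongly_convex (mu : R) f :=
  (forall x, differentiable f x) /\
  forall x y, mu / 2 * enorm (x - y) ^+ 2 <= f x - f y - dotp (grad f y) (x - y).

Definition lipschitz_gradient (L : R) f :=
  (forall x, differentiable f x) /\
  forall x y, enorm (grad f x - grad f y) <= L * enorm (x - y).

Definition minimizer f x := forall y, f x <= f y.

End euclidean.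

#[short(type="completeMetricType")]
HB.structure Definition CompleteMetric (R : numDomainType) :=
  {T of CompletePseudoMetric R T & Metric R T}.

Definition separable (T : topologicalType) :=
  exists D : set T, countable D /\ dense D.

Notation borel Z := (g_sigma_algebraType (@open Z)).

Section total_variation_norm.
Context d (T : measurableType d) (R : realType).

(* |nu|(T); the value does not depend on the chosen Hahn decomposition. *)
Definition tv_norm (nu : {charge set T -> \bar R}) : \bar R :=
  let N := cid (projT2 (cid (Hahn_decomposition nu))) in
  charge_variation (projT2 N) setT.

End total_variation_norm.

Section kernels.
Context d (T : measurableType d) (R : realType) (Q : R.-pker T ~> T).

Fixpoint kernel_iter (k : nat) : R.-spker T ~> T :=
  if k is k'.+1 then mkcomp_noparam Q (kernel_iter k')
  else kdirac (@measurable_id _ T setT).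

Definition iter_law (k : nat) (z : T) : set T -> \bar R := kernel_iter k z.

HB.instance Definition _ k z := Measure.on (iter_law k z).

HB.instance Definition _ k z := Measure_isFinite.Build _ _ _ (iter_law k z)
  (finite_kernel_measure (kernel_iter k) z).

Definition iter_charge k z := charge_of_finite_measure (iter_law k z).

Definition mixing (tau : nat) := forall k,
  (ereal_sup [set (2^-1)%:E * tv_norm (cadd (iter_charge k z)
                                            (copp (iter_charge k z')))
             | z in [set: T] & z' in [set: T]] <= ((1 / 4) ^+ (k %/ tau))%:E)%E.

Definition invariant_law (pi : probability T R) :=
  forall A, measurable A -> (\int[pi]_z Q z A = pi A)%E.

Definition unique_invariant_law (pi : probability T R) :=
  invariant_law pi /\
  forall pi' : probability T R, invariant_law pi' ->
    forall A, measurable A -> pi' A = pi A.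

Section chain.
Context d' (Omega : measurableType d') (P : probability Omega R).
Variable X : nat -> {RV P >-> T}.

Definition trajectory (n : nat) (w : Omega) : n.+1.-tuple T :=
  [tuple X i w | i < n.+1].

Definition markov_property := forall n (B : set (n.+1.-tuple T)) (A : set T),
  measurable B -> measurable A ->
  (P (trajectory n @^-1` B `&` X n.+1 @^-1` A)
   = \int[P]_(w in trajectory n @^-1` B) Q (X n w) A)%E.

(* A Markov chain started from an invariant law is stationary. *)
Definition stationary_markov_chain (pi : probability T R) :=
  [/\ invariant_law pi,
      (forall A, measurable A -> distribution P (X 0) A = pi A)
    & markov_property].

End chain.
End kernels.

Record two_point_instance (R : realType) (d tau : nat) (mu sigma2 : R) := {
  state_space : completeMetricType R;
  state_space_separable : separable state_space;
  transition : R.-pker (borel state_space) ~> (borel state_space);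
  inv_law : probability (borel state_space) R;
  inv_law_unique : unique_invariant_law transition inv_law;
  transition_mixing : mixing transition tau;
  Omega_display : measure_display;
  Omega : measurableType Omega_display;
  Omega_law : probability Omega R;
  chain : nat -> {RV Omega_law >-> borel state_space};
  chain_stationary : stationary_markov_chain transition chain inv_law;
  loss : 'rV[R]_d -> borel state_space -> R;
  loss_integrable : forall x, inv_law.-integrable setT (EFin \o loss x);
  loss_smooth :
    exists2 L : R, 0 < L & forall z, lipschitz_gradient L (loss ^~ z);
  objective : 'rV[R]_d -> R := fun x => \int[inv_law]_z loss x z;
  objective_strongly_convex : strongly_convex mu objective;
  loss_grad_integrable : forall x i,
    inv_law.-integrable setT (fun z => (grad (loss ^~ z) x 0 i)%:E);
  loss_grad_unbiased : forall x i,
    \int[inv_law]_z grad (loss ^~ z) x 0 i = grad objective x 0 i;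
  loss_grad_variance : forall x,
    (\int[inv_law]_z (enorm (grad (loss ^~ z) x - grad objective x) ^+ 2)%:E
       <= (sigma2 ^+ 2)%:E)%E
}.

(* Measurability into R^d is coordinatewise. *)
Definition measurable_rV d' (T : measurableType d') (R : realType) (d : nat)
    (g : T -> 'rV[R]_d) :=
  forall i, measurable_fun setT (fun t => g t 0 i).

(* A randomized algorithm draws a seed once and for all, so that a seed may
   encode all the random choices made at the successive calls.  The k-th query
   is a function of the seed and of the k previous answers (calls are numbered
   from 0, and query k is used only for k < N). *)
Record algorithm (R : realType) (d N : nat) := {
  seed_display : measure_display;
  seed : measurableType seed_display;
  seed_law : probability seed R;
  query : forall k, seed * k.-tuple (R * R) -> 'rV[R]_d * 'rV[R]_d;
  output : seed * N.-tuple (R * R) -> 'rV[R]_d;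
  measurable_query1 : forall k,
    measurable_rV (fun h : seed * k.-tuple (R * R) => (query h).1);
  measurable_query2 : forall k,
    measurable_rV (fun h : seed * k.-tuple (R * R) => (query h).2);
  measurable_output : measurable_rV output
}.

Section run.
Context (R : realType) (d tau N : nat) (mu sigma2 : R).
Variables (a : algorithm R d N) (I : two_point_instance d tau mu sigma2).

Fixpoint answers (s : seed a) (w : Omega I) (k : nat) : k.-tuple (R * R) :=
  if k is k'.+1 then
    let h := answers s w k' in
    let xy := query (s, h) in
    let z := chain I k' w in
    [tuple of rcons h (loss xy.1 z, loss xy.2 z)]
  else [tuple].

Definition estimate (s : seed a) (w : Omega I) : 'rV[R]_d :=
  output (s, answers s w N).

(* The product measure makes the seed independent of the chain. *)
Definition mean_square_error (xstar : 'rV[R]_d) : \bar R :=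
  (\int[seed_law a \x Omega_law I]_sw (enorm (estimate sw.1 sw.2 - xstar) ^+ 2)%:E)%E.

End run.

(* Main.v *)
Require Import Defs.
From HB Require Import structures.
From mathcomp Require Import all_boot all_order all_algebra.
From mathcomp Require Import all_classical all_reals all_analysis.
From mathcomp Require Import measurable_realfun charge ring lra.
Set Implicit Arguments.
Unset Strict Implicit.
Unset Printing Implicit Defensive.
Import Order.TTheory GRing.Theory Num.Theory.
Import numFieldNormedType.Exports.
Local Open Scope classical_set_scope.
Local Open Scope ring_scope.

(** The hard losses are the quadratics mu/2 |x|^2 - <b, x> whose linear term
    b = theta + s w is the parameter blurred by a Gaussian vector w read off the
    state of the chain.  The minimizer of the mean loss is theta / mu, and a call
    at (x, y) reveals of the noisy vector b only its products with x and y.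

    Two mechanisms make theta expensive to estimate.  A call sees only the two
    dimensions of b spanned by its queries, whence the factor d.  And if the
    chain keeps its state with probability 1 - rho and redraws it with
    probability rho of order 1 / tau, then N calls meet only about 1 + N / tau
    independent noise vectors, whence the factor tau; [lazy_mixing] checks that
    such a chain mixes at the prescribed speed.  Each mechanism has its own
    instance ([lower_bound_dimension] with rho = 1, [lower_bound_mixing]), and
    the better of the two bounds dominates half of their sum.

    Both bounds come from one Bayesian argument, the van Trees inequality with
    a finite shift in place of a derivative, a form that applies to every
    measurable estimator. Give theta a Gaussian prior. Translate the i-th
    coordinate of theta, and at the same time translate each freshly drawn
    noise vector by the opposite amount inside the subspace that the queries
    can see: all answers, hence the estimate, are unchanged, while the error
    of the i-th coordinate moves by exactly -t. By the Cameron--Martin formula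
    the translated experiment has density L = exp (- t S - t^2 I / 2) with
    respect to the original one, I being the sum of the squared lengths of the
    translations ([tilt_state]). Comparing the means of the error in both
    experiments gives t = E [err (1 - L)], and for small t the mean of (1 -
    L)^2 is at most 2 t^2 E I, because E L^2 = E exp (t^2 I); the resulting
    inequality is [van_trees]. Summed over i it involves only the total
    information, which is small: an orthogonal projection of rank at most 2
    has trace at most 2 ([plane_proj_le2]), and noise vectors are redrawn rho
    N times on average ([sum_integral_info]). The Bayes risk so obtained
    ([bayes_risk_ge]) is at most twice the risk at some fixed theta
    ([hard_instance_of_bayes]).

    Concretely the state space is the real line, and the prior, the initial state
    and all the innovations of the chain are functions of one uniform variable,
    split again and again into two independent ones ([integral_bisect]);
    Gaussian variables are quantiles of uniform ones. *)

(** * Two independent uniform variables from one *)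

Section mfun_of.
Context d d' (T : measurableType d) (U : measurableType d').

Definition mfun_of (f : T -> U) (mf : measurable_fun setT f) : {mfun T >-> U} :=
  HB.pack f (isMeasurableFun.Build d d' T U f mf).

End mfun_of.

Section rays.
Variable R : realType.
Local Notation RM := (measurableTypeR R).

Lemma measure_eq_rays (m1 m2 : {measure set RM -> \bar R}) :
  (forall x, m1 `]-oo, x[%classic < +oo)%E ->
  (forall x, m1 `]-oo, x[%classic = m2 `]-oo, x[%classic) ->
  forall E, measurable E -> m1 E = m2 E.
Proof.
move=> fin eq12 E mE.
have H := @g_sigma_algebra_measure_unique _ R RM (@RGenInftyO.G R) _ (fun n => `]-oo, n%:R[%classic) _ _ m1 m2.
apply: H => //.
- by move=> _ [x ->]; exact: measurable_itv.
- by move=> n; exists n%:R.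
- apply/seteqP; split => // x _; exists (Num.truncn `|x|).+1 => //=.
  by rewrite in_itv/= (le_lt_trans (ler_norm x)) // truncnS_gt.
- move=> _ _ [x ->] [y ->]; exists (Num.min x y).
  apply/seteqP; split => z /=; rewrite !in_itv/= lt_min; first by move=> [-> ->].
  by move=> /andP[].
- by move=> _ [x ->]; exact: eq12.
- by move: mE; rewrite RGenInftyO.measurableE.
Qed.

End rays.

Section uniform_law.
Variable R : realType.
Local Notation RM := (measurableTypeR R).

Definition unif : probability RM R := uniform_prob (@ltr01 R).

(** The distribution function of the uniform law. *)
Definition clamp (x : R) : R := Num.max 0 (Num.min 1 x).

Lemma unif_ray x : unif `]-oo, x[%classic = (clamp x)%:E.
Proof.
rewrite /unif/= /uniform_prob integral_uniform_pdf.
rewrite (eq_integral (cst 1%E)); last first.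
  move=> y; rewrite inE/= => -[_]; rewrite /uniform_pdf in_itv/= => ->.
  by rewrite subr0 invr1.
rewrite integral_cst/=; last by apply: measurableI; exact: measurable_itv.
rewrite mul1e /clamp.
have [x0|x0] := leP x 0.
  rewrite (_ : _ `&` _ = set0) ?measure0.
    by rewrite max_l// ge_min x0 orbT.
  apply/seteqP; split => // y [] /=; rewrite !in_itv/= => yx /andP[y0 _].
  by move: (lt_le_trans yx x0); rewrite ltNge y0.
have [x1|x1] := leP x 1.
  rewrite (_ : _ `&` _ = `[0, x[%classic).
    by rewrite lebesgue_measure_itv/= lte_fin x0 oppr0 adde0 max_r ?ltW.
  apply/seteqP; split => y /=; rewrite !in_itv/=.
    by move=> [-> /andP[-> _]].
  by move=> /andP[-> yx]; rewrite yx (ltW (lt_le_trans yx x1)).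
rewrite (_ : _ `&` _ = `[0, 1]%classic).
  by rewrite lebesgue_measure_itv/= lte_fin ltr01 oppr0 adde0 max_r.
apply/seteqP; split => y /=; rewrite !in_itv/=; first by case.
by move=> /andP[-> y1]; rewrite y1 (le_lt_trans y1 x1).
Qed.

Lemma unif_set1 x : unif [set x] = 0%E.
Proof. by rewrite /unif/= /uniform_prob integral_set1. Qed.

Lemma unif_cray x : unif `]-oo, x]%classic = (clamp x)%:E.
Proof.
rewrite -(@setUitv1 _ _ _ _ true)// measureU//.
- by rewrite [X in (X + _)%E]unif_ray [X in (_ + X)%E]unif_set1 adde0.
- by apply/seteqP; split => // y [] /=; rewrite in_itv/= => + yx; rewrite yx ltxx.
Qed.

Lemma unif_unit_itv : unif (~` `]0, 1[%classic) = 0%E.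
Proof.
rewrite /unif/= /uniform_prob integral_uniform_pdf.
rewrite (_ : _ `&` _ = [set 0; 1]).
  apply: null_set_integral.
  - by apply: measurableU; exact: measurable_set1.
  - by apply/measurable_EFinP/measurable_funTS; exact: measurable_uniform_pdf.
  - by apply: countable_lebesgue_measure0; apply: finite_set_countable.
apply/seteqP; split => y /=; rewrite !in_itv/=; last first.
  by move=> [->|->]; rewrite ltxx ?andbF ?lexx ?ler01; split.
move=> [/negP]; rewrite negb_and -!leNgt => /orP[y0|y1] /andP[y0' y1'].
  by left; apply/eqP; rewrite eq_le y0 y0'.
by right; apply/eqP; rewrite eq_le y1 y1'.
Qed.

(** The digit identities below fail at 0 and 1, where expansions are not
    unique; these points carry no mass. *)
Lemma unif_eq_on_unit (A B : set RM) : measurable A -> measurable B ->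
  (forall x, 0 < x < 1 -> A x <-> B x) -> unif A = unif B.
Proof.
move=> mA mB AB.
have m01 : measurable (`]0, 1[%classic : set RM) by exact: measurable_itv.
have H (C : set RM) : measurable C -> unif C = unif (C `&` `]0, 1[%classic).
  move=> mC; rewrite -[C in LHS](setIT C) -(setUv `]0, 1[%classic) setIUr.
  rewrite measureU//; last 3 first.
  - exact: measurableI.
  - by apply: measurableI => //; exact: measurableC.
  - by rewrite setIACA setICr setI0.
  rewrite [X in (_ + X)%E](_ : _ = 0%E) ?adde0//.
  apply: (@subset_measure0 _ _ _ unif _ (~` `]0, 1[%classic)) => //.
  - by apply: measurableI => //; exact: measurableC.
  - exact: measurableC.
  - exact: unif_unit_itv.
rewrite (H A)// (H B)//; congr (unif _).
apply/seteqP; split => x /= [h]; rewrite in_itv/= => x01; split => //; exact/AB.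
Qed.

Lemma clamp_half x : clamp x = (clamp (2 * x) + clamp (2 * x - 1)) / 2.
Proof.
rewrite /clamp /Num.max /Num.min.
by repeat case: ifPn; rewrite -?leNgt; lra.
Qed.

(** The first binary digit of a uniform variable is a fair coin, and the
    number formed by the remaining digits is again uniform. *)
Lemma unif_half E : measurable E ->
  unif E = ((2^-1)%:E * unif ((fun v => v / 2)%R @^-1` E) +
           (2^-1)%:E * unif ((fun v => (v + 1) / 2)%R @^-1` E))%E.
Proof.
have m0 : measurable_fun setT (fun v : RM => (v / 2)%R : RM).
  exact: measurable_funM.
have m1 : measurable_fun setT (fun v : RM => ((v + 1) / 2)%R : RM).
  by apply: measurable_funM => //; exact: measurable_funD.
have h0 : 0 <= (2^-1 : R) by lra.
pose m := measure_add
  (mscale (NngNum h0) (distribution unif (mfun_of m0)))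
  (mscale (NngNum h0) (distribution unif (mfun_of m1))).
move=> mE.
suff -> : unif E = m E by rewrite /m measure_addE.
apply: measure_eq_rays => // x; first by rewrite [X in (X < _)%E]unif_ray ltry.
rewrite [LHS]unif_ray.
rewrite [RHS]measure_addE; set lhs := LHS.
change (lhs = (2^-1)%:E * unif ((fun v : RM => v / 2)%R @^-1` `]-oo, x[%classic) +
    (2^-1)%:E * unif ((fun v : RM => (v + 1) / 2)%R @^-1` `]-oo, x[%classic))%E.
have -> : (fun v : RM => v / 2) @^-1` `]-oo, x[%classic = `]-oo, 2 * x[%classic.
  by apply/seteqP; split => v /=; rewrite !in_itv/=; lra.
have -> : (fun v : RM => (v + 1) / 2) @^-1` `]-oo, x[%classic = `]-oo, 2 * x - 1[%classic.
  by apply/seteqP; split => v /=; rewrite !in_itv/=; lra.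
by rewrite !unif_ray/= -!EFinM -EFinD /lhs clamp_half; congr (_%:E); lra.
Qed.

(** Digits of numbers of the unit interval in base 2; [shift_bits] drops
    the first one. *)
Definition bit (x : R) : R := if 2^-1 <= x then 1 else 0.
Definition shift_bits (x : R) : R := 2 * x - bit x.

Lemma measurable_bit : measurable_fun setT (bit : RM -> RM).
Proof.
by apply: measurable_fun_ifT => //; exact: measurable_fun_ler.
Qed.

Lemma measurable_shift_bits : measurable_fun setT (shift_bits : RM -> RM).
Proof.
apply: measurable_funB; last exact: measurable_bit.
exact: measurable_funM.
Qed.

(** The number with the first [n] binary digits of [x] of even rank,
    counting ranks from 0. *)
Fixpoint even_approx (n : nat) (x : R) : R :=
  if n is n'.+1 then
    (bit x + even_approx n' (shift_bits (shift_bits x))) / 2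
  else 0.

Definition even_part (x : R) : R := limn (even_approx ^~ x).
Definition odd_part (x : R) : R := even_part (shift_bits x).

Lemma bit_ge0 x : 0 <= bit x. Proof. by rewrite /bit; case: ifP. Qed.
Lemma bit_le1 x : bit x <= 1. Proof. by rewrite /bit; case: ifP. Qed.

Lemma even_approx_itv n x : 0 <= even_approx n x <= 1.
Proof.
elim: n x => [|n IH] x /=; first by rewrite lexx ler01.
have := IH (shift_bits (shift_bits x)); have := bit_ge0 x; have := bit_le1 x.
by move=> ? ? /andP[? ?]; apply/andP; split; lra.
Qed.

Lemma even_approx_nd x : nondecreasing_seq (even_approx ^~ x).
Proof.
apply/nondecreasing_seqP => n; elim: n x => [|n IH] x.
  by have /andP[] := even_approx_itv 1 x.
by have := IH (shift_bits (shift_bits x)); rewrite /=; lra.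
Qed.

Lemma is_cvg_even_approx x : cvgn (even_approx ^~ x).
Proof.
apply: nondecreasing_is_cvgn; first exact: even_approx_nd.
by exists 1 => _ [n _ <-]; have /andP[] := even_approx_itv n x.
Qed.

Lemma even_part_cvg x : even_approx ^~ x @ \oo --> even_part x.
Proof. exact: is_cvg_even_approx. Qed.

Lemma even_part_itv x : 0 <= even_part x <= 1.
Proof.
apply/andP; split.
  apply: limr_ge; first exact: is_cvg_even_approx.
  by apply: nearW => n; have /andP[] := even_approx_itv n x.
apply: limr_le; first exact: is_cvg_even_approx.
by apply: nearW => n; have /andP[] := even_approx_itv n x.
Qed.

Lemma even_partE x : even_part x = (bit x + odd_part (shift_bits x)) / 2.
Proof.
apply: (@cvg_unique _ _ (even_approx ^~ x @ \oo)) => //; first exact: even_part_cvg.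
change (even_approx ^~ x @ \oo --> (bit x + odd_part (shift_bits x)) / 2).
rewrite -cvg_shiftS /=.
apply: cvgMl; apply: cvgD; first exact: cvg_cst.
exact: even_part_cvg.
Qed.

Lemma measurable_even_approx n : measurable_fun setT (even_approx n : RM -> RM).
Proof.
elim: n => [|n IH] /=; first exact: measurable_cst.
apply: measurable_funM => //; apply: measurable_funD; first exact: measurable_bit.
apply: measurableT_comp IH _.
by apply: (@measurableT_comp _ _ _ _ _ _ shift_bits);
  exact: measurable_shift_bits.
Qed.

Lemma measurable_even_part : measurable_fun setT (even_part : RM -> RM).
Proof.
apply: (measurable_fun_cvg measurable_even_approx) => x _; exact: even_part_cvg.
Qed.

Lemma measurable_odd_part : measurable_fun setT (odd_part : RM -> RM).
Proof.
exact: measurableT_comp measurable_even_part measurable_shift_bits.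
Qed.

Definition bisect (x : RM) : RM * RM := (even_part x, odd_part x).

Lemma measurable_bisect : measurable_fun setT bisect.
Proof.
exact: measurable_fun_pair measurable_even_part measurable_odd_part.
Qed.

Lemma even_part0 v : 0 < v < 1 -> even_part (v / 2) = odd_part v / 2.
Proof.
move=> v01; rewrite even_partE.
have b : bit (v / 2) = 0 by rewrite /bit; case: ifP => //; lra.
by rewrite /shift_bits b add0r subr0 [2 * _]mulrC divfK ?pnatr_eq0.
Qed.

Lemma even_part1 v : 0 < v < 1 -> even_part ((v + 1) / 2) = (odd_part v + 1) / 2.
Proof.
move=> v01; rewrite even_partE.
have b : bit ((v + 1) / 2) = 1 by rewrite /bit; case: ifP => //; lra.
have -> : shift_bits ((v + 1) / 2) = v by rewrite /shift_bits b; lra.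
by rewrite b addrC.
Qed.

Lemma odd_part0 v : 0 < v < 1 -> odd_part (v / 2) = even_part v.
Proof.
move=> v01; rewrite /odd_part /shift_bits.
have -> : bit (v / 2) = 0 by rewrite /bit; case: ifP => //; lra.
by congr even_part; lra.
Qed.

Lemma odd_part1 v : 0 < v < 1 -> odd_part ((v + 1) / 2) = even_part v.
Proof.
move=> v01; rewrite /odd_part /shift_bits.
have -> : bit ((v + 1) / 2) = 1 by rewrite /bit; case: ifP => //; lra.
by congr even_part; lra.
Qed.

Definition split_cdf (a b : R) : R :=
  fine (unif (even_part @^-1` `]-oo, a[%classic `&` odd_part @^-1` `]-oo, b[%classic)).

Lemma measurable_split_ray a b :
  measurable (even_part @^-1` `]-oo, a[%classic `&` odd_part @^-1` `]-oo, b[%classic : set RM).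
Proof.
apply: measurableI; rewrite -[X in measurable X]setTI.
  exact: measurable_even_part.
exact: measurable_odd_part.
Qed.

(** Conditioning on the first digit: it is the first digit of the even
    part, and once it is removed the two parts exchange their roles. *)
Lemma split_cdf_half a b :
  split_cdf a b = (split_cdf b (2 * a) + split_cdf b (2 * a - 1)) / 2.
Proof.
rewrite {1}/split_cdf unif_half; last exact: measurable_split_ray.
set X := (X in unif X); set Y := (Y in (_ + _ * unif Y)%E).
rewrite (@unif_eq_on_unit X (even_part @^-1` `]-oo, b[%classic `&` odd_part @^-1` `]-oo, 2 * a[%classic)); last 3 first.
- rewrite /X -[X in measurable X]setTI; apply: measurable_funM => //.
  exact: measurable_split_ray.
- exact: measurable_split_ray.
- move=> v v01; rewrite /X/= !in_itv/= even_part0// odd_part0//.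
  split => -[h1 h2]; split => //; lra.
rewrite (@unif_eq_on_unit Y (even_part @^-1` `]-oo, b[%classic `&` odd_part @^-1` `]-oo, 2 * a - 1[%classic)); last 3 first.
- rewrite /Y -[X in measurable X]setTI; apply: measurable_funM => //; last first.
    exact: measurable_split_ray.
  exact: measurable_funD.
- exact: measurable_split_ray.
- move=> v v01; rewrite /Y/= !in_itv/= even_part1// odd_part1//.
  split => -[h1 h2]; split => //; lra.
rewrite fineD ?fineM ?fin_numM ?fin_num_measure//; try exact: measurable_split_ray.
by rewrite /split_cdf/=; lra.
Qed.

Lemma clamp_itv x : 0 <= clamp x <= 1.
Proof. by rewrite /clamp /Num.max /Num.min; repeat case: ifPn; rewrite -?leNgt; lra. Qed.

Lemma clamp_id x : 0 <= x <= 1 -> clamp x = x.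
Proof. by rewrite /clamp /Num.max /Num.min; repeat case: ifPn; rewrite -?leNgt; lra. Qed.

Lemma clamp_le0 x : x <= 0 -> clamp x = 0.
Proof. by rewrite /clamp /Num.max /Num.min; repeat case: ifPn; rewrite -?leNgt; lra. Qed.

Lemma clamp_ge1 x : 1 <= x -> clamp x = 1.
Proof. by rewrite /clamp /Num.max /Num.min; repeat case: ifPn; rewrite -?leNgt; lra. Qed.

Lemma split_cdf_itv a b : 0 <= split_cdf a b <= 1.
Proof.
have mab := measurable_split_ray a b.
rewrite /split_cdf fine_ge0//= -lee_fin fineK ?probability_le1//.
by rewrite fin_num_measure.
Qed.

Lemma split_cdf_le0 a b : a <= 0 \/ b <= 0 -> split_cdf a b = 0.
Proof.
move=> ab; rewrite /split_cdf (_ : _ `&` _ = set0) ?measure0//.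
apply/seteqP; split => // x /=; rewrite !in_itv/= => -[xa xb].
have /andP[A0 _] := even_part_itv x.
have /andP[B0 _] := even_part_itv (shift_bits x).
rewrite /odd_part in xb.
by case: ab => ?; lra.
Qed.

Lemma split_cdf_gt1 a b : 1 < a -> 1 < b -> split_cdf a b = 1.
Proof.
move=> a1 b1; rewrite /split_cdf (_ : _ `&` _ = setT) ?probability_setT//.
apply/seteqP; split => // x _ /=; rewrite !in_itv/=.
have /andP[_ A0] := even_part_itv x.
have /andP[_ B0] := even_part_itv (shift_bits x).
by rewrite /odd_part; split; lra.
Qed.

(** Both sides satisfy the same equation, the value at (a, b) being the
    mean of the values at the four points (2a - i, 2b - j) with i and j in
    {0, 1}. They agree when an argument is nonpositive and when both exceed
    1, and one of the four points is always of this kind; so the largest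
    difference between the two sides is at most 3/4 of itself. *)
Lemma split_cdfE a b : split_cdf a b = clamp a * clamp b.
Proof.
pose f a b := split_cdf a b - clamp a * clamp b.
have fE a' b' : f a' b' = (f (2 * a') (2 * b') + f (2 * a') (2 * b' - 1) +
    f (2 * a' - 1) (2 * b') + f (2 * a' - 1) (2 * b' - 1)) / 4.
  rewrite /f split_cdf_half (split_cdf_half b') (split_cdf_half b' (_ - 1)).
  by rewrite (clamp_half a') (clamp_half b'); lra.
have f0 a' b' : a' <= 0 \/ b' <= 0 -> f a' b' = 0.
  move=> ab; rewrite /f split_cdf_le0//.
  by case: ab => h; rewrite (clamp_le0 h) ?mul0r ?mulr0 subr0.
have f1 a' b' : 1 < a' -> 1 < b' -> f a' b' = 0.
  by move=> a1 b1; rewrite /f split_cdf_gt1// !clamp_ge1 ?ltW// mulr1 subrr.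
have bnd n a' b' : `|f a' b'| <= (3 / 4) ^+ n.
  elim: n a' b' => [|n IH] a' b'.
    rewrite expr0 /f ler_norml.
    have /andP[h1 h2] := split_cdf_itv a' b'.
    have /andP[h3 h4] := clamp_itv a'; have /andP[h5 h6] := clamp_itv b'.
    apply/andP; split; nra.
  rewrite exprS fE normrM (@ger0_norm _ 4^-1); last by lra.
  have H (p q r s : R) : [\/ p = 0, q = 0, r = 0 | s = 0] ->
      `|p| <= (3 / 4) ^+ n -> `|q| <= (3 / 4) ^+ n ->
      `|r| <= (3 / 4) ^+ n -> `|s| <= (3 / 4) ^+ n ->
      `|p + q + r + s| / 4 <= 3 / 4 * (3 / 4) ^+ n.
    rewrite !ler_norml => h /andP[? ?] /andP[? ?] /andP[? ?] /andP[? ?].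
    have q0 : 0 <= (3 / 4 : R) ^+ n by apply: exprn_ge0; lra.
    rewrite ler_pdivrMr// ler_norml.
    by case: h => ->; apply/andP; split; lra.
  apply: H; rewrite ?IH//.
  (* Of the four points one has a nonpositive coordinate, or else a and b
     exceed 1/2 and both coordinates of the first point exceed 1. *)
  have [a2|a2] := leP a' 2^-1; first by apply: Or44; apply: f0; left; lra.
  have [b2|b2] := leP b' 2^-1; first by apply: Or44; apply: f0; right; lra.
  by apply: Or41; apply: f1; lra.
apply/eqP; rewrite -subr_eq0 -normr_le0 -/(f a b).
have q1 : `|3 / 4 : R| < 1 by rewrite ger0_norm; lra.
rewrite -(cvg_lim _ (cvg_expr q1))//; apply: limr_ge.
  exact: cvgP (cvg_expr q1).
by apply: nearW => n; exact: bnd.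
Qed.

(** The product formula on rays is [split_cdfE]; it extends to Borel sets
    in one variable at a time, by uniqueness of measures. *)
Lemma unif_bisect (X Y : set RM) : measurable X -> measurable Y ->
  unif (even_part @^-1` X `&` odd_part @^-1` Y) = (unif X * unif Y)%E.
Proof.
have mA (Z : set RM) : measurable Z -> measurable (even_part @^-1` Z : set RM).
  by move=> mZ; rewrite -[V in measurable V]setTI; exact: measurable_even_part.
have mB (Z : set RM) : measurable Z -> measurable (odd_part @^-1` Z : set RM).
  by move=> mZ; rewrite -[V in measurable V]setTI; exact: measurable_odd_part.
have fl (A : set RM) : measurable A -> (unif A < +oo)%E.
  by move=> mA'; apply: le_lt_trans (ltry 1); exact: probability_le1.
have fr (A : set RM) : measurable A -> 0 <= fine (unif A) by move=> _; exact: fine_ge0.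
have key b (Z : set RM) : measurable Z ->
    unif (even_part @^-1` Z `&` odd_part @^-1` `]-oo, b[%classic) = (unif Z * (clamp b)%:E)%E.
  move=> mZ.
  have mO := mB _ (measurable_itv `]-oo, b[).
  have c0 : 0 <= clamp b by have /andP[] := clamp_itv b.
  pose m1 := pushforward (mrestr unif mO) (mfun_of measurable_even_part).
  pose m2 := mscale (NngNum c0) unif.
  transitivity (m1 Z); first by [].
  transitivity (m2 Z); last by rewrite /m2/mscale/= muleC.
  apply: measure_eq_rays mZ => a.
    apply: fl; exact: measurable_split_ray.
  rewrite /m1 /m2 /= /mscale /pushforward /mrestr /=.
  rewrite [X in (_ * X)%E]unif_ray -EFinM mulrC -split_cdfE fineK//.
  by have mab := measurable_split_ray a b; rewrite fin_num_measure.
move=> mX mY.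
have x0 := fr _ mX.
pose m1 := pushforward (mrestr unif (mA _ mX)) (mfun_of measurable_odd_part).
pose m2 := mscale (NngNum x0) unif.
transitivity (m1 Y); first by rewrite setIC.
transitivity (m2 Y); last by rewrite /m2/mscale/= fineK// fin_num_measure.
apply: measure_eq_rays mY => a.
  apply: fl; apply: measurableI; first exact: (mB _ (measurable_itv `]-oo, a[)).
  exact: (mA _ mX).
rewrite /m1 /m2 /= /mscale /pushforward /mrestr /=.
rewrite setIC [LHS]key//; congr (_ * _)%E; last by rewrite [RHS]unif_ray.
by rewrite fineK// fin_num_measure.
Qed.

Lemma distribution_bisect (X : set (RM * RM)) : measurable X ->
  distribution unif (mfun_of measurable_bisect) X = (unif \x unif)%E X.
Proof.
move=> mX; apply/esym; apply: product_measure_unique mX => A B mA mB.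
exact: unif_bisect.
Qed.

(** Independence of the two parts, in the form in which one uniform
    variable is traded for two. *)
Lemma integral_bisect (f : RM * RM -> \bar R) : measurable_fun setT f ->
  (forall x, 0 <= f x)%E ->
  (\int[unif]_x f (bisect x) = \int[unif]_x \int[unif]_y f (x, y))%E.
Proof.
move=> mf f0.
rewrite -[RHS](fubini_tonelli1 (m1 := unif) (m2 := unif))//.
rewrite -(ge0_integral_distribution (mfun_of measurable_bisect : {RV unif >-> _}) mf)//.
apply: eq_measure_integral => A mA _; exact: distribution_bisect.
Qed.

End uniform_law.

(** * Translating Gaussian variables *)

Section density.
Context d (T : measurableType d) (R : realType).
Variables (nu : {finite_measure set T -> \bar R})
  (mu : {sigma_finite_measure set T -> \bar R}) (g : T -> \bar R).
Hypotheses (mg : measurable_fun setT g) (g0 : forall x, (0 <= g x)%E).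
Hypothesis nuE : forall A, measurable A -> nu A = (\int[mu]_(x in A) g x)%E.

(** The function [g] is some version of the Radon--Nikodym derivative, and
    two versions agree almost everywhere. *)
Lemma ge0_integral_density (f : T -> \bar R) :
  measurable_fun setT f -> (forall x, 0 <= f x)%E ->
  (\int[nu]_x f x = \int[mu]_x (f x * g x))%E.
Proof.
move=> mf f0.
have numu : nu `<< mu.
  apply/null_content_dominatesP => A mA muA.
  by rewrite nuE//; apply: null_set_integral => //; exact: measurable_funTS.
rewrite -(Radon_Nikodym_SigmaFinite.change_of_variables numu)//.
have mD := measurable_int _ (Radon_Nikodym_SigmaFinite.f_integrable numu).
apply: ae_eq_integral => //; [exact: emeasurable_funM|exact: emeasurable_funM|].
have : ae_eq mu setT (Radon_Nikodym_SigmaFinite.f nu mu) g.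
  apply: integral_ae_eq => //.
    exact: Radon_Nikodym_SigmaFinite.f_integrable.
  by move=> E _ mE; rewrite -Radon_Nikodym_SigmaFinite.f_integral// nuE.
by apply: filterS => x /= h _; rewrite h.
Qed.

End density.

Section gaussian.
Variable R : realType.
Local Notation RM := (measurableTypeR R).
Local Notation mu := (@lebesgue_measure R).

Lemma probability_eq_rays (m1 m2 : probability RM R) :
  (forall x, m1 `]-oo, x]%classic = m2 `]-oo, x]%classic) ->
  forall E, measurable E -> m1 E = m2 E.
Proof.
move=> eq12 E mE.
have H := @g_sigma_algebra_measure_unique _ R RM (@RGenOInfty.G R) _ (fun n => `](- n%:R)%R, +oo[%classic) _ _ m1 m2.
have C (m : probability RM R) x : m `]x, +oo[%classic = (1 - m `]-oo, x]%classic)%E.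
  rewrite -probability_setC; last exact: measurable_itv.
  by rewrite setCitvl.
apply: H => //.
- by move=> _ [x ->]; exact: measurable_itv.
- by move=> n; exists (- n%:R).
- apply/seteqP; split => // x _; exists (Num.truncn `|x|).+1 => //=.
  rewrite in_itv/= andbT ltrNl; apply: le_lt_trans (truncnS_gt _).
  by rewrite -normrN ler_norm.
- move=> _ _ [x ->] [y ->]; exists (Num.max x y).
  apply/seteqP; split => z /=; rewrite !in_itv/= !andbT gt_max.
    by move=> [-> ->].
  by move=> /andP[].
- by move=> _ [x ->]; rewrite [LHS]C [RHS]C eq12.
- by move=> k; apply: le_lt_trans (ltry 1); apply: probability_le1; exact: measurable_itv.
- by move: mE; rewrite RGenOInfty.measurableE.
Qed.

Definition gauss : probability RM R := normal_prob 0 1.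

Lemma integral_gauss (f : RM -> \bar R) : measurable_fun setT f ->
  (forall x, 0 <= f x)%E ->
  (\int[gauss]_x f x = \int[mu]_x (f x * (normal_pdf 0 1 x)%:E))%E.
Proof.
move=> mf f0; apply: (@ge0_integral_density _ _ R gauss mu) => //.
by apply/measurable_EFinP; exact: measurable_normal_pdf.
Qed.

Lemma integral_lebesgue_shift (u : R) (f : RM -> \bar R) : measurable_fun setT f ->
  (forall x, 0 <= f x)%E ->
  (\int[mu]_x f (x + u)%R = \int[mu]_x f x)%E.
Proof.
move=> mf f0.
have ms : measurable_fun setT (fun x : RM => x + u : RM) by exact: measurable_funD.
rewrite -[LHS](ge0_integral_pushforward (phi := mfun_of ms) _ mu (D := setT))//.
apply: eq_measure_integral => A mA _; apply/esym.
apply: lebesgue_measure_unique => // _ [[a b]] /= _ <-.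
rewrite /pushforward/=.
rewrite (_ : _ @^-1` _ = `]a - u, b - u]%classic).
  rewrite [LHS]lebesgue_measure_itv [RHS]lebesgue_measure_itv/= !lte_fin ltrD2r.
  by case: ifP => // _; rewrite -!EFinB; congr (_%:E); lra.
by apply/seteqP; split => z /=; rewrite !in_itv/= lerBrDr ltrBlDr.
Qed.

(** The Cameron--Martin formula on the line: invariance of Lebesgue measure
    moves the translation from the integrand to the density. *)
Lemma integral_gauss_shift (u : R) (f : RM -> \bar R) : measurable_fun setT f ->
  (forall x, 0 <= f x)%E ->
  (\int[gauss]_x f (x - u)%R =
   \int[gauss]_x (f x * (expR (- (u * x) - u ^+ 2 / 2))%:E))%E.
Proof.
move=> mf f0.
have ms : measurable_fun setT (fun x : RM => x - u : RM) by exact: measurable_funD.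
have mpdf : measurable_fun setT (fun x : RM => (normal_pdf 0 1 x)%:E).
  by apply/measurable_EFinP; exact: measurable_normal_pdf.
rewrite [LHS]integral_gauss//; last exact: measurableT_comp.
rewrite -(@integral_lebesgue_shift u); last 2 first.
- by apply: emeasurable_funM => //; exact: measurableT_comp.
- by move=> x; rewrite mule_ge0// lee_fin normal_pdf_ge0.
rewrite integral_gauss//; last 2 first.
- apply: emeasurable_funM => //; apply/measurable_EFinP.
  apply: measurableT_comp => //; apply: measurable_funB => //.
  exact: measurableT_comp.
- by move=> x; rewrite mule_ge0// lee_fin expR_ge0.
apply: eq_integral => x _; rewrite addrK -muleA; congr (_ * _)%E.
rewrite -EFinM; congr (_%:E).
rewrite !normal_pdfE ?oner_neq0//= mulrCA; congr (_ * _).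
rewrite /normal_fun -expRD; congr expR.
by rewrite expr1n !subr0; lra.
Qed.

(** The distribution function of the standard Gaussian law. *)
Definition Phi (x : R) : R := fine (gauss `]-oo, x]%classic).

Lemma PhiE x : (Phi x)%:E = gauss `]-oo, x]%classic.
Proof. by rewrite fineK// fin_num_measure//; exact: measurable_itv. Qed.

Lemma Phi_itv x : 0 <= Phi x <= 1.
Proof.
rewrite -!lee_fin PhiE measure_ge0 probability_le1//; exact: measurable_itv.
Qed.

Let idg : {RV gauss >-> R} := mfun_of (@measurable_id _ RM setT : measurable_fun setT (idfun : RM -> R)).

Let cdfE : cdf idg = EFin \o Phi.
Proof. by apply/funext => x /=; rewrite PhiE /cdf. Qed.

Lemma Phi_nd x y : x <= y -> Phi x <= Phi y.
Proof.
move=> xy; have := cdf_nondecreasing idg xy.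
by rewrite cdfE/= lee_fin.
Qed.

Lemma Phi_cvgy : Phi x @[x --> +oo] --> (1:R).
Proof. exact: (fine_cvg (cvg_cdfy1 idg)). Qed.

Lemma Phi_cvgNy : Phi x @[x --> -oo] --> (0:R).
Proof. exact: (fine_cvg (cvg_cdfNy0 idg)). Qed.

Lemma Phi_cvg_right x : Phi y @[y --> x^'+] --> Phi x.
Proof.
have h : cdf idg y @[y --> x^'+] --> (Phi x)%:E.
  by have := @cdf_right_continuous _ _ _ _ idg x; rewrite cdfE.
exact: (fine_cvg h).
Qed.

(** The generalized inverse of [Phi]. Outside ]0, 1[ the set need not have
    an infimum; the uniform law puts no mass there, and 0 is a default. *)
Definition quantile (u : R) : R :=
  if (0 < u) && (u < 1) then inf [set x | u <= Phi x] else 0.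

(** The infimum is attained because [Phi] is right-continuous, which makes
    [quantile] and [Phi] adjoint. *)
Lemma quantile_le u x : 0 < u -> u < 1 -> (quantile u <= x) = (u <= Phi x).
Proof.
move=> u0 u1; rewrite /quantile u0 u1/=.
set E := [set x | u <= Phi x].
have E0 : E !=set0.
  have /cvgr_gt/(_ u u1) := Phi_cvgy.
  by case/pinfty_ex_gt0 => y /= _ h; exists y; exact: ltW.
have lE : has_lbound E.
  have /cvgr_lt/(_ u u0) := Phi_cvgNy.
  case=> y [_ h]; exists (y - 1) => z; rewrite /E/= => uz.
  rewrite leNgt; apply/negP => zy.
  have := h z; have : z < y by lra.
  by move=> /[swap] /[apply]; rewrite ltNge uz.
have infE : u <= Phi (inf E).
  apply: (@cvgr_to_ge R _ _ _ _ _ _ (@Phi_cvg_right (inf E))).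
  near=> z.
  have [||y Ey yz] := @inf_adherent _ E (z - inf E); [|by split|].
    by rewrite subr_gt0; near: z; exact: nbhs_right_gt.
  apply: le_trans Ey _; apply: Phi_nd; rewrite ltW//.
  by move: yz; rewrite addrC subrK.
apply/idP/idP => h; last by apply: ge_inf.
by apply: (le_trans infE); exact: Phi_nd.
Unshelve. all: by end_near.
Qed.

Lemma measurable_quantile : measurable_fun setT (quantile : RM -> RM).
Proof.
apply: (@measurability _ _ RM RM setT _ (@RGenOInfty.G R)).
  exact: RGenOInfty.measurableE.
move=> _ [_ [x ->] <-]; rewrite setTI.
have m01 : measurable (`]0, 1[%classic : set RM) by exact: measurable_itv.
rewrite (_ : _ @^-1` _ = (`]0, 1[ `&` `]Phi x, +oo[%classic) `|`
    (~` `]0, 1[%classic `&` [set _ | x < 0])).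
  apply: measurableU; first by apply: measurableI => //; exact: measurable_itv.
  apply: measurableI; first exact: measurableC.
  have [x0|x0] := ltP x 0; first by rewrite (_ : [set _ | _] = setT)//; apply/seteqP.
  rewrite (_ : [set _ | _] = set0)//; by apply/seteqP; split.
apply/seteqP; split => u /=; rewrite !in_itv/= !andbT.
  have [/andP[u0 u1]|u01] := boolP ((0 < u) && (u < 1)).
    by rewrite ltNge quantile_le// -ltNge; left.
  by rewrite /quantile (negbTE u01); right.
move=> [[/andP[u0 u1]]|[/negP u01 x0]].
  by rewrite (ltNge x) quantile_le// -ltNge.
by rewrite /quantile (negbTE u01).
Qed.

Lemma distribution_quantile (E : set RM) : measurable E ->
  distribution (unif R) (mfun_of measurable_quantile) E = gauss E.
Proof.
apply: probability_eq_rays => x; rewrite -PhiE.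
have /andP[P0 P1] := Phi_itv x.
transitivity (unif R `]-oo, Phi x]%classic).
  apply: unif_eq_on_unit; last first.
  - by move=> u /andP[u0 u1] /=; rewrite !in_itv/= quantile_le.
  - exact: measurable_itv.
  - rewrite -[X in measurable X]setTI.
    exact: (measurable_quantile measurableT (measurable_itv `]-oo, x])).
by rewrite unif_cray clamp_id// P0 P1.
Qed.

Lemma integral_quantile (f : RM -> \bar R) : measurable_fun setT f ->
  (forall x, 0 <= f x)%E ->
  (\int[unif R]_x f (quantile x) = \int[gauss]_x f x)%E.
Proof.
move=> mf f0.
rewrite -[LHS](ge0_integral_distribution (mfun_of measurable_quantile : {RV unif R >-> _}) mf)//.
apply: eq_measure_integral => A mA _; exact: distribution_quantile.
Qed.

End gaussian.

Section gaussian_vector.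
Variable R : realType.
Local Notation RM := (measurableTypeR R).
Local Notation unif := (unif R).

Lemma measurable_quantileR : measurable_fun setT (@quantile R : RM -> R).
Proof. exact: measurable_quantile. Qed.

Lemma integral_quantile_shift (u : R) (f : R -> \bar R) : measurable_fun setT f ->
  (forall x, 0 <= f x)%E ->
  (\int[unif]_x f (quantile x - u)%R =
   \int[unif]_x (f (quantile x) * (expR (- (u * quantile x) - u ^+ 2 / 2))%:E))%E.
Proof.
move=> mf f0.
rewrite (@integral_quantile R (fun x => f (x - u)))//; last first.
  by apply: measurableT_comp => //; exact: measurable_funB.
rewrite integral_gauss_shift//.
rewrite -(@integral_quantile R (fun x => f x * (expR (- (u * x) - u ^+ 2 / 2))%:E)%E)//.
- apply: emeasurable_funM => //; apply/measurable_EFinP.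
  apply: measurableT_comp => //; apply: measurable_funB => //.
  exact: measurableT_comp.
- by move=> x; rewrite mule_ge0// lee_fin expR_ge0.
Qed.

(** Independent standard Gaussian coordinates: the first one is read off
    the even digits and the rest, recursively, off the odd digits. *)
Fixpoint gvec (d : nat) (v : RM) : d.-tuple R :=
  if d is d'.+1 then cons_tuple (quantile (even_part v)) (gvec d' (odd_part v))
  else [tuple].

Definition tdot d (u w : d.-tuple R) : R := \sum_(i < d) tnth u i * tnth w i.

Definition tshift d (t : R) (u w : d.-tuple R) : d.-tuple R :=
  [tuple tnth w i - t * tnth u i | i < d].

(** The density of the law of [tshift 1 u w] with respect to that of [w],
    when [w] is a standard Gaussian vector. *)
Definition tilt d (u w : d.-tuple R) : R := expR (- tdot u w - tdot u u / 2).

Lemma measurable_gvec d : measurable_fun setT (gvec d).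
Proof.
elim: d => [|d IH].
  apply/measurable_fun_tnthP => -[]//.
apply: measurable_cons.
  exact: measurableT_comp measurable_quantileR (@measurable_even_part R).
exact: measurableT_comp IH (@measurable_odd_part R).
Qed.

Lemma measurable_gvec_comp d d' (T : measurableType d') (f : T -> RM) :
  measurable_fun setT f -> measurable_fun setT (fun x => gvec d (f x)).
Proof.
exact: measurableT_comp (@measurable_gvec d).
Qed.

Lemma measurable_tdot d d' (T : measurableType d') (f g : T -> d.-tuple R) :
  measurable_fun setT f -> measurable_fun setT g ->
  measurable_fun setT (fun x => tdot (f x) (g x)).
Proof.
move=> /measurable_fun_tnthP mf /measurable_fun_tnthP mg.
by apply: measurable_sum => i; apply: measurable_funM; [exact: mf|exact: mg].
Qed.

Lemma measurable_tshift d d' (T : measurableType d') t (f g : T -> d.-tuple R) :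
  measurable_fun setT f -> measurable_fun setT g ->
  measurable_fun setT (fun x => tshift t (f x) (g x)).
Proof.
move=> /measurable_fun_tnthP mf /measurable_fun_tnthP mg.
apply/measurable_fun_tnthP => i.
rewrite (_ : _ \o _ = fun x => tnth (g x) i - t * tnth (f x) i); last first.
  by apply/funext => x /=; rewrite tnth_mktuple.
apply: measurable_funB; first exact: mg.
by apply: measurable_funM => //; exact: mf.
Qed.

Lemma measurable_tilt d d' (T : measurableType d') (f g : T -> d.-tuple R) :
  measurable_fun setT f -> measurable_fun setT g ->
  measurable_fun setT (fun x => tilt (f x) (g x)).
Proof.
move=> mf mg; apply: measurableT_comp => //; apply: measurable_funB.
  by apply: measurableT_comp => //; exact: measurable_tdot.
by apply: measurable_funM => //; exact: measurable_tdot.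
Qed.

Lemma tilt_cons d (a b : R) (u w : d.-tuple R) :
  tilt (cons_tuple a u) (cons_tuple b w) =
  expR (- (a * b) - a ^+ 2 / 2) * tilt u w.
Proof.
rewrite /tilt -expRD /tdot !big_ord_recl !tnth0; congr expR.
under eq_bigr do rewrite !tnthS.
under [X in _ - (_ + X) / 2]eq_bigr do rewrite !tnthS.
lra.
Qed.

Lemma tshift_cons d t (a b : R) (u w : d.-tuple R) :
  tshift t (cons_tuple a u) (cons_tuple b w) =
  cons_tuple (b - t * a) (tshift t u w).
Proof.
apply: eq_from_tnth => i; rewrite tnth_mktuple.
case: (unliftP ord0 i) => [j|] ->; first by rewrite !tnthS tnth_mktuple.
by rewrite !tnth0.
Qed.

(** The formula on the line applied coordinate by coordinate; Tonelli
    separates the first coordinate from the others. *)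
Lemma integral_gvec_shift d (u : d.-tuple R) (f : d.-tuple R -> \bar R) :
  measurable_fun setT f -> (forall x, 0 <= f x)%E ->
  (\int[unif]_v f (tshift 1 u (gvec d v)) =
   \int[unif]_v (f (gvec d v) * (tilt u (gvec d v))%:E))%E.
Proof.
elim: d u f => [|d IH] u f mf f0.
  apply: eq_integral => v _; rewrite /tilt /tdot !big_ord0 oppr0 mul0r subr0.
  by rewrite expR0 mule1; congr f; apply: eq_from_tnth => -[].
case/tupleP: u => a u.
have mcons d' (T : measurableType d') (g : T -> R) (h : T -> d.-tuple R) :
    measurable_fun setT g -> measurable_fun setT h ->
    measurable_fun setT (fun x => f (cons_tuple (g x) (h x))).
  by move=> mg mh; apply: measurableT_comp => //; exact: measurable_cons.
have mq1 : measurable_fun setT (fun x : RM * RM => quantile x.1 : R).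
  exact: measurableT_comp measurable_quantileR measurable_fst.
have mg2 : measurable_fun setT (fun x : RM * RM => gvec d x.2).
  by apply: measurable_gvec_comp; exact: measurable_snd.
have mq1a : measurable_fun setT (fun x : RM * RM => quantile x.1 - a : R).
  exact: measurable_funB.
pose G0 (x : RM * RM) :=
  f (cons_tuple (quantile x.1 - 1 * a) (tshift 1 u (gvec d x.2))).
pose G1 (x : RM * RM) :=
  (f (cons_tuple (quantile x.1 - a)%R (gvec d x.2)) * (tilt u (gvec d x.2))%:E)%E.
pose G2 (x : RM * RM) := (f (cons_tuple (quantile x.1) (gvec d x.2)) *
  (tilt (cons_tuple a u) (cons_tuple (quantile x.1) (gvec d x.2)))%:E)%E.
transitivity (\int[unif]_v G0 (bisect v))%E.
  by apply: eq_integral => v _; rewrite /G0 /= tshift_cons.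
rewrite integral_bisect; last 2 first.
- apply: mcons; first by rewrite mul1r.
  by apply: measurable_tshift => //; exact: measurable_cst.
- by move=> x; exact: f0.
transitivity (\int[unif]_x \int[unif]_y G1 (x, y))%E.
  apply: eq_integral => x _; rewrite /G0 /G1/= mul1r.
  rewrite (IH u (fun w => f (cons_tuple (quantile x - a)%R w)))//.
  exact: mcons.
rewrite fubini_tonelli; last 2 first.
- apply: emeasurable_funM; first exact: mcons.
  by apply/measurable_EFinP; apply: measurable_tilt => //; exact: measurable_cst.
- by move=> x; rewrite mule_ge0// lee_fin expR_ge0.
transitivity (\int[unif]_y \int[unif]_x G2 (x, y))%E.
  apply: eq_integral => y _; rewrite /G1 /G2/=.
  rewrite (integral_quantile_shift a (f := fun z => f (cons_tuple z (gvec d y)) * (tilt u (gvec d y))%:E)%E)//.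
  - apply: eq_integral => x _; rewrite tilt_cons EFinM -muleA; congr (_ * _)%E.
    by rewrite muleC.
  - by apply: emeasurable_funM => //; exact: mcons.
  - by move=> x; rewrite mule_ge0// lee_fin expR_ge0.
have mG2 : measurable_fun setT G2.
  apply: emeasurable_funM; first exact: mcons.
  apply/measurable_EFinP; apply: measurable_tilt => //.
  exact: measurable_cons.
have G20 x : (0 <= G2 x)%E by rewrite mule_ge0// lee_fin expR_ge0.
by rewrite -fubini_tonelli// -integral_bisect.
Qed.

End gaussian_vector.

(** * The lazy chain on the real line *)

Section real_line_state.
Variable R : realType.
Local Notation RM := (measurableTypeR R).

HB.instance Definition _ := PseudoMetric_isMetric.Build R R
  (fun x y : R => @mdist_ge0 R R^o x y)
  (fun x y : R => @mdist_positivity R R^o x y)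
  (fun x r => @ballEmdist R R^o x r).

(* Makes the metric available in the structures that combine it with
   completeness. *)
HB.saturate R.

End real_line_state.

Section borel_line.
Variable R : realType.
Local Notation RM := (measurableTypeR R).

Definition line : completeMetricType R := R.

Lemma line_separable : separable line.
Proof.
exists (range (ratr : rat -> R)); split; last exact: dense_rat.
by apply: card_le_trans (card_image_le _ _) _; exact: countableP.
Qed.

(** Uniform laws and quantiles live on the sigma-algebra generated by
    intervals, the state space on the one generated by open sets; on the
    line they coincide. *)
Lemma measurable_borel_line : @measurable _ (borel line) = @measurable _ RM.
Proof.
apply/seteqP; split.
  apply: smallest_sub; first exact: sigma_algebra_measurable.
  by move=> A; exact: open_measurable.
rewrite RGenOpens.measurableE; apply: smallest_sub.
  exact: sigma_algebra_measurable.
move=> _ [x [y ->]]; apply: sub_sigma_algebra; exact: interval_open.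
Qed.

Lemma measurable_to_line d (T : measurableType d) (f : T -> RM) :
  measurable_fun setT f -> measurable_fun setT (f : T -> borel line).
Proof.
by move=> mf _ A; rewrite measurable_borel_line => mA; exact: mf.
Qed.

Lemma measurable_from_line d (T : measurableType d) (f : RM -> T) :
  measurable_fun setT f -> measurable_fun setT (f : borel line -> T).
Proof.
move=> mf _ A mA; rewrite measurable_borel_line; exact: mf.
Qed.

End borel_line.

Lemma integral_prob_cst d (T : measurableType d) (R : realType)
    (P : probability T R) (c : \bar R) : (\int[P]_w c = c)%E.
Proof. by rewrite integral_cst// [X in (_ * X)%E]probability_setT mule1. Qed.

Lemma measure_integral_indic d (T : measurableType d) (R : realType)
    (P : {measure set T -> \bar R}) (A : set T) : measurable A ->
  P A = (\int[P]_w (\1_A w)%:E)%E.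
Proof. by move=> mA; rewrite integral_indic// setIT. Qed.

Section innovation.
Variables (R : realType) (rho : R).
Hypothesis rho01 : 0 <= rho <= 1.
Local Notation RM := (measurableTypeR R).
Local Notation unif := (unif R).

(** One uniform variable provides the innovation of a step, a redraw flag
    of probability [rho] with a candidate state, and a uniform variable
    that feeds all later steps. *)
Definition draw (r : RM) : (bool * RM) * RM :=
  ((even_part r < rho, even_part (odd_part r)), odd_part (odd_part r)).

Lemma measurable_draw : measurable_fun setT draw.
Proof.
have me := @measurable_even_part R; have mo := @measurable_odd_part R.
have mo2 := measurableT_comp mo (@measurable_odd_part R).
apply: measurable_fun_pair => //; apply: measurable_fun_pair; last exact: measurableT_comp me mo.
by apply: measurable_fun_ltr.
Qed.

Lemma unif_lt_rho : unif [set a | a < rho] = rho%:E.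
Proof.
rewrite (_ : [set a | _] = `]-oo, rho[%classic); last first.
  by apply/seteqP; split => x /=; rewrite in_itv.
by rewrite unif_ray clamp_id.
Qed.

Lemma integral_draw (f : (bool * RM) * RM -> \bar R) : measurable_fun setT f ->
  (forall p, 0 <= f p)%E ->
  (\int[unif]_r f (draw r) =
    (1 - rho)%:E * (\int[unif]_v \int[unif]_r f ((false, v), r)) +
    rho%:E * (\int[unif]_v \int[unif]_r f ((true, v), r)))%E.
Proof.
move=> mf f0; have /andP[r0 r1] := rho01.
have me := @measurable_even_part R; have mo := @measurable_odd_part R.
pose g (p : RM * RM) := f ((p.1 < rho, even_part p.2), odd_part p.2).
have mg : measurable_fun setT g.
  apply: (measurableT_comp mf); apply: measurable_fun_pair.
    apply: measurable_fun_pair; first by apply: measurable_fun_ltr.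
    exact: measurableT_comp me measurable_snd.
  exact: measurableT_comp mo measurable_snd.
have mfb b : measurable_fun setT (fun p : RM * RM => f ((b, p.1), p.2)).
  apply: (measurableT_comp mf); apply: measurable_fun_pair => //.
  exact: measurable_fun_pair.
set F0 := (\int[unif]_v \int[unif]_r f ((false, v), r))%E.
set F1 := (\int[unif]_v \int[unif]_r f ((true, v), r))%E.
have F00 : (0 <= F0)%E by apply: integral_ge0 => y _; exact: integral_ge0.
have F10 : (0 <= F1)%E by apply: integral_ge0 => y _; exact: integral_ge0.
have mlt : measurable ([set a | a < rho] : set RM).
  rewrite (_ : [set a | _] = `]-oo, rho[%classic); first exact: measurable_itv.
  by apply/seteqP; split => z /=; rewrite in_itv.
transitivity (\int[unif]_a \int[unif]_b g (a, b))%E.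
  exact: (integral_bisect mg (fun p => f0 _)).
transitivity (\int[unif]_a ((\1_[set a | (a < rho)%R] a)%:E * F1 +
   (\1_(~` [set a | (a < rho)%R]) a)%:E * F0))%E.
  apply: eq_integral => a _; rewrite !indicE in_setC.
  transitivity (\int[unif]_v \int[unif]_r f (((a < rho)%R, v), r))%E.
    exact: (integral_bisect (mfb (a < rho)) (fun p => f0 _)).
  have [arho|arho] := ltP a rho.
    by rewrite mem_set//= mul1e mul0e adde0.
  by rewrite memNset/= ?mul0e ?add0e ?mul1e//; apply/negP; rewrite -leNgt.
rewrite ge0_integralD//; last 4 first.
- by move=> a _; rewrite mule_ge0.
- by apply: emeasurable_funM => //; exact/measurable_EFinP/measurable_indic.
- by move=> a _; rewrite mule_ge0.
- apply: emeasurable_funM => //; apply/measurable_EFinP/measurable_indic.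
  exact: measurableC.
rewrite !ge0_integralZr//; last 2 first.
- by apply/measurable_EFinP/measurable_indic; exact: measurableC.
- exact/measurable_EFinP/measurable_indic.
rewrite !integral_indic//; last exact: measurableC.
have e1 : unif [set a | a < rho] = rho%:E by exact: unif_lt_rho.
have e2 : unif (~` [set a | a < rho]) = (1 - rho)%:E.
  by rewrite probability_setC// [X in (_ - X)%E]e1.
by rewrite !setIT addeC; congr (_ * _ + _ * _)%E; [exact: e2|exact: e1].
Qed.

Definition next (xr : RM * RM) : RM * RM :=
  let: ((b, v), r) := draw xr.2 in (if b then v else xr.1, r).

Lemma measurable_if_draw d (T : measurableType d) (g : T -> RM) :
  measurable_fun setT g ->
  measurable_fun setT (fun p : T * (bool * RM) => if p.2.1 then p.2.2 else g p.1).
Proof.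
move=> mg; apply: measurable_fun_ifT.
- exact: measurableT_comp measurable_fst measurable_snd.
- exact: measurableT_comp measurable_snd measurable_snd.
- exact: measurableT_comp mg measurable_fst.
Qed.

Lemma measurable_next : measurable_fun setT next.
Proof.
have md : measurable_fun setT (fun p : RM * RM => draw p.2).
  exact: measurableT_comp measurable_draw measurable_snd.
apply: measurable_fun_pair; last exact: measurableT_comp measurable_snd md.
pose h (p : RM * (bool * RM)) : RM := if p.2.1 then p.2.2 else p.1.
have mh : measurable_fun setT h by exact: (measurable_if_draw (g := id)).
apply: (@measurableT_comp _ _ _ _ _ _ h _ (fun p : RM * RM => (p.1, (draw p.2).1))) => //.
by apply: measurable_fun_pair => //; exact: measurableT_comp measurable_fst md.
Qed.

Lemma integral_next1 (x : RM) (f : RM -> \bar R) : measurable_fun setT f ->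
  (forall p, 0 <= f p)%E ->
  (\int[unif]_r f (next (x, r)).1 =
    (1 - rho)%:E * f x + rho%:E * \int[unif]_v f v)%E.
Proof.
move=> mf f0.
pose h (p : (bool * RM) * RM) := f (if p.1.1 then p.1.2 else x).
have mh : measurable_fun setT h.
  apply: (measurableT_comp mf); apply: measurable_fun_ifT => //.
  - exact: measurableT_comp measurable_fst measurable_fst.
  - exact: measurableT_comp measurable_snd measurable_fst.
transitivity (\int[unif]_r h (draw r))%E; first by [].
apply: (eq_trans (integral_draw mh (fun p => f0 _))).
congr (_ * _ + _ * _)%E.
  apply: (eq_trans _ (integral_prob_cst unif (f x))).
  by apply: eq_integral => v _; exact: (integral_prob_cst unif (f x)).
by apply: eq_integral => v _; exact: (integral_prob_cst unif (f v)).
Qed.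

End innovation.

Section fresh.
Context {R : realType} {d} {Omega : measurableType d} (P : probability Omega R).
Local Notation RM := (measurableTypeR R).
Local Notation unif := (unif R).

(** The law of [(Y, tail)] is the product of the law of [Y] with the
    uniform law, stated on nonnegative functions because it is used on
    integrals only. *)
Definition fresh d' (T : measurableType d') (Y : Omega -> T) (tail : Omega -> RM) :=
  forall h : T * RM -> \bar R, measurable_fun setT h -> (forall p, 0 <= h p)%E ->
  (\int[P]_w h (Y w, tail w) = \int[P]_w \int[unif]_v h (Y w, v))%E.

Lemma fresh_comp d1 d2 (T1 : measurableType d1) (T2 : measurableType d2)
    (Y : Omega -> T1) tail (phi : T1 -> T2) :
  measurable_fun setT phi -> fresh Y tail -> fresh (phi \o Y) tail.
Proof.
move=> mphi fY h mh h0.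
have mh' : measurable_fun setT (fun p => h (phi p.1, p.2)).
  apply: (measurableT_comp mh); apply: measurable_fun_pair => //.
  exact: measurableT_comp mphi measurable_fst.
exact: (fY _ mh' (fun p => h0 _)).
Qed.

Lemma measurable_integral_unif d' (T : measurableType d') (h : T * RM -> \bar R) :
  measurable_fun setT h -> (forall p, 0 <= h p)%E ->
  measurable_fun setT (fun t => \int[unif]_v h (t, v))%E.
Proof.
move=> mh h0; exact: (@measurable_fun_fubini_tonelli_F _ _ _ _ _ unif h).
Qed.

Section draw.
Variables (rho : R) (rho01 : 0 <= rho <= 1).
Context d' (T : measurableType d') (Y : Omega -> T) (tail : Omega -> RM).
Hypothesis fY : fresh Y tail.

(** After a step, the unused digits are independent of the past together
    with the innovation; this is what propagates independence along the
    chain. *)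
Lemma fresh_draw : fresh (fun w => (Y w, (draw rho (tail w)).1))
                         (fun w => (draw rho (tail w)).2).
Proof.
move=> h mh h0.
have md : measurable_fun setT (fun p : T * RM => draw rho p.2).
  exact: measurableT_comp (@measurable_draw R rho) measurable_snd.
have md1 := measurableT_comp measurable_fst md.
have md2 := measurableT_comp measurable_snd md.
pose H (q : T * (bool * RM)) := (\int[unif]_v h (q, v))%E.
have mH : measurable_fun setT H by exact: measurable_integral_unif.
have H0 q : (0 <= H q)%E by exact: integral_ge0.
have mh1 : measurable_fun setT (fun p : T * RM => h ((p.1, (draw rho p.2).1), (draw rho p.2).2)).
  by apply: (measurableT_comp mh); do 2 apply: measurable_fun_pair => //.
apply: (eq_trans (fY mh1 (fun p => h0 _))).
have mH1 : measurable_fun setT (fun p : T * RM => H (p.1, (draw rho p.2).1)).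
  by apply: (measurableT_comp mH); apply: measurable_fun_pair.
apply: (eq_trans _ (esym (fY mH1 (fun p => H0 _)))).
apply: eq_integral => w _.
have mhY : measurable_fun setT (fun q : (bool * RM) * RM => h ((Y w, q.1), q.2)).
  by apply: (measurableT_comp mh); do 2 apply: measurable_fun_pair => //.
have mHY : measurable_fun setT (fun q : (bool * RM) * RM => H (Y w, q.1)).
  by apply: (measurableT_comp mH); apply: measurable_fun_pair => //.
apply: (eq_trans (integral_draw rho01 mhY (fun p => h0 _))).
apply: (eq_trans _ (esym (integral_draw rho01 mHY (fun p => H0 _)))).
congr (_ * _ + _ * _)%E; apply: eq_integral => v _;
  exact/esym/(integral_prob_cst unif (H (Y w, (_, v)))).
Qed.

(** Expectation of a function of the past and of the next innovation: the
    candidate state is averaged out and the redraw flag is expanded. *)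
Lemma integral_fresh_draw (f : T * (bool * RM) -> \bar R) : measurable_fun setT f ->
  (forall p, 0 <= f p)%E ->
  (\int[P]_w f (Y w, (draw rho (tail w)).1) =
   \int[P]_w ((1 - rho)%:E * (\int[unif]_v f (Y w, (false, v))) +
              rho%:E * (\int[unif]_v f (Y w, (true, v)))))%E.
Proof.
move=> mf f0.
have mf1 : measurable_fun setT (fun p : T * RM => f (p.1, (draw rho p.2).1)).
  apply: (measurableT_comp mf); apply: measurable_fun_pair => //.
  apply: (measurableT_comp measurable_fst).
  exact: measurableT_comp (@measurable_draw R rho) measurable_snd.
apply: (eq_trans (fY mf1 (fun p => f0 _))).
apply: eq_integral => w _.
have mfY : measurable_fun setT (fun q : (bool * RM) * RM => f (Y w, q.1)).
  by apply: (measurableT_comp mf); apply: measurable_fun_pair => //.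
apply: (eq_trans (integral_draw rho01 mfY (fun p => f0 _))).
congr (_ * _ + _ * _)%E; apply: eq_integral => v _;
  exact: (integral_prob_cst unif (f (Y w, (_, v)))).
Qed.

Lemma fresh_next (g : T -> RM) : measurable_fun setT g ->
  fresh (fun w => (Y w, (next rho (g (Y w), tail w)).1))
        (fun w => (next rho (g (Y w), tail w)).2).
Proof.
move=> mg.
pose phi (p : T * (bool * RM)) := (p.1, if p.2.1 then p.2.2 else g p.1).
have mphi : measurable_fun setT phi.
  by apply: measurable_fun_pair => //; exact: measurable_if_draw.
exact: (fresh_comp mphi fresh_draw).
Qed.

End draw.

End fresh.

Lemma tv_normE d (T : measurableType d) (R : realType)
    (nu : {charge set T -> \bar R}) : exists P N,
  [/\ measurable P, measurable N & (tv_norm nu = nu P - nu N)%E].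
Proof.
pose P := cid (Hahn_decomposition nu); pose N := cid (projT2 P).
exists (projT1 P), (projT1 N).
have [[mP _] [mN _] _ _] := projT2 N; split=> //.
rewrite /tv_norm -/P -/N /charge_variation jordan_posE jordan_negE/= cjordan_negE.
by rewrite /charge.cjordan_pos /crestr0 !mem_set// /crestr !setTI.
Qed.

Section lazy_chain.
Variables (R : realType) (rho : R).
Hypothesis rho01 : 0 <= rho <= 1.
Local Notation RM := (measurableTypeR R).
Local Notation BR := (borel (line R)).
Local Notation unif := (unif R).

Lemma measurable_id_line : measurable_fun setT (id : RM -> BR).
Proof. exact: measurable_to_line. Qed.

Definition pi_line : probability BR R :=
  distribution unif (mfun_of measurable_id_line).

Lemma pi_lineE A : pi_line A = unif A.
Proof. by []. Qed.

Lemma measurable_next1 (x : RM) :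
  measurable_fun setT (fun r : RM => (next rho (x, r)).1 : BR).
Proof.
apply: measurable_to_line; apply: (measurableT_comp measurable_fst).
apply: (measurableT_comp (@measurable_next R rho)); exact: measurable_pair1.
Qed.

(** Defined as the law of one simulated step, so that the chain built from
    [next] has this kernel by construction. *)
Definition lazy_kernel (x : BR) : {measure set BR -> \bar R} :=
  distribution unif (mfun_of (measurable_next1 x)).

Lemma lazy_kernelE x A : measurable A ->
  lazy_kernel x A = ((1 - rho) * \1_A x + rho * fine (unif A))%:E.
Proof.
move=> mA; have mA' : measurable (A : set RM) by rewrite -measurable_borel_line.
rewrite [LHS]measure_integral_indic//.
rewrite ge0_integral_distribution//; last exact/measurable_EFinP/measurable_indic.
have mI : measurable_fun setT (fun y : RM => (\1_A y)%:E : \bar R).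
  exact/measurable_EFinP/measurable_indic.
apply: (eq_trans (integral_next1 rho01 x mI _)) => //.
rewrite [RHS]EFinD (EFinM (1 - rho)) (EFinM rho); congr (_ * _ + _ * _)%E.
by rewrite integral_indic// setIT fineK// fin_num_measure.
Qed.

Lemma measurable_lazy_kernel A : measurable A -> measurable_fun setT (lazy_kernel ^~ A).
Proof.
move=> mA.
rewrite (_ : (fun x => lazy_kernel x A) = fun x => ((1 - rho) * \1_A x + rho * fine (unif A))%:E).
  apply/measurable_EFinP; apply: measurable_funD => //.
  by apply: measurable_funM => //; exact: measurable_indic.
by apply/funext => x; exact: lazy_kernelE.
Qed.

Lemma lazy_kernel_prob x : lazy_kernel x setT = 1%E.
Proof. exact: probability_setT. Qed.

#[local] HB.instance Definition _ :=
  isKernel.Build _ _ _ _ _ lazy_kernel measurable_lazy_kernel.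
#[local] HB.instance Definition _ :=
  Kernel_isProbability.Build _ _ _ _ _ lazy_kernel lazy_kernel_prob.

Definition lazy : R.-pker BR ~> BR := lazy_kernel.

Lemma lazyE x A : measurable A ->
  lazy x A = ((1 - rho) * \1_A x + rho * fine (unif A))%:E.
Proof. exact: lazy_kernelE. Qed.

Lemma integral_pi_line (f : BR -> \bar R) : measurable_fun setT f ->
  (forall x, 0 <= f x)%E -> (\int[pi_line]_x f x = \int[unif]_x f x)%E.
Proof. by move=> mf f0; rewrite ge0_integral_distribution. Qed.

Lemma unif_fineE (A : set BR) : measurable A -> (fine (unif A))%:E = unif A.
Proof.
move=> mA; rewrite fineK// fin_num_measure//.
by rewrite -measurable_borel_line.
Qed.

Lemma fine_unif_itv (A : set BR) : measurable A -> 0 <= fine (unif A) <= 1.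
Proof.
move=> mA; rewrite -!lee_fin unif_fineE// measure_ge0 probability_le1//.
by rewrite -measurable_borel_line.
Qed.

Lemma integral_lazy_invariant (nu : probability BR R) A : measurable A ->
  (\int[nu]_x lazy x A = ((1 - rho) * fine (nu A) + rho * fine (unif A))%:E)%E.
Proof.
move=> mA; have /andP[r0 r1] := rho01.
have /andP[l0 l1] := fine_unif_itv mA.
transitivity (\int[nu]_x ((1 - rho)%:E * (\1_A x)%:E + (rho * fine (unif A))%:E))%E.
  by apply: eq_integral => x _; rewrite lazyE// EFinD EFinM.
have r1' : (0 <= (1 - rho)%:E :> \bar R)%E by rewrite lee_fin subr_ge0.
have mI : measurable_fun setT (fun x : BR => (\1_A x)%:E : \bar R).
  exact/measurable_EFinP/measurable_indic.
rewrite ge0_integralD//; last 3 first.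
- by move=> x _; rewrite mule_ge0.
- by apply: emeasurable_funM.
- by move=> x _; rewrite lee_fin mulr_ge0.
rewrite ge0_integralZl// integral_indic// setIT integral_prob_cst.
by rewrite [RHS]EFinD (EFinM (1 - rho)) fineK// fin_num_measure.
Qed.

(** Integrating the kernel against an invariant law nu gives nu A = (1 -
    rho) nu A + rho unif A, and rho is positive. *)
Lemma lazy_unique_invariant : 0 < rho -> unique_invariant_law lazy pi_line.
Proof.
move=> rho0; split=> [A mA|nu inv A mA].
  rewrite integral_lazy_invariant// pi_lineE.
  by rewrite -mulrDl subrK mul1r unif_fineE.
have := inv A mA; rewrite integral_lazy_invariant// pi_lineE -unif_fineE//.
rewrite -[nu A]fineK ?fin_num_measure// => -[] h; congr (_%:E).
have : rho * (fine (unif A) - fine (nu A)) = 0 by lra.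
by move=> /eqP; rewrite mulf_eq0 gt_eqF//= subr_eq0 => /eqP.
Qed.

(** The starting point matters only if no redraw occurred in k steps, an
    event of probability (1 - rho)^k; after a redraw the state is uniform. *)
Lemma iter_lazyE k x A : measurable A -> iter_law lazy k x A =
  ((1 - rho) ^+ k * \1_A x + (1 - (1 - rho) ^+ k) * fine (unif A))%:E.
Proof.
move=> mA; have /andP[r0 r1] := rho01.
have /andP[l0 l1] := fine_unif_itv mA.
have q0 n : 0 <= (1 - rho) ^+ n by rewrite exprn_ge0 ?subr_ge0.
have q1 n : (1 - rho) ^+ n <= 1 by rewrite exprn_ile1 ?subr_ge0// lerBlDr lerDl.
elim: k x => [|k IH] x.
  by rewrite expr0 mul1r subrr mul0r addr0 /iter_law/= /dirac.
transitivity (\int[lazy x]_y iter_law lazy k y A)%E; first by [].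
transitivity (\int[lazy x]_y (((1 - rho) ^+ k)%:E * (\1_A y)%:E +
    ((1 - (1 - rho) ^+ k) * fine (unif A))%:E))%E.
  by apply: eq_integral => y _; rewrite IH EFinD EFinM.
have mI : measurable_fun setT (fun x : BR => (\1_A x)%:E : \bar R).
  exact/measurable_EFinP/measurable_indic.
rewrite ge0_integralD//; last 3 first.
- by move=> y _; rewrite mule_ge0 ?lee_fin.
- by apply: emeasurable_funM.
- by move=> y _; rewrite lee_fin mulr_ge0// subr_ge0.
rewrite ge0_integralZl ?lee_fin// integral_indic// setIT lazyE//.
rewrite [X in (_ + X)%E](_ : _ = ((1 - (1 - rho) ^+ k) * fine (unif A))%:E).
  by rewrite -EFinM -EFinD exprS; congr (_%:E); ring.
by rewrite integral_cst// [X in (_ * X)%E](lazy_kernel_prob x) mule1.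
Qed.

(** By [iter_lazyE] two k-step laws differ by (1 - rho)^k times a
    difference of Dirac masses, whose total variation is at most 2. *)
Lemma lazy_mixing tau : (0 < tau)%N -> (1 - rho) ^+ tau <= 1 / 4 -> mixing lazy tau.
Proof.
move=> tau0 hrho k; have /andP[r0 r1] := rho01.
have q0 n : 0 <= (1 - rho) ^+ n by rewrite exprn_ge0 ?subr_ge0.
have q1 n : (1 - rho) ^+ n <= 1 by rewrite exprn_ile1 ?subr_ge0// lerBlDr lerDl.
apply: ge_ereal_sup => _ [z _ [z' _ <-]].
apply: (@le_trans _ _ ((1 - rho) ^+ k)%:E); last first.
  rewrite lee_fin {1}(divn_eq k tau) exprD mulnC exprM.
  apply: (@le_trans _ _ (((1 - rho) ^+ tau) ^+ (k %/ tau))).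
    by apply: ler_piMr; [exact: exprn_ge0|exact: q1].
  by apply: lerXn2r => //; rewrite nnegrE ?q0 ?divr_ge0.
set nu := cadd _ _.
have nuE A : measurable A -> nu A = ((1 - rho) ^+ k * (\1_A z - \1_A z'))%:E.
  move=> mA; transitivity (iter_law lazy k z A - iter_law lazy k z' A)%E; first by [].
  by rewrite !iter_lazyE// -EFinB; congr (_%:E); ring.
have [P [N [mP mN ->]]] := tv_normE nu.
rewrite [X in (_ * (X - _))%E](nuE P mP) [X in (_ * (_ - X))%E](nuE N mN) -EFinB -EFinM lee_fin -mulrBr mulrCA.
apply: ler_piMr => //.
have : `|(\1_P z - \1_P z' - (\1_N z - \1_N z'))%R : R| <= 2.
  have I A y : 0 <= (\1_A y : R) <= 1 by rewrite indicE; case: (_ \in _); rewrite ?lexx ?ler01.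
  have /andP[? ?] := I _ P z; have /andP[? ?] := I _ P z'.
  have /andP[? ?] := I _ N z; have /andP[? ?] := I _ N z'.
  by rewrite ler_norml; lra.
by rewrite ler_norml => /andP[_ ?]; lra.
Qed.

(** The pair of the current state and of the digits still unused. *)
Definition lazy_path (n : nat) (w : RM) : RM * RM := iter n (next rho) (bisect w).

Definition lazy_state (n : nat) (w : RM) : BR := (lazy_path n w).1.

Lemma lazy_pathS n w :
  lazy_path n.+1 w = next rho (lazy_state n w, (lazy_path n w).2).
Proof. by rewrite /lazy_state /lazy_path iterS; case: (iter n _ _). Qed.

Lemma measurable_lazy_path n : measurable_fun setT (lazy_path n).
Proof.
elim: n => [|n IH] /=; first exact: measurable_bisect.
exact: measurableT_comp (@measurable_next R rho) IH.
Qed.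

Lemma measurable_lazy_state n : measurable_fun setT (lazy_state n).
Proof.
apply: measurable_to_line; exact: measurableT_comp measurable_fst (measurable_lazy_path n).
Qed.

Definition lazy_chain (n : nat) : {RV unif >-> BR} := mfun_of (measurable_lazy_state n).

Lemma fresh_bisect : fresh unif (fun w => even_part w) (fun w => odd_part w).
Proof.
move=> h mh h0.
transitivity (\int[unif]_w h (bisect w))%E; first by [].
apply: (eq_trans (integral_bisect mh h0)).
have mH := measurableT_comp (measurable_integral_unif mh h0) (@measurable_fst _ _ RM RM).
apply: (eq_trans _ (esym (integral_bisect mH _))); last first.
  by move=> p; exact: integral_ge0.
apply: eq_integral => x _.
exact/esym/(integral_prob_cst unif (\int[unif]_v h (x, v))%E).
Qed.

Lemma fresh_trajectory n :
  fresh unif (trajectory lazy_chain n) (fun w => (lazy_path n w).2).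
Proof.
elim: n => [|n IH].
  have := fresh_comp (phi := fun x : RM => [tuple x : BR]) _ fresh_bisect.
  move=> H; have -> : trajectory lazy_chain 0 =
      (fun w => [tuple (even_part w : BR)] : 1.-tuple BR).
    apply/funext => w; apply: eq_from_tnth => i.
    by rewrite tnth_mktuple (ord1 i).
  apply: H; apply/measurable_fun_tnthP => i.
  rewrite (_ : _ \o _ = id); first exact: measurable_id_line.
  by apply/funext => x /=; rewrite (ord1 i).
pose last_state (t : n.+1.-tuple BR) : RM := tnth t ord_max.
have ml : measurable_fun setT last_state.
  move=> _ A mA; apply: (measurable_tnth ord_max) => //.
  by rewrite measurable_borel_line.
have := fresh_next rho01 IH ml.
move=> /(fresh_comp (phi := fun p : n.+1.-tuple BR * RM =>
    [tuple of rcons p.1 (p.2 : BR)])).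
have lastE w : last_state (trajectory lazy_chain n w) = lazy_state n w.
  by rewrite /last_state tnth_mktuple.
rewrite (_ : _ \o _ = trajectory lazy_chain n.+1); last first.
  apply/funext => w; apply: eq_from_tnth => i; rewrite tnth_mktuple.
  rewrite (tnth_nth (lazy_state 0 w)) [val _]/(rcons _ _) nth_rcons size_tuple lastE.
  case: ltnP => [ni|ni].
    rewrite (_ : nth _ _ _ = tnth (trajectory lazy_chain n w) (Ordinal ni)).
      by rewrite tnth_mktuple.
    by rewrite (tnth_nth (lazy_state 0 w)).
  have iE : i = n.+1 :> nat by apply/eqP; rewrite eqn_leq ni -ltnS ltn_ord.
  rewrite iE eqxx /=.
  by rewrite [in RHS]/lazy_state lazy_pathS.
rewrite (_ : (fun w => (next rho (last_state (trajectory lazy_chain n w), _)).2) =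
  (fun w => (lazy_path n.+1 w).2)); last first.
  by apply/funext => w; rewrite lastE lazy_pathS.
apply; apply/measurable_fun_tnthP => i.
have [ni|ni] := ltnP i n.+1.
  rewrite (_ : _ \o _ = fun p : n.+1.-tuple BR * RM => tnth p.1 (Ordinal ni)).
    exact: measurableT_comp (measurable_tnth _) measurable_fst.
  apply/funext => p /=; rewrite !(tnth_nth p.2) /= nth_rcons size_tuple ni.
  by [].
rewrite (_ : _ \o _ = fun p : n.+1.-tuple BR * RM => p.2 : BR).
  apply: measurable_to_line; exact: measurable_snd.
apply/funext => p /=; rewrite (tnth_nth p.2) /= nth_rcons size_tuple ltnNge ni /=.
by case: ifP.
Qed.

(** The next state is a function of the current state and of a uniform
    variable that is independent of the trajectory so far. *)
Lemma lazy_markov : markov_property lazy lazy_chain.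
Proof.
move=> n B A mB mA.
have mtr : measurable_fun setT (trajectory lazy_chain n).
  apply/measurable_fun_tnthP => i.
  rewrite (_ : _ \o _ = lazy_state i); first exact: measurable_lazy_state.
  by apply/funext => w /=; rewrite tnth_mktuple.
have mB' : measurable (trajectory lazy_chain n @^-1` B).
  by rewrite -[X in measurable X]setTI; exact: mtr.
have mA' : measurable (lazy_state n.+1 @^-1` A).
  by rewrite -[X in measurable X]setTI; exact: measurable_lazy_state.
pose last_state (t : n.+1.-tuple BR) : RM := tnth t ord_max.
have lastE w : last_state (trajectory lazy_chain n w) = lazy_state n w.
  by rewrite /last_state tnth_mktuple.
have ml : measurable_fun setT last_state.
  move=> _ C mC; apply: (measurable_tnth ord_max) => //.
  by rewrite measurable_borel_line.
pose h (p : n.+1.-tuple BR * RM) :=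
  ((\1_B p.1)%:E * (\1_A (next rho (last_state p.1, p.2)).1)%:E : \bar R)%E.
have mh : measurable_fun setT h.
  apply: emeasurable_funM; apply/measurable_EFinP.
    exact: measurableT_comp (measurable_indic mB) measurable_fst.
  have mA2 : measurable (A : set RM) by rewrite -measurable_borel_line.
  apply: (measurableT_comp (measurable_indic mA2)).
  apply: (measurableT_comp measurable_fst).
  apply: (measurableT_comp (@measurable_next R rho)).
  by apply: measurable_fun_pair => //; exact: measurableT_comp ml measurable_fst.
have h0 p : (0 <= h p)%E by rewrite mule_ge0 ?lee_fin.
transitivity (\int[unif]_w h (trajectory lazy_chain n w, (lazy_path n w).2))%E.
  rewrite [LHS]measure_integral_indic; last exact: measurableI.
  apply: eq_integral => w _; rewrite /h lastE -lazy_pathS -EFinM; congr (_%:E).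
  by rewrite indicI.
apply: (eq_trans (fresh_trajectory mh h0)).
rewrite [RHS]integral_mkcond; apply: eq_integral => w _.
rewrite patchE; case: ifPn => wB.
  rewrite lazyE// -lazy_kernelE//.
  rewrite [RHS]measure_integral_indic//.
  rewrite ge0_integral_distribution//; last exact/measurable_EFinP/measurable_indic.
  apply: eq_integral => v _; rewrite /h/= lastE indicE.
  by rewrite mem_set ?mul1e//; move: wB; rewrite inE.
transitivity (0%:E : \bar R); last by [].
apply: integral0_eq => v _; rewrite /h/= indicE memNset ?mul0e//.
by move: wB; rewrite notin_setE.
Qed.

Lemma lazy_stationary : stationary_markov_chain lazy lazy_chain pi_line.
Proof.
split; [|move=> A mA|exact: lazy_markov].
  move=> A mA; rewrite integral_lazy_invariant// pi_lineE.
  by rewrite -mulrDl subrK mul1r unif_fineE.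
have mA2 : measurable (A : set RM) by rewrite -measurable_borel_line.
have := unif_bisect mA2 measurableT.
by rewrite preimage_setT setIT probability_setT mule1 => <-.
Qed.

End lazy_chain.

(** * Quadratic losses with Gaussian noise *)

Section quadratic.
Variables (R : realType) (d : nat).
Implicit Types (u v x y g : 'rV[R]_d) (mu : R).

Lemma dotpC u v : dotp u v = dotp v u.
Proof. by apply: eq_bigr => i _; rewrite mulrC. Qed.

Lemma dotpDl u v x : dotp (u + v) x = dotp u x + dotp v x.
Proof. by rewrite -big_split; apply: eq_bigr => i _; rewrite mxE mulrDl. Qed.

Lemma dotpZl (a : R) u x : dotp (a *: u) x = a * dotp u x.
Proof. by rewrite /dotp mulr_sumr; apply: eq_bigr => i _; rewrite mxE mulrA. Qed.

Lemma dotpNl u x : dotp (- u) x = - dotp u x.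
Proof. by rewrite -scaleN1r dotpZl mulN1r. Qed.

Lemma dotpDr u v x : dotp x (u + v) = dotp x u + dotp x v.
Proof. by rewrite ![dotp x _]dotpC dotpDl. Qed.

Lemma dotpZr (a : R) u x : dotp x (a *: u) = a * dotp x u.
Proof. by rewrite ![dotp x _]dotpC dotpZl. Qed.

Lemma dotpNr u x : dotp x (- u) = - dotp x u.
Proof. by rewrite ![dotp x _]dotpC dotpNl. Qed.

Lemma dotp_delta u i : dotp u (delta_mx 0 i) = u 0 i.
Proof.
rewrite /dotp (bigD1 i)//= mxE !eqxx mulr1 big1 ?addr0// => j ji.
by rewrite mxE (negbTE ji) andbF mulr0.
Qed.

Lemma dotp_ge0 u : 0 <= dotp u u.
Proof. by apply: sumr_ge0 => i _; rewrite -expr2 sqr_ge0. Qed.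

Lemma enorm_sqr u : enorm u ^+ 2 = dotp u u.
Proof. by rewrite sqr_sqrtr// dotp_ge0. Qed.

Lemma enormZ (a : R) u : 0 <= a -> enorm (a *: u) = a * enorm u.
Proof.
move=> a0; rewrite /enorm dotpZl dotpZr mulrA -expr2 sqrtrM ?sqr_ge0//.
by rewrite sqrtr_sqr ger0_norm.
Qed.

Definition quad mu g x : R := mu / 2 * dotp x x - dotp g x.

Lemma derive_quad mu g v x : 'D_v (quad mu g) x = mu * dotp x v - dotp g v.
Proof.
apply: cvg_lim => //.
have H : (fun h : R => (mu * dotp x v - dotp g v) + h * (mu / 2 * dotp v v)) h
    @[h --> 0^'] --> mu * dotp x v - dotp g v.
  rewrite -[X in _ --> X]addr0 -[X in _ --> _ + X](mul0r (mu / 2 * dotp v v)).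
  apply: cvgD; first exact: cvg_cst.
  apply: cvgMl; exact: cvg_within.
apply: cvg_trans H; apply: near_eq_cvg; near=> h.
have h0 : h != 0 by near: h; exact: nbhs_dnbhs_neq.
rewrite /quad /= !(dotpDl, dotpDr, dotpZl, dotpZr) [dotp v x]dotpC.
rewrite /GRing.scale/=; field.
by rewrite h0.
Unshelve. all: by end_near.
Qed.

Lemma differentiable_quad mu g x : differentiable (quad mu g) x.
Proof.
have dc i : differentiable (fun y : 'rV[R]_d => y 0 i) x.
  exact: differentiable_coord.
apply: differentiableB.
  apply: differentiableM => //.
  rewrite (_ : (fun y => dotp y y) = \sum_(i < d) (fun y : 'rV[R]_d => y 0 i * y 0 i)).
    by apply: differentiable_sum => i; exact: differentiableM.
  by apply/funext => y; rewrite fct_sumE.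
rewrite (_ : dotp g = \sum_(i < d) (fun y : 'rV[R]_d => g 0 i * y 0 i)).
  by apply: differentiable_sum => i; exact: differentiableM.
by apply/funext => y; rewrite fct_sumE.
Qed.

Lemma grad_quad mu g x : grad (quad mu g) x = mu *: x - g.
Proof.
by apply/rowP => i; rewrite !mxE derive_quad !dotp_delta.
Qed.

Lemma lipschitz_gradient_quad mu g : 0 <= mu -> lipschitz_gradient mu (quad mu g).
Proof.
move=> mu0; split=> [x|x y]; first exact: differentiable_quad.
rewrite !grad_quad (_ : _ - _ - _ = mu *: (x - y)) ?enormZ//.
by apply/rowP => i; rewrite !mxE; ring.
Qed.

Lemma strongly_convex_quad mu g : strongly_convex mu (quad mu g).
Proof.
split=> [x|x y]; first exact: differentiable_quad.
rewrite grad_quad enorm_sqr /quad.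
rewrite !(dotpDl, dotpDr, dotpNl, dotpNr, dotpZl, dotpZr) [dotp y x]dotpC.
lra.
Qed.

Lemma minimizer_quad mu g : 0 < mu -> minimizer (quad mu g) (mu^-1 *: g).
Proof.
move=> mu0 y.
have := dotp_ge0 (mu *: y - g).
rewrite /quad !(dotpDl, dotpDr, dotpNl, dotpNr, dotpZl, dotpZr) [dotp y g]dotpC.
have m1 : mu * mu^-1 = 1 by rewrite divff// gt_eqF.
set a := dotp y y; set b := dotp g y; set c := dotp g g => h.
rewrite -subr_ge0 -(pmulr_rge0 _ mu0).
rewrite [X in 0 <= X](_ : _ = (mu * (mu * a - b) - (mu * b - c)) / 2).
  by rewrite divr_ge0//; lra.
have -> : mu * (mu / 2 * a - b - (mu / 2 * (mu^-1 * (mu^-1 * c)) - mu^-1 * c)) =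
  mu * mu * a / 2 - mu * b - ((mu * mu^-1) * (mu * mu^-1) * c / 2 - (mu * mu^-1) * c).
  by ring.
by rewrite m1; field.
Qed.

End quadratic.

Section gaussian_moments.
Variable R : realType.
Local Notation RM := (measurableTypeR R).
Local Notation unif := (unif R).

(** The shift formula applied to the constant function 1 gives the Laplace
    transform. *)
Lemma integral_exp_quantile (u : R) :
  (\int[unif]_v (expR (u * quantile v))%:E = (expR (u ^+ 2 / 2))%:E)%E.
Proof.
have me : measurable_fun setT (fun v : RM => expR (u * quantile v) : R).
  apply: measurableT_comp => //; apply: measurable_funM => //.
  exact: measurable_quantileR.
have h := @integral_quantile_shift R (- u) (cst 1%E) (measurable_cst _) (fun _ => lee01).
have e1 : (\int[unif]_x (cst 1%E (quantile x - - u)%R : \bar R))%E = 1%E.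
  exact: integral_prob_cst.
rewrite {}e1 in h.
have h2 : (1 = (expR (- (u ^+ 2 / 2)))%:E * \int[unif]_v (expR (u * quantile v))%:E)%E.
  rewrite -ge0_integralZl//; last exact/measurable_EFinP.
  rewrite {1}h; apply: eq_integral => v _.
  by rewrite mul1e -EFinM -expRD sqrrN; congr ((expR _)%:E); lra.
have : ((expR (u ^+ 2 / 2))%:E * 1 = (expR (u ^+ 2 / 2))%:E * ((expR (- (u ^+ 2 / 2)))%:E * \int[unif]_v (expR (u * quantile v))%:E))%E.
  by rewrite -h2.
by rewrite mule1 muleA -EFinM -expRD subrr expR0 mul1e => ->.
Qed.

(** Bounds the second moment of a Gaussian variable by its Laplace
    transform. *)
Lemma sqr_le_expR (x : R) : x ^+ 2 <= 2 * (expR (1 * x) + expR (-1 * x)).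
Proof.
rewrite mul1r mulN1r.
have H (y : R) : 0 <= y -> y ^+ 2 <= 2 * (expR y + expR (- y)).
  move=> y0; have := expR_ge1Dxn 1 y0; have := expR_ge0 (- y).
  rewrite (_ : 2`!%:R = 2 :> R)//; lra.
have [x0|x0] := leP 0 x; first exact: H.
have := H (- x); rewrite sqrrN opprK [expR x + _]addrC; apply; lra.
Qed.

Lemma integral_sqr_quantile : (\int[unif]_v ((quantile v : R) ^+ 2)%:E < +oo)%E.
Proof.
have me (u : R) : measurable_fun setT (fun v : RM => expR (u * quantile v) : R).
  apply: measurableT_comp => //; apply: measurable_funM => //.
  exact: measurable_quantileR.
apply: (@le_lt_trans _ _ (\int[unif]_v (2%:E * ((expR (1 * quantile v))%:E + (expR (-1 * quantile v))%:E)))%E).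
  apply: ge0_le_integral => //.
  - by move=> v _; rewrite lee_fin sqr_ge0.
  - apply/measurable_EFinP; apply: measurable_funX; exact: measurable_quantileR.
  - by apply: emeasurable_funM => //; apply: emeasurable_funD; apply/measurable_EFinP.
  - by move=> v _; rewrite -EFinD -EFinM lee_fin sqr_le_expR.
rewrite ge0_integralZl//; last 2 first.
- by apply: emeasurable_funD; apply/measurable_EFinP.
- by move=> v _; rewrite adde_ge0// lee_fin expR_ge0.
rewrite ge0_integralD//; try (by move=> v _; rewrite lee_fin expR_ge0);
  try exact/measurable_EFinP.
by rewrite !integral_exp_quantile -EFinD -EFinM ltry.
Qed.

Lemma integrable_quantile : unif.-integrable setT (EFin \o (@quantile R)).
Proof.
apply/integrableP; split.
  by apply/measurable_EFinP; exact: measurable_quantileR.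
apply: (@le_lt_trans _ _ (\int[unif]_v (1 + ((quantile v : R) ^+ 2)%:E))%E).
  apply: ge0_le_integral => //.
  - by apply: measurableT_comp => //; apply/measurable_EFinP; exact: measurable_quantileR.
  - apply: emeasurable_funD => //; apply/measurable_EFinP; apply: measurable_funX.
    exact: measurable_quantileR.
  - move=> v _; rewrite /= -EFinD lee_fin.
    rewrite -[X in _ <= 1 + X]real_normK ?num_real//.
    have := sqr_ge0 (`|quantile v : R| - 1).
    by have := normr_ge0 (quantile v : R); nra.
rewrite ge0_integralD//.
- by rewrite integral_prob_cst lte_add_pinfty// ?ltry// integral_sqr_quantile.
- by move=> v _; rewrite lee_fin sqr_ge0.
- apply/measurable_EFinP; apply: measurable_funX; exact: measurable_quantileR.
Qed.

(** Centring the noise by its mean, whatever its value, makes the oracle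
    unbiased. *)
Definition gmean : R := (\int[unif]_v quantile v)%R.

(** An upper bound on the variance of a coordinate; adding 1 makes its
    positivity immediate. *)
Definition gvar_bound : R := fine (\int[unif]_v ((quantile v - gmean) ^+ 2)%:E)%E + 1.

Lemma measurable_sqr_center : measurable_fun setT (fun v : RM => ((quantile v - gmean) ^+ 2)%:E).
Proof.
apply/measurable_EFinP; apply: measurable_funX; apply: measurable_funB => //.
exact: measurable_quantileR.
Qed.

Lemma gvar_bound_gt0 : 0 < gvar_bound.
Proof.
rewrite ltr_pwDr// fine_ge0// integral_ge0// => v _.
by rewrite lee_fin sqr_ge0.
Qed.

Lemma integral_sqr_center :
  (\int[unif]_v ((quantile v - gmean) ^+ 2)%:E <= gvar_bound%:E)%E.
Proof.
rewrite /gvar_bound; set I := (\int[unif]_v _)%E.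
have I0 : (0 <= I)%E by apply: integral_ge0 => v _; rewrite lee_fin sqr_ge0.
suff fI : (I < +oo)%E.
  by rewrite EFinD fineK ?ge0_fin_numE// leeDl// lee01.
apply: (@le_lt_trans _ _ (\int[unif]_v (2%:E * ((quantile v : R) ^+ 2)%:E + (2 * gmean ^+ 2)%:E))%E).
  apply: ge0_le_integral => //.
  - by move=> v _; rewrite lee_fin sqr_ge0.
  - exact: measurable_sqr_center.
  - apply: emeasurable_funD => //; apply: emeasurable_funM => //.
    apply/measurable_EFinP; apply: measurable_funX; exact: measurable_quantileR.
  - move=> v _; rewrite -EFinM -EFinD lee_fin.
    have := sqr_ge0 (quantile v + gmean); nra.
have ms : measurable_fun setT (fun v : RM => ((quantile v : R) ^+ 2)%:E).
  apply/measurable_EFinP; apply: measurable_funX; exact: measurable_quantileR.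
rewrite ge0_integralD//; last 3 first.
- by move=> v _; rewrite -EFinM lee_fin mulr_ge0// sqr_ge0.
- exact: emeasurable_funM.
- by move=> v _; rewrite lee_fin mulr_ge0// sqr_ge0.
rewrite integral_prob_cst lte_add_pinfty// ?ltry//.
rewrite ge0_integralZl//; last by move=> v _; rewrite lee_fin sqr_ge0.
by rewrite lte_mul_pinfty// integral_sqr_quantile.
Qed.

Lemma ge0_integral_gvec_coord d (i : 'I_d) (f : R -> \bar R) :
  measurable_fun setT f -> (forall x, 0 <= f x)%E ->
  (\int[unif]_v f (tnth (gvec d v) i) = \int[unif]_v f (quantile v))%E.
Proof.
move=> mf f0; elim: d i => [[]//|d IH] i.
have mq : measurable_fun setT (fun v : RM => f (quantile v)).
  exact: measurableT_comp mf (@measurable_quantileR R).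
case: (unliftP ord0 i) => [j|] ->.
  have mg : measurable_fun setT (fun v : RM => f (tnth (gvec d v) j)).
    apply: (measurableT_comp mf).
    exact: (measurable_fun_tnthP _).1 (@measurable_gvec R d) j.
  transitivity (\int[unif]_v (fun p : RM * RM => f (tnth (gvec d p.2) j)) (bisect v))%E.
    by apply: eq_integral => v _; rewrite /= tnthS.
  rewrite (@integral_bisect R (fun p => f (tnth (gvec d p.2) j)))//.
    apply: eq_trans (IH j).
    exact: (integral_prob_cst unif (\int[unif]_v f (tnth (gvec d v) j))%E).
  exact: measurableT_comp mg measurable_snd.
transitivity (\int[unif]_v (fun p : RM * RM => f (quantile p.1)) (bisect v))%E.
  by apply: eq_integral => v _; rewrite /= tnth0.
rewrite (@integral_bisect R (fun p => f (quantile p.1)))//.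
  apply: eq_integral => x _; exact: (integral_prob_cst unif (f (quantile x))).
exact: measurableT_comp mq measurable_fst.
Qed.

End gaussian_moments.

Section instance.
Variables (R : realType) (d tau : nat) (mu sigma rho : R) (theta : 'rV[R]_d).
Hypotheses (d0 : (0 < d)%N) (tau0 : (0 < tau)%N) (mu0 : 0 < mu) (sigma0 : 0 < sigma).
Hypotheses (rho0 : 0 < rho) (rho1 : rho <= 1) (rhotau : (1 - rho) ^+ tau <= 1 / 4).
Local Notation RM := (measurableTypeR R).
Local Notation BR := (borel (line R)).
Local Notation unif := (unif R).

Let rho01 : 0 <= rho <= 1. Proof. by rewrite ltW. Qed.

(** Chosen so that the [d] coordinates of the gradient noise have total
    variance at most [sigma ^+ 2]. *)
Definition noise_scale : R := sigma / Num.sqrt (d%:R * gvar_bound R).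

Local Notation s := noise_scale.

Lemma noise_scale_sqr : s ^+ 2 * (d%:R * gvar_bound R) = sigma ^+ 2.
Proof.
have dg : 0 < d%:R * gvar_bound R by rewrite mulr_gt0 ?ltr0n// gvar_bound_gt0.
by rewrite /noise_scale expr_div_n sqr_sqrtr ?ltW// divfK// gt_eqF.
Qed.

Lemma noise_scale_gt0 : 0 < s.
Proof. by rewrite divr_gt0// sqrtr_gt0 mulr_gt0 ?ltr0n// gvar_bound_gt0. Qed.

Definition center_coord (i : 'I_d) (z : RM) : R := tnth (gvec d z) i - gmean R.

Definition noise (z : RM) : 'rV[R]_d := \row_i center_coord i z.

(** The noise enters through the linear term, so that the gradient noise is
    the same at every point and all losses have the same Hessian. *)
Definition two_point_loss (x : 'rV[R]_d) (z : BR) : R :=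
  quad mu (theta + s *: noise z) x.

Lemma measurable_center_coord i : measurable_fun setT (center_coord i : RM -> R).
Proof.
apply: measurable_funB => //.
exact: (measurable_fun_tnthP _).1 (@measurable_gvec R d) i.
Qed.

Lemma integral_center_coord i (f : R -> \bar R) : measurable_fun setT f ->
  (\int[unif]_v f (center_coord i v) = \int[unif]_v f (quantile v - gmean R)%R)%E.
Proof.
move=> mf; rewrite integralE [RHS]integralE; congr (_ - _)%E.
  have mp : measurable_fun setT (fun x : R => f^\+ (x - gmean R)%R)%E.
    by apply: (measurableT_comp (measurable_funepos mf)); exact: measurable_funB.
  apply: eq_trans (eq_trans (ge0_integral_gvec_coord i mp (fun x => funepos_ge0 _ _)) _);
    by apply: eq_integral => v _; rewrite !funeposE.
have mn : measurable_fun setT (fun x : R => f^\- (x - gmean R)%R)%E.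
  by apply: (measurableT_comp (measurable_funeneg mf)); exact: measurable_funB.
apply: eq_trans (eq_trans (ge0_integral_gvec_coord i mn (fun x => funeneg_ge0 _ _)) _);
  by apply: eq_integral => v _; rewrite !funenegE.
Qed.

Lemma integrable_center_coord i : unif.-integrable setT (EFin \o center_coord i).
Proof.
apply/integrableP; split.
  by apply/measurable_EFinP; exact: measurable_center_coord.
rewrite (@integral_center_coord i (fun x => `|x%:E|)%E); last first.
  by apply: measurableT_comp => //; exact/measurable_EFinP.
have : unif.-integrable setT (fun v => (quantile v - gmean R)%:E).
  under eq_fun do rewrite EFinB.
  apply: integrableB => //; first exact: integrable_quantile.
  exact: finite_measure_integrable_cst.
by move=> /integrableP[].
Qed.

Lemma integral_center_coord0 i : (\int[unif]_v (center_coord i v)%:E = 0)%E.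
Proof.
rewrite (@integral_center_coord i EFin); last exact/measurable_EFinP.
under eq_integral do rewrite EFinB.
rewrite integralB//; last 2 first.
- exact: integrable_quantile.
- exact: finite_measure_integrable_cst.
rewrite integral_prob_cst /gmean /Rintegral fineK ?subee//.
  exact: (integrable_fin_num measurableT (integrable_quantile R)).
exact: (integrable_fin_num measurableT (integrable_quantile R)).
Qed.

Lemma integral_pi (f : BR -> \bar R) : measurable_fun setT (f : RM -> \bar R) ->
  (\int[pi_line R]_z f z = \int[unif]_z f z)%E.
Proof.
move=> /measurable_from_line mf; rewrite integralE [RHS]integralE; congr (_ - _)%E.
  by rewrite integral_pi_line//; exact: measurable_funepos.
by rewrite integral_pi_line//; exact: measurable_funeneg.
Qed.

Lemma integrable_pi (f : BR -> \bar R) : unif.-integrable setT (f : RM -> \bar R) ->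
  (pi_line R).-integrable setT f.
Proof.
move=> /integrableP[mf fi]; apply/integrableP; split.
  exact: measurable_from_line.
by rewrite integral_pi//; exact: measurableT_comp.
Qed.

Lemma integrable_affine (a : R) (b : 'I_d -> R) :
  unif.-integrable setT (fun z => (a - \sum_(i < d) b i * center_coord i z)%:E).
Proof.
under eq_fun do rewrite EFinB.
apply: integrableB => //; first exact: finite_measure_integrable_cst.
under eq_fun do rewrite -sumEFin.
apply: integrable_sum => // i _.
under eq_fun do rewrite EFinM.
apply: integrableZl => //; exact: integrable_center_coord.
Qed.

Lemma integral_affine (a : R) (b : 'I_d -> R) :
  (\int[unif]_z (a - \sum_(i < d) b i * center_coord i z)%:E = a%:E)%E.
Proof.
under eq_integral do rewrite EFinB.
have ib i : unif.-integrable setT (fun z => (b i * center_coord i z)%:E).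
  under eq_fun do rewrite EFinM.
  apply: integrableZl => //; exact: integrable_center_coord.
rewrite integralB//; last 2 first.
- exact: finite_measure_integrable_cst.
- under eq_fun do rewrite -sumEFin.
  exact: integrable_sum.
rewrite integral_prob_cst.
under eq_integral do rewrite -sumEFin.
rewrite integral_sum// big1 ?sube0// => i _.
under eq_integral do rewrite EFinM.
by rewrite integralZl ?integral_center_coord0 ?mule0//; exact: integrable_center_coord.
Qed.

Lemma two_point_lossE x z : two_point_loss x z =
  quad mu theta x - \sum_(i < d) (s * x 0 i) * center_coord i z.
Proof.
rewrite /two_point_loss /quad dotpDl dotpZl opprD addrA; congr (_ - _).
rewrite /dotp mulr_sumr; apply: eq_bigr => i _; rewrite mxE; ring.
Qed.

Lemma grad_two_point_lossE x z i : grad (two_point_loss ^~ z) x 0 i =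
  (mu *: x - theta) 0 i - \sum_(j < d) (s * (j == i)%:R) * center_coord j z.
Proof.
rewrite grad_quad !mxE (bigD1 i)//= eqxx big1 ?addr0.
  by rewrite mulr1; ring.
by move=> j /negbTE ->; rewrite mulr0 mul0r.
Qed.

Lemma two_point_loss_integrable x :
  (pi_line R).-integrable setT (EFin \o two_point_loss x).
Proof.
apply: integrable_pi; rewrite (_ : EFin \o _ = fun z : RM =>
  (quad mu theta x - \sum_(i < d) (s * x 0 i) * center_coord i z)%:E).
  exact: integrable_affine.
by apply/funext => z /=; rewrite two_point_lossE.
Qed.

Lemma two_point_loss_smooth :
  exists2 L : R, 0 < L & forall z, lipschitz_gradient L (two_point_loss ^~ z).
Proof. by exists mu => // z; apply: lipschitz_gradient_quad; exact: ltW. Qed.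

Lemma two_point_objective :
  (fun x => \int[pi_line R]_z two_point_loss x z)%R = quad mu theta.
Proof.
apply/funext => x; rewrite /Rintegral integral_pi.
  under eq_integral do rewrite two_point_lossE.
  by rewrite integral_affine.
under eq_fun do rewrite two_point_lossE.
exact: measurable_int (integrable_affine _ _).
Qed.

Lemma two_point_objective_convex :
  strongly_convex mu (fun x => \int[pi_line R]_z two_point_loss x z)%R.
Proof. rewrite two_point_objective; exact: strongly_convex_quad. Qed.

Lemma two_point_grad_integrable x i : (pi_line R).-integrable setT
  (fun z => (grad (two_point_loss ^~ z) x 0 i)%:E).
Proof.
apply: integrable_pi.
under eq_fun do rewrite grad_two_point_lossE.
exact: integrable_affine.
Qed.

Lemma two_point_grad_unbiased x i :
  (\int[pi_line R]_z grad (two_point_loss ^~ z) x 0 i)%R =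
  grad (fun x => \int[pi_line R]_z two_point_loss x z)%R x 0 i.
Proof.
rewrite two_point_objective grad_quad /Rintegral integral_pi.
  under eq_integral do rewrite grad_two_point_lossE.
  by rewrite integral_affine.
under eq_fun do rewrite grad_two_point_lossE.
exact: measurable_int (integrable_affine _ _).
Qed.

Lemma two_point_grad_variance x :
  (\int[pi_line R]_z (enorm (grad (two_point_loss ^~ z) x -
     grad (fun x => \int[pi_line R]_z two_point_loss x z)%R x) ^+ 2)%:E
    <= (sigma ^+ 2)%:E)%E.
Proof.
have E z : enorm (grad (two_point_loss ^~ z) x -
     grad (fun x => \int[pi_line R]_z two_point_loss x z)%R x) ^+ 2 =
     \sum_(i < d) s ^+ 2 * center_coord i z ^+ 2.
  rewrite enorm_sqr two_point_objective !grad_quad.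
  apply: eq_bigr => i _; rewrite !mxE; ring.
under eq_integral do rewrite E -sumEFin.
have mc i : measurable_fun setT (fun z : RM => (s ^+ 2 * center_coord i z ^+ 2)%:E).
  apply/measurable_EFinP; apply: measurable_funM => //; apply: measurable_funX.
  exact: measurable_center_coord.
rewrite integral_pi; last exact: emeasurable_sum.
rewrite ge0_integral_sum//; last first.
  by move=> i z _; rewrite lee_fin mulr_ge0// sqr_ge0.
apply: (@le_trans _ _ (\sum_(i < d) (s ^+ 2 * gvar_bound R)%:E)%E).
  apply: lee_sum => i _.
  under eq_integral do rewrite EFinM.
  rewrite ge0_integralZl ?lee_fin ?sqr_ge0//; last 2 first.
  - apply/measurable_EFinP; apply: measurable_funX; exact: measurable_center_coord.
  - by move=> z _; rewrite lee_fin sqr_ge0.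
  rewrite [leRHS]EFinM lee_pmul2l ?lte_fin ?exprn_gt0 ?noise_scale_gt0//.
  rewrite (@integral_center_coord i (fun y => (y ^+ 2)%:E)).
    exact: integral_sqr_center.
  apply/measurable_EFinP; exact: measurable_funX.
by rewrite sumEFin sumr_const card_ord lee_fin -noise_scale_sqr -mulr_natl; nra.
Qed.

Definition hard_instance : two_point_instance d tau mu sigma := {|
  state_space := line R;
  state_space_separable := line_separable R;
  transition := lazy rho01;
  inv_law := pi_line R;
  inv_law_unique := lazy_unique_invariant rho01 rho0;
  transition_mixing := lazy_mixing rho01 tau0 rhotau;
  Omega_law := unif;
  chain := lazy_chain rho;
  chain_stationary := lazy_stationary rho01;
  loss := two_point_loss;
  loss_integrable := two_point_loss_integrable;
  loss_smooth := two_point_loss_smooth;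
  objective_strongly_convex := two_point_objective_convex;
  loss_grad_integrable := two_point_grad_integrable;
  loss_grad_unbiased := two_point_grad_unbiased;
  loss_grad_variance := two_point_grad_variance
|}.

Lemma minimizer_hard_instance : minimizer (objective hard_instance) (mu^-1 *: theta).
Proof.
rewrite [objective _]two_point_objective; exact: minimizer_quad.
Qed.

End instance.

(** * One step of the translated experiment *)

Section tilt_step.
Context {R : realType} {d} {Omega : measurableType d} (P : probability Omega R).
Variables (rho : R) (rho01 : 0 <= rho <= 1).
Local Notation RM := (measurableTypeR R).
Local Notation unif := (unif R).
Context d1 d2 (C : measurableType d1) (C' : measurableType d2).
Variables (Y : Omega -> C) (tail : Omega -> RM) (fY : fresh P Y tail).
Variables (flow : C -> C) (flow' : C' -> C') (e : C -> R) (e' : C' -> R).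
Variables (hold : C -> C') (renew : C * RM -> C') (q : C * RM -> R).
Hypotheses (mflow' : measurable_fun setT flow') (me' : measurable_fun setT e').
Hypotheses (mhold : measurable_fun setT hold) (mrenew : measurable_fun setT renew).
Hypothesis (mq : measurable_fun setT q).
Hypotheses (e0 : forall c, 0 <= e c) (e'0 : forall c, 0 <= e' c).
Hypothesis q0 : forall p, 0 <= q p.
Hypothesis flow_hold : rho < 1 -> forall c, hold (flow c) = flow' (hold c).
Hypothesis flow_renew : forall c (f : C' -> \bar R), measurable_fun setT f ->
  (forall x, 0 <= f x)%E ->
  (\int[unif]_v f (flow' (renew (c, v))) =
   \int[unif]_v (f (renew (flow c, v)) * (q (flow c, v))%:E))%E.
Hypothesis e_hold : forall c, e' (hold c) = e c.
Hypothesis e_renew : forall c v, e' (renew (c, v)) = e c * q (c, v).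
Hypothesis tiltY : forall f : C -> \bar R, measurable_fun setT f ->
  (forall x, 0 <= f x)%E ->
  (\int[P]_w f (flow (Y w)) = \int[P]_w (f (Y w) * (e (Y w))%:E))%E.

Definition advance (p : C * (bool * RM)) : C' :=
  if p.2.1 then renew (p.1, p.2.2) else hold p.1.

Lemma measurable_advance : measurable_fun setT advance.
Proof.
apply: measurable_fun_ifT.
- exact: measurableT_comp measurable_fst measurable_snd.
- apply: (measurableT_comp mrenew); apply: measurable_fun_pair => //.
  exact: measurableT_comp measurable_snd measurable_snd.
- exact: measurableT_comp mhold measurable_fst.
Qed.

(** A map [flow] transports the law of [Y] to the one of density [e]. The
    next state is either [hold Y] or [renew (Y, v)] with a fresh uniform
    [v]. If holding commutes with the flows, and renewing commutes with
    them up to the density [q] contributed by [v], then the law of the next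
    state is transported to the density [e'], the product of [e] with the
    [q] of the renewals. *)
Lemma tilt_advance (f : C' -> \bar R) : measurable_fun setT f ->
  (forall x, 0 <= f x)%E ->
  (\int[P]_w f (flow' (advance (Y w, (draw rho (tail w)).1))) =
   \int[P]_w (f (advance (Y w, (draw rho (tail w)).1)) *
     (e' (advance (Y w, (draw rho (tail w)).1)))%:E))%E.
Proof.
move=> mf f0; have /andP[r0 r1] := rho01.
have r10 : (0 <= (1 - rho)%:E :> \bar R)%E by rewrite lee_fin subr_ge0.
have mfq : measurable_fun setT (fun p : C * RM => f (renew p) * (q p)%:E)%E.
  apply: emeasurable_funM; first exact: measurableT_comp mf mrenew.
  exact/measurable_EFinP.
have fq0 p : (0 <= f (renew p) * (q p)%:E)%E by rewrite mule_ge0// lee_fin.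
pose F c : \bar R := (\int[unif]_v (f (renew (c, v)) * (q (c, v))%:E))%E.
have mF : measurable_fun setT F by exact: (measurable_integral_unif mfq).
have F0 c : (0 <= F c)%E by apply: integral_ge0 => v _; exact: fq0.
pose Psi c : \bar R := ((1 - rho)%:E * f (hold c) + rho%:E * F c)%E.
have mPsi : measurable_fun setT Psi.
  apply: emeasurable_funD; apply: emeasurable_funM => //.
  exact: measurableT_comp mf mhold.
have Psi0 c : (0 <= Psi c)%E by rewrite adde_ge0// mule_ge0// lee_fin.
have mA1 : measurable_fun setT (fun p => f (flow' (advance p))).
  exact: measurableT_comp (measurableT_comp mf mflow') measurable_advance.
have mA2 : measurable_fun setT (fun p => f (advance p) * (e' (advance p))%:E)%E.
  apply: emeasurable_funM; first exact: measurableT_comp mf measurable_advance.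
  by apply/measurable_EFinP; exact: measurableT_comp me' measurable_advance.
have A20 p : (0 <= f (advance p) * (e' (advance p))%:E)%E.
  by rewrite mule_ge0// lee_fin.
apply: (eq_trans (integral_fresh_draw rho01 fY mA1 (fun p => f0 _))).
transitivity (\int[P]_w Psi (flow (Y w)))%E.
  apply: eq_integral => w _; congr (_ + _)%E; last first.
    by congr (_ * _)%E; exact: flow_renew.
  have [rlt|rge] := ltP rho 1.
    congr (_ * _)%E; rewrite flow_hold//.
    exact: (integral_prob_cst unif (f (flow' (hold (Y w))))).
  have -> : 1 - rho = 0 by lra.
  by rewrite !mul0e.
rewrite tiltY//.
apply: (eq_trans _ (esym (integral_fresh_draw rho01 fY mA2 A20))).
apply: eq_integral => w _; rewrite /Psi ge0_muleDl ?mule_ge0 ?lee_fin//.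
congr (_ + _)%E; rewrite -muleA; congr (_ * _)%E.
  apply: (eq_trans _ (esym (integral_prob_cst unif (f (hold (Y w)) * (e' (hold (Y w)))%:E)%E))).
  by rewrite e_hold.
rewrite /F -ge0_integralZr//; last first.
- by rewrite lee_fin.
- exact: measurableT_comp mfq (@measurable_pair1 _ _ _ _ (Y w)).
apply: eq_integral => v _; rewrite /advance/= e_renew -muleA -EFinM.
by rewrite mulrC.
Qed.

End tilt_step.

(** * The van Trees inequality with a finite shift *)

Section van_trees.
Context {R : realType} {d} {Omega : measurableType d} (P : probability Omega R).
Variables (err S I : Omega -> R) (B t al : R).
Hypotheses (merr : measurable_fun setT err) (mS : measurable_fun setT S).
Hypothesis (mI : measurable_fun setT I).
Hypotheses (I0 : forall w, 0 <= I w) (IB : forall w, I w <= B).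
Hypotheses (t0 : 0 < t) (al0 : 0 < al) (tB : t ^+ 2 * B <= 2^-1).

(** The density of the translated experiment; [S] and [I] stand for the
    Gaussian score and information. *)
Definition likelihood (t : R) (w : Omega) : R := expR (- t * S w - t ^+ 2 * I w / 2).

(** The experiment translated by [t] moves the error by [- t], and the one
    translated by [2 * t] leaves the law of the information unchanged. *)
Hypothesis tilt_err : forall f : R -> \bar R, measurable_fun setT f ->
  (forall x, 0 <= f x)%E ->
  (\int[P]_w (f (err w) * (likelihood t w)%:E) = \int[P]_w f (err w - t)%R)%E.
Hypothesis tilt_info :
  (\int[P]_w ((expR (t ^+ 2 * I w))%:E * (likelihood (2 * t) w)%:E) =
   \int[P]_w (expR (t ^+ 2 * I w))%:E)%E.

Local Notation L := (likelihood t).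

Lemma measurable_likelihood u : measurable_fun setT (likelihood u).
Proof.
apply: measurableT_comp => //; apply: measurable_funB.
  exact: measurable_funM.
by apply: measurable_funM => //; exact: measurable_funM.
Qed.

Lemma likelihood_ge0 u w : 0 <= likelihood u w. Proof. exact: expR_ge0. Qed.

Lemma likelihood_sqr w : L w ^+ 2 = expR (t ^+ 2 * I w) * likelihood (2 * t) w.
Proof.
rewrite expr2 -!expRD; congr expR; lra.
Qed.

Lemma integral_likelihood : (\int[P]_w (L w)%:E = 1)%E.
Proof.
have := @tilt_err (cst 1%E) (measurable_cst _) (fun _ => lee01).
rewrite [RHS](_ : _ = 1%E); last exact: integral_prob_cst.
by move=> <-; apply: eq_integral => w _; rewrite mul1e.
Qed.

Lemma expR_le_double (x : R) : 0 <= x <= 2^-1 -> expR x <= 1 + 2 * x.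
Proof.
move=> /andP[x0 x1].
have h := expR_ge1Dx (- x); have := expR_gt0 x.
have : expR x * expR (- x) = 1 by rewrite -expRD subrr expR0.
nra.
Qed.

(** By [likelihood_sqr] the second moment of L is the mean of exp (t^2 I)
    in the experiment translated by 2t, where I has the same law as before. *)
Lemma integral_likelihood_sqr :
  (\int[P]_w ((L w) ^+ 2)%:E <= 1 + (2 * t ^+ 2)%:E * \int[P]_w (I w)%:E)%E.
Proof.
have mI2 : measurable_fun setT (fun w => (I w)%:E) by exact/measurable_EFinP.
under eq_integral do rewrite likelihood_sqr EFinM.
rewrite tilt_info.
apply: (@le_trans _ _ (\int[P]_w (1 + (2 * t ^+ 2)%:E * (I w)%:E))%E).
  apply: ge0_le_integral => //.
  - by apply/measurable_EFinP; apply: measurableT_comp => //; exact: measurable_funM.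
  - by apply: emeasurable_funD => //; exact: emeasurable_funM.
  - move=> w _; rewrite -EFinM -EFinD lee_fin.
    apply: (le_trans (expR_le_double _)); last by rewrite mulrA.
    rewrite mulr_ge0 ?sqr_ge0//=; apply: le_trans tB.
    by rewrite ler_wpM2l ?sqr_ge0.
rewrite ge0_integralD//; last 2 first.
- by move=> w _; rewrite mule_ge0// lee_fin// mulr_ge0// sqr_ge0.
- exact: emeasurable_funM.
rewrite integral_prob_cst leeD2l// ge0_integralZl//.
  by move=> w _; rewrite lee_fin.
by rewrite lee_fin mulr_ge0// sqr_ge0.
Qed.

Let A : \bar R := (\int[P]_w ((err w) ^+ 2)%:E)%E.
Let J : \bar R := (\int[P]_w (I w)%:E)%E.

(** The means of the error under the two experiments differ by t, that is t
    = E [err (1 - L)]. Splitting the product as al/2 err^2 + (1 - L)^2 / (2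
    al), it remains to bound E (1 - L)^2 = E L^2 - 1. The weight [al] is
    left free: it is optimized after summing over coordinates. *)
Lemma van_trees : (t%:E <= (al / 2)%:E * A + (t ^+ 2 / al)%:E * J)%E.
Proof.
have A0 : (0 <= A)%E by apply: integral_ge0 => w _; rewrite lee_fin sqr_ge0.
have J0 : (0 <= J)%E by apply: integral_ge0 => w _; rewrite lee_fin.
have JB : (J < +oo)%E.
  apply: (@le_lt_trans _ _ (\int[P]_w B%:E)%E).
    apply: ge0_le_integral => //; try exact/measurable_EFinP;
      by move=> w _; rewrite lee_fin.
  by rewrite integral_prob_cst ltry.
(* The inequality is trivial for an estimator of infinite risk; otherwise all
   the integrals below are finite. *)
have [Aoo|Afin] := eqVneq A +oo%E.
  rewrite Aoo gt0_muley ?lte_fin ?divr_gt0// addye ?leey//.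
  by rewrite gt_eqF// (lt_le_trans (ltNyr 0))// mule_ge0// lee_fin divr_ge0 ?sqr_ge0// ltW.
have {Afin} Afin : (A < +oo)%E by rewrite ltey.
have mL := measurable_likelihood t.
have mA : measurable_fun setT (fun w => (err w ^+ 2)%:E).
  by apply/measurable_EFinP; exact: measurable_funX.
have mL2 : measurable_fun setT (fun w => (L w ^+ 2)%:E).
  by apply/measurable_EFinP; exact: measurable_funX.
have Lfin : (\int[P]_w ((L w) ^+ 2)%:E < +oo)%E.
  apply: le_lt_trans integral_likelihood_sqr _.
  rewrite lte_add_pinfty ?ltry// lte_mul_pinfty//.
  by rewrite lee_fin mulr_ge0// sqr_ge0.
have iA : P.-integrable setT (fun w => (err w ^+ 2)%:E).
  apply/integrableP; split => //.
  by under eq_integral do rewrite gee0_abs ?lee_fin ?sqr_ge0//.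
have iL2 : P.-integrable setT (fun w => (L w ^+ 2)%:E).
  apply/integrableP; split => //.
  by under eq_integral do rewrite gee0_abs ?lee_fin ?sqr_ge0//.
have i1 (c : R) : P.-integrable setT (fun w => c%:E) by exact: finite_measure_integrable_cst.
have ierr : P.-integrable setT (fun w => (err w)%:E).
  have i2 : P.-integrable setT (fun w => (1 + err w ^+ 2)%:E).
    by under eq_fun do rewrite EFinD; exact: integrableD (i1 1) iA.
  apply: (le_integrable measurableT _ _ i2); first exact/measurable_EFinP.
  move=> w _; rewrite !abse_EFin lee_fin (ger0_norm (_ : 0 <= 1 + _)); last first.
    by rewrite addr_ge0// sqr_ge0.
  rewrite -[X in _ <= 1 + X]real_normK ?num_real//.
  have := sqr_ge0 (`|err w| - 1); have := normr_ge0 (err w); nra.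
have iL : P.-integrable setT (fun w => (L w)%:E).
  apply/integrableP; split; first exact/measurable_EFinP.
  under eq_integral do rewrite gee0_abs ?lee_fin ?likelihood_ge0//.
  by rewrite integral_likelihood ltry.
have ieL : P.-integrable setT (fun w => (err w * L w)%:E).
  have i2 : P.-integrable setT (fun w => (err w ^+ 2 + L w ^+ 2)%:E).
    by under eq_fun do rewrite EFinD; exact: integrableD iA iL2.
  apply: (le_integrable measurableT _ _ i2).
    by apply/measurable_EFinP; exact: measurable_funM.
  move=> w _; rewrite !abse_EFin lee_fin (ger0_norm (_ : 0 <= _ ^+ 2 + _)); last first.
    by rewrite addr_ge0// sqr_ge0.
  rewrite normrM -[X in _ <= X + _]real_normK ?num_real//.
  rewrite -[X in _ <= _ + X]real_normK ?num_real//.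
  have := sqr_ge0 (`|err w| - `|L w|).
  have := normr_ge0 (err w); have := normr_ge0 (L w); nra.
have shift : (\int[P]_w (err w * L w)%:E = \int[P]_w (err w - t)%:E)%E.
  rewrite integralE [RHS]integralE.
  have mp : measurable_fun setT ((EFin : R -> \bar R)^\+)%E.
    by apply: measurable_funepos; exact/measurable_EFinP.
  have mn : measurable_fun setT ((EFin : R -> \bar R)^\-)%E.
    by apply: measurable_funeneg; exact/measurable_EFinP.
  congr (_ - _)%E.
    apply: eq_trans (eq_trans (tilt_err mp (fun x => funepos_ge0 _ _)) _).
      apply: eq_integral => w _; rewrite !funeposE EFinM.
      by rewrite maxe_pMl ?mul0e// lee_fin likelihood_ge0.
    by apply: eq_integral => w _; rewrite !funeposE.
  apply: eq_trans (eq_trans (tilt_err mn (fun x => funeneg_ge0 _ _)) _).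
    apply: eq_integral => w _; rewrite !funenegE EFinM -mulNe.
    by rewrite maxe_pMl ?mul0e// lee_fin likelihood_ge0.
  by apply: eq_integral => w _; rewrite !funenegE.
have key : (t%:E = \int[P]_w (err w * (1 - L w))%:E)%E.
  under eq_integral do rewrite mulrBr mulr1 EFinB.
  rewrite integralB// shift.
  under [X in (_ - X)%E]eq_integral do rewrite EFinB.
  rewrite integralB// integral_prob_cst.
  have fe := integrable_fin_num measurableT ierr.
  by rewrite oppeB ?fin_num_adde_defl// addeA subee// add0e.
rewrite key.
have sq0 : (\int[P]_w ((1 - L w) ^+ 2)%:E <= (2 * t ^+ 2)%:E * J)%E.
  have h : (\int[P]_w ((1 - L w) ^+ 2)%:E = \int[P]_w (1 + (L w ^+ 2)%:E - (2 * L w)%:E))%E.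
    apply: eq_integral => w _; rewrite (_ : (1 - L w) ^+ 2 = 1 + L w ^+ 2 - 2 * L w); last by ring.
    by rewrite EFinB EFinD.
  rewrite h integralB//; last 2 first.
  - exact: integrableD.
  - by under eq_fun do rewrite EFinM; exact: integrableZl.
  rewrite integralD// integral_prob_cst.
  under [X in (_ - X)%E]eq_integral do rewrite EFinM.
  rewrite integralZl// integral_likelihood mule1.
  rewrite leeBlDr// (le_trans (leeD2l _ integral_likelihood_sqr))//.
  by rewrite addeA addeC -EFinD.
apply: (@le_trans _ _ (\int[P]_w ((al / 2)%:E * (err w ^+ 2)%:E + (2 * al)^-1%:E * ((1 - L w) ^+ 2)%:E))%E).
  apply: le_integral => //.
  - under eq_fun do rewrite mulrBr mulr1 EFinB; exact: integrableB.
  - apply: integrableD => //; first exact: integrableZl.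
    apply: integrableZl => //; apply/integrableP; split.
      by apply/measurable_EFinP; apply: measurable_funX; exact: measurable_funB.
    under eq_integral do rewrite gee0_abs ?lee_fin ?sqr_ge0//.
    apply: le_lt_trans sq0 _; rewrite lte_mul_pinfty//.
    by rewrite lee_fin mulr_ge0// sqr_ge0.
  - move=> w _; rewrite -!EFinM -EFinD lee_fin.
    have := sqr_ge0 (al * err w - (1 - L w)); set x := err w; set y := 1 - L w => h.
    have -> : al / 2 * x ^+ 2 + (2 * al)^-1 * y ^+ 2 = x * y + (al * x - y) ^+ 2 / (2 * al).
      by field; rewrite gt_eqF.
    by rewrite lerDl divr_ge0// mulr_ge0// ltW.
rewrite ge0_integralD//; last 4 first.
- by move=> w _; rewrite -EFinM lee_fin mulr_ge0 ?sqr_ge0// divr_ge0// ltW.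
- exact: emeasurable_funM.
- by move=> w _; rewrite -EFinM lee_fin mulr_ge0 ?sqr_ge0// invr_ge0 mulr_ge0// ltW.
- apply: emeasurable_funM => //; apply/measurable_EFinP; apply: measurable_funX.
  exact: measurable_funB.
have al2 : 0 <= (2 * al)^-1 by rewrite invr_ge0 mulr_ge0// ltW.
rewrite !ge0_integralZl//; try (by move=> w _; rewrite lee_fin sqr_ge0).
- rewrite leeD2l//; apply: le_trans (lee_wpmul2l _ sq0) _; first by rewrite lee_fin.
  rewrite muleA -EFinM (_ : (2 * al)^-1 * (2 * t ^+ 2) = t ^+ 2 / al)//.
  by field; rewrite gt_eqF.
- by apply/measurable_EFinP; apply: measurable_funX; exact: measurable_funB.
- by rewrite lee_fin divr_ge0// ltW.
Qed.

End van_trees.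

(** * The transcript of an adaptive experiment *)

Lemma measurable_rcons d1 d2 (T1 : measurableType d1) (T2 : measurableType d2) n
    (f : T1 -> n.-tuple T2) (g : T1 -> T2) :
  measurable_fun setT f -> measurable_fun setT g ->
  measurable_fun setT (fun x => [tuple of rcons (f x) (g x)] : n.+1.-tuple T2).
Proof.
move=> /measurable_fun_tnthP mf mg; apply/measurable_fun_tnthP => i.
have [ni|ni] := ltnP i n.
  rewrite (_ : _ \o _ = (fun t => tnth t (Ordinal ni)) \o f); first exact: mf.
  by apply/funext => x /=; rewrite !(tnth_nth (g x)) /= nth_rcons size_tuple ni.
rewrite (_ : _ \o _ = g)//; apply/funext => x /=.
rewrite (tnth_nth (g x)) /= nth_rcons size_tuple ltnNge ni /=.
by case: ifP.
Qed.

Section gaussian_shift.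
Context {R : realType} {d : nat}.
Local Notation RM := (measurableTypeR R).
Local Notation unif := (unif R).
Implicit Types (u v w : d.-tuple R).

Definition tscale (t : R) u : d.-tuple R := [tuple t * tnth u i | i < d].

Lemma tshift_scale t u w : tshift 1 (tscale t u) w = tshift t u w.
Proof. by apply: eq_from_tnth => i; rewrite !tnth_mktuple mul1r. Qed.

Lemma tdotZl t u w : tdot (tscale t u) w = t * tdot u w.
Proof.
by rewrite /tdot mulr_sumr; apply: eq_bigr => i _; rewrite tnth_mktuple mulrA.
Qed.

Lemma tdotC u w : tdot u w = tdot w u.
Proof. by apply: eq_bigr => i _; rewrite mulrC. Qed.

Lemma tdot_ge0 u : 0 <= tdot u u.
Proof. by apply: sumr_ge0 => i _; rewrite -expr2 sqr_ge0. Qed.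

Lemma tdot_shift t u w : tdot u (tshift t u w) = tdot u w - t * tdot u u.
Proof.
rewrite /tdot mulr_sumr -sumrB; apply: eq_bigr => i _; rewrite tnth_mktuple; ring.
Qed.

Lemma tilt_scale t u w :
  tilt (tscale t u) w = expR (- t * tdot u w - t ^+ 2 * tdot u u / 2).
Proof.
rewrite /tilt !tdotZl (tdotC u (tscale _ _)) tdotZl; congr expR; ring.
Qed.

Lemma integral_gvec_scaled_shift t u (f : d.-tuple R -> \bar R) :
  measurable_fun setT f -> (forall x, 0 <= f x)%E ->
  (\int[unif]_v f (tshift t u (gvec d v)) =
   \int[unif]_v (f (gvec d v) * (tilt (tscale t u) (gvec d v))%:E))%E.
Proof.
move=> mf f0; rewrite -integral_gvec_shift//.
by apply: eq_integral => v _; rewrite tshift_scale.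
Qed.

End gaussian_shift.

(** The experiment for one coordinate of the parameter. The answer [obs] is
    a function of the prior draw, of the earlier answers and of the current
    noise vector. The prior draw is to be translated along [u0] and the
    current noise along [pol h], a direction chosen from the earlier
    answers [h]. *)
Section process.
Context {R : realType} {d : nat} (rho : R).
Hypothesis rho01 : 0 <= rho <= 1.
Local Notation RM := (measurableTypeR R).
Local Notation unif := (unif R).
Local Notation T := (d.-tuple R).
Local Notation H k := (k.-tuple (R * R)).
Variable obs : forall k, T * (H k * T) -> R * R.
Hypothesis mobs : forall k, measurable_fun setT (@obs k).

Fixpoint history (g : T) (w : RM) (k : nat) : H k :=
  if k is k'.+1 then
    [tuple of rcons (history g w k') (obs (g, (history g w k', gvec d (lazy_state rho k' w))))]
  else [tuple].

Variables (u0 : T) (pol : forall k, H k -> T).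
Hypothesis mpol : forall k, measurable_fun setT (@pol k).
(** The simultaneous translation cannot be detected from the answers. *)
Hypothesis obs_shift : forall k t g h w,
  @obs k (tshift t u0 g, (h, tshift t (pol h) w)) = obs (g, (h, w)).
(** While the chain holds its state the noise vector is not redrawn and
    cannot be translated afresh, so the direction must not change. For rho
    = 1 every step redraws, and the direction may follow the queries. *)
Hypothesis pol_hold : rho < 1 -> forall k (h : H k) q,
  pol [tuple of rcons h q] = pol h.

(** The prior draw with its score and information, followed by the answers
    so far and the current noise vector. Score and information are carried
    along so that the density of the translated experiment is a function of
    the state. *)
Definition state_of k := ((T * (R * R)) * (H k * T))%type.

Definition prior k (c : state_of k) : T := c.1.1.
Definition score k (c : state_of k) : R := c.1.2.1.
Definition info k (c : state_of k) : R := c.1.2.2.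
Definition hist k (c : state_of k) : H k := c.2.1.
Definition current k (c : state_of k) : T := c.2.2.

(** The score of a translated sample is computed from the translated
    vectors, hence the drift by [t * info c]. *)
Definition flow (t : R) k (c : state_of k) : state_of k :=
  ((tshift t u0 (prior c), (score c - t * info c, info c)),
   (hist c, tshift t (pol (hist c)) (current c))).

Definition weight (t : R) k (c : state_of k) : R :=
  expR (- t * score c - t ^+ 2 * info c / 2).

Definition extend k (c : state_of k) : H k.+1 :=
  [tuple of rcons (hist c) (obs (prior c, (hist c, current c)))].

Definition hold k (c : state_of k) : state_of k.+1 :=
  ((prior c, (score c, info c)), (extend c, current c)).

Definition renew k (p : state_of k * RM) : state_of k.+1 :=
  let h := extend p.1 in let u := pol h in
  ((prior p.1, (score p.1 + tdot u (gvec d p.2), info p.1 + tdot u u)),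
   (h, gvec d p.2)).

(** A single uniform variable provides the prior draw (even digits) and the
    whole chain (odd digits). Both the prior draw and the first noise
    vector are fresh, and contribute to the score and to the information. *)
Definition start (u : RM) : state_of 0 :=
  let g := gvec d (even_part u) in
  let w := gvec d (lazy_state rho 0 (odd_part u)) in
  let p := pol (k := 0) [tuple] in
  ((g, (tdot u0 g + tdot p w, tdot u0 u0 + tdot p p)), ([tuple], w)).

Definition tail k (u : RM) : RM := (lazy_path rho k (odd_part u)).2.

Fixpoint state k (u : RM) : state_of k :=
  if k is k'.+1 then
    advance (@hold k') (@renew k') (state k' u, (draw rho (tail k' u)).1)
  else start u.

Lemma state_prior k u : prior (state k u) = gvec d (even_part u).
Proof. by elim: k => //= k <-; rewrite /advance; case: ifP. Qed.

Lemma state_current k u :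
  current (state k u) = gvec d (lazy_state rho k (odd_part u)).
Proof.
elim: k => [//|k IH]; rewrite /= /advance /lazy_state lazy_pathS /next /tail /=.
by case: ifP.
Qed.

(** The state is a bookkeeping device around the actual transcript. *)
Lemma state_hist k u : hist (state k u) = history (gvec d (even_part u)) (odd_part u) k.
Proof.
elim: k => //= k IH; rewrite -IH -state_current -(state_prior k) /advance.
by case: ifP.
Qed.

Lemma measurable_prior k : measurable_fun setT (@prior k).
Proof. exact: measurableT_comp measurable_fst measurable_fst. Qed.

Lemma measurable_score k : measurable_fun setT (@score k).
Proof.
apply: measurableT_comp measurable_fst _.
exact: measurableT_comp measurable_snd measurable_fst.
Qed.

Lemma measurable_info k : measurable_fun setT (@info k).
Proof.
apply: measurableT_comp measurable_snd _.
exact: measurableT_comp measurable_snd measurable_fst.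
Qed.

Lemma measurable_hist k : measurable_fun setT (@hist k).
Proof. exact: measurableT_comp measurable_fst measurable_snd. Qed.

Lemma measurable_current k : measurable_fun setT (@current k).
Proof. exact: measurableT_comp measurable_snd measurable_snd. Qed.

Lemma measurable_flow t k : measurable_fun setT (@flow t k).
Proof.
have mp := @measurable_prior k; have ms := @measurable_score k.
have mi := @measurable_info k; have mh := @measurable_hist k.
have mc := @measurable_current k.
apply: measurable_fun_pair.
  apply: measurable_fun_pair; first exact: measurable_tshift.
  apply: measurable_fun_pair => //; apply: measurable_funB => //.
  exact: measurable_funM.
apply: measurable_fun_pair => //; apply: measurable_tshift => //.
exact: (measurableT_comp (@mpol k) mh).
Qed.

Lemma measurable_weight t k : measurable_fun setT (@weight t k).
Proof.
apply: measurableT_comp => //; apply: measurable_funB.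
  by apply: measurable_funM => //; exact: measurable_score.
apply: measurable_funM => //; apply: measurable_funM => //; exact: measurable_info.
Qed.

Lemma measurable_extend k : measurable_fun setT (@extend k).
Proof.
apply: measurable_rcons; first exact: measurable_hist.
apply: (measurableT_comp (@mobs k)); apply: measurable_fun_pair.
  exact: measurable_prior.
by apply: measurable_fun_pair; [exact: measurable_hist|exact: measurable_current].
Qed.

Lemma measurable_hold k : measurable_fun setT (@hold k).
Proof.
apply: measurable_fun_pair; apply: measurable_fun_pair.
- exact: measurable_prior.
- by apply: measurable_fun_pair; [exact: measurable_score|exact: measurable_info].
- exact: measurable_extend.
- exact: measurable_current.
Qed.

Lemma measurable_pol_extend k : measurable_fun setT (fun c : state_of k => pol (extend c)).
Proof. exact: measurableT_comp (@mpol k.+1) (@measurable_extend k). Qed.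

Lemma measurable_renew k : measurable_fun setT (@renew k).
Proof.
have mg : measurable_fun setT (fun p : state_of k * RM => gvec d p.2).
  by apply: measurable_gvec_comp; exact: measurable_snd.
have mu : measurable_fun setT (fun p : state_of k * RM => pol (extend p.1)).
  exact: measurableT_comp (@measurable_pol_extend k) measurable_fst.
apply: measurable_fun_pair; apply: measurable_fun_pair => //.
- exact: measurableT_comp (@measurable_prior k) measurable_fst.
- apply: measurable_fun_pair; apply: measurable_funD.
  + exact: measurableT_comp (@measurable_score k) measurable_fst.
  + exact: measurable_tdot.
  + exact: measurableT_comp (@measurable_info k) measurable_fst.
  + exact: measurable_tdot.
- exact: measurableT_comp (@measurable_extend k) measurable_fst.
Qed.

Lemma measurable_tail k : measurable_fun setT (tail k).
Proof.
apply: measurableT_comp measurable_snd _.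
exact: measurableT_comp (@measurable_lazy_path R rho k) (@measurable_odd_part R).
Qed.

Lemma measurable_even_odd : measurable_fun setT (fun u : RM => even_part (odd_part u)).
Proof. exact: measurableT_comp (@measurable_even_part R) (@measurable_odd_part R). Qed.

Lemma measurable_state k : measurable_fun setT (state k).
Proof.
elim: k => [|k IH] /=.
  have mg : measurable_fun setT (fun u : RM => gvec d (even_part u)).
    by apply: measurable_gvec_comp; exact: measurable_even_part.
  have mw : measurable_fun setT (fun u : RM => gvec d (lazy_state rho 0 (odd_part u))).
    apply: measurable_gvec_comp; exact: measurable_even_odd.
  apply: measurable_fun_pair; apply: measurable_fun_pair => //.
  apply: measurable_fun_pair => //.
  by apply: measurable_funD; apply: measurable_tdot.
apply: (measurableT_comp (measurable_advance (@measurable_hold k) (@measurable_renew k))).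
have md := measurableT_comp (@measurable_draw R rho) (measurable_tail k).
exact: measurable_fun_pair IH (measurableT_comp measurable_fst md).
Qed.

Lemma fresh_start : fresh unif (fun u => (even_part u, even_part (odd_part u)))
  (fun u => odd_part (odd_part u)).
Proof.
move=> h mh h0.
pose h1 (p : RM * RM) := h ((p.1, even_part p.2), odd_part p.2).
have mh1 : measurable_fun setT h1.
  apply: (measurableT_comp mh); apply: measurable_fun_pair.
    apply: measurable_fun_pair => //.
    exact: measurableT_comp (@measurable_even_part R) measurable_snd.
  exact: measurableT_comp (@measurable_odd_part R) measurable_snd.
pose h2 (q : RM * RM) := (\int[unif]_v h (q, v))%E.
have mh2 : measurable_fun setT h2 by exact: measurable_integral_unif.
have h20 q : (0 <= h2 q)%E by exact: integral_ge0.
apply: (eq_trans (fresh_bisect mh1 (fun p => h0 _))).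
have mh3 : measurable_fun setT (fun p : RM * RM => h2 (p.1, even_part p.2)).
  apply: (measurableT_comp mh2); apply: measurable_fun_pair => //.
  exact: measurableT_comp (@measurable_even_part R) measurable_snd.
apply: (eq_trans _ (esym (fresh_bisect mh3 (fun p => h20 _)))).
apply: eq_integral => u _; rewrite /h1.
have mhu : measurable_fun setT (fun p : RM * RM => h ((even_part u, p.1), p.2)).
  apply: (measurableT_comp mh); apply: measurable_fun_pair => //.
  exact: measurable_fun_pair.
exact: (fresh_bisect mhu (fun p => h0 _)).
Qed.

Lemma fresh_state k : fresh unif (state k) (tail k).
Proof.
elim: k => [|k IH].
  have -> : state 0 = (fun p : RM * RM =>
      let g := gvec d p.1 in let w := gvec d p.2 in let p := pol (k := 0) [tuple] in
      ((g, (tdot u0 g + tdot p w, tdot u0 u0 + tdot p p)), ([tuple], w)) : state_of 0)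
      \o (fun u => (even_part u, even_part (odd_part u))) by [].
  apply: fresh_comp; last exact: fresh_start.
  have mg : measurable_fun setT (fun u : RM * RM => gvec d u.1).
    by apply: measurable_gvec_comp; exact: measurable_fst.
  have mw : measurable_fun setT (fun u : RM * RM => gvec d u.2).
    by apply: measurable_gvec_comp; exact: measurable_snd.
  apply: measurable_fun_pair; apply: measurable_fun_pair => //.
  apply: measurable_fun_pair => //.
  by apply: measurable_funD; apply: measurable_tdot.
have := fresh_comp (measurable_advance (@measurable_hold k) (@measurable_renew k))
  (fresh_draw rho01 IH).
by rewrite (_ : (fun w => (draw rho (tail k w)).2) = tail k.+1).
Qed.

(** The Cameron--Martin formula for the prior draw and for the first noise
    vector, which are independent. *)
Lemma tilt_start t (f : state_of 0 -> \bar R) : measurable_fun setT f ->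
  (forall x, 0 <= f x)%E ->
  (\int[unif]_u f (flow t (state 0 u)) =
   \int[unif]_u (f (state 0 u) * (weight t (state 0 u))%:E))%E.
Proof.
move=> mf f0; pose p := pol (k := 0) [tuple].
pose mk (g w : T) (s : R) : state_of 0 :=
  ((g, (s, tdot u0 u0 + tdot p p)), ([tuple], w)).
have mmk d' (X : measurableType d') (g w : X -> T) (s : X -> R) :
    measurable_fun setT g -> measurable_fun setT w -> measurable_fun setT s ->
    measurable_fun setT (fun x => f (mk (g x) (w x) (s x))).
  move=> mg mw ms; apply: (measurableT_comp mf).
  apply: measurable_fun_pair; apply: measurable_fun_pair => //.
  exact: measurable_fun_pair.
pose phi (g w : T) : \bar R := f (mk g w (tdot u0 g + tdot p w)).
have mphi d' (X : measurableType d') (g w : X -> T) :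
    measurable_fun setT g -> measurable_fun setT w ->
    measurable_fun setT (fun x => phi (g x) (w x)).
  move=> mg mw; apply: mmk => //.
  by apply: measurable_funD; apply: measurable_tdot.
have mg1 : measurable_fun setT (fun x : RM * RM => gvec d x.1).
  by apply: measurable_gvec_comp; exact: measurable_fst.
have mg2 : measurable_fun setT (fun x : RM * RM => gvec d x.2).
  by apply: measurable_gvec_comp; exact: measurable_snd.
have mg : measurable_fun setT (gvec d : RM -> T) by exact: measurable_gvec.
pose c1 := tscale t u0; pose c2 := tscale t p.
pose h1 (x : RM * RM) := phi (tshift t u0 (gvec d x.1)) (tshift t p (gvec d x.2)).
pose h2 (x : RM * RM) := (phi (tshift t u0 (gvec d x.1)) (gvec d x.2) *
  (tilt c2 (gvec d x.2))%:E)%E.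
pose h3 (x : RM * RM) := (phi (gvec d x.1) (gvec d x.2) *
  (tilt c2 (gvec d x.2))%:E * (tilt c1 (gvec d x.1))%:E)%E.
have mt c d' (X : measurableType d') (g : X -> T) : measurable_fun setT g ->
    measurable_fun setT (fun x => (tilt c (g x))%:E).
  by move=> mg'; apply/measurable_EFinP; exact: measurable_tilt.
have mh1 : measurable_fun setT h1 by apply: mphi; exact: measurable_tshift.
have mh2 : measurable_fun setT h2.
  by apply: emeasurable_funM; [apply: mphi => //; exact: measurable_tshift|exact: mt].
have mh3 : measurable_fun setT h3.
  by do 2 (apply: emeasurable_funM; last exact: mt); exact: mphi.
have h20 x : (0 <= h2 x)%E by rewrite mule_ge0 ?f0// lee_fin expR_ge0.
have h30 x : (0 <= h3 x)%E by rewrite !mule_ge0 ?f0// lee_fin expR_ge0.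
have to_pair (h : RM * RM -> \bar R) : measurable_fun setT h -> (forall x, 0 <= h x)%E ->
    (\int[unif]_u h (even_part u, even_part (odd_part u)) =
     \int[unif]_x \int[unif]_y h (x, y))%E.
  move=> mh h0.
  apply: eq_trans (integral_bisect (f := fun q => h (q.1, even_part q.2)) _ _) _ => //.
    apply: (measurableT_comp mh); apply: measurable_fun_pair => //.
    exact: measurableT_comp (@measurable_even_part R) measurable_snd.
  apply: eq_integral => x _.
  have mhx : measurable_fun setT (fun q : RM * RM => h (x, q.1)).
    by apply: (measurableT_comp mh); exact: measurable_fun_pair.
  apply: eq_trans (integral_bisect mhx (fun q => h0 _)) _.
  apply: eq_integral => y _; exact: (integral_prob_cst unif (h (x, y))).
transitivity (\int[unif]_u h1 (even_part u, even_part (odd_part u)))%E.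
  apply: eq_integral => u _; rewrite /h1 /phi /flow/= /mk; congr (f ((_, (_, _)), _)).
  rewrite /score/info/= !tdot_shift; ring.
apply: (eq_trans (to_pair _ mh1 (fun x => f0 _))).
transitivity (\int[unif]_x \int[unif]_y h2 (x, y))%E.
  apply: eq_integral => x _; rewrite /h1 /h2/=.
  rewrite (integral_gvec_scaled_shift t p (f := phi (tshift t u0 (gvec d x))))//.
    exact: mphi.
  by move=> y; exact: f0.
apply: (eq_trans (fubini_tonelli h2 mh2 h20)).
transitivity (\int[unif]_y \int[unif]_x h3 (x, y))%E.
  apply: eq_integral => y _; rewrite /h2 /h3/=.
  rewrite (integral_gvec_scaled_shift t u0
    (f := fun g => phi g (gvec d y) * (tilt c2 (gvec d y))%:E)%E)//.
    by apply: emeasurable_funM => //; exact: mphi.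
  by move=> g; rewrite mule_ge0 ?f0// lee_fin expR_ge0.
apply: (eq_trans (esym (fubini_tonelli h3 mh3 h30))).
apply: (eq_trans (esym (to_pair _ mh3 h30))).
apply: eq_integral => u _; rewrite /h3 /phi/= -muleA -EFinM.
congr (_ * _%:E)%E; rewrite /c1 /c2 !tilt_scale -expRD; congr expR.
rewrite /score /info/=; ring.
Qed.

(** Induction along the chain. The answers being unchanged by the flow, so
    are the directions of later translations, and a renewed noise vector is
    translated by a direction that is fixed once the past is given; the
    formula for Gaussian vectors therefore applies conditionally on the
    past. *)
Lemma tilt_state t k (f : state_of k -> \bar R) : measurable_fun setT f ->
  (forall x, 0 <= f x)%E ->
  (\int[unif]_u f (flow t (state k u)) =
   \int[unif]_u (f (state k u) * (weight t (state k u))%:E))%E.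
Proof.
elim: k f => [|k IH] f mf f0; first exact: tilt_start.
pose q (p : state_of k * RM) : R := tilt (tscale t (pol (extend p.1))) (gvec d p.2).
have extend_flow (c : state_of k) : extend (flow t c) = extend c.
  by rewrite /extend /= /prior/= obs_shift.
apply: (@tilt_advance _ _ _ unif rho rho01 _ _ _ _ _ _ (@fresh_state k)
  (@flow t k) (@flow t k.+1) (@weight t k) (@weight t k.+1) (@hold k) (@renew k) q) => //.
- exact: measurable_flow.
- exact: measurable_weight.
- exact: measurable_hold.
- exact: measurable_renew.
- have mg : measurable_fun setT (fun p : state_of k * RM => gvec d p.2).
    by apply: measurable_gvec_comp; exact: measurable_snd.
  have mu : measurable_fun setT (fun p : state_of k * RM => pol (extend p.1)).
    exact: measurableT_comp (@measurable_pol_extend k) measurable_fst.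
  rewrite (_ : q = fun p => expR (- t * tdot (pol (extend p.1)) (gvec d p.2)
      - t ^+ 2 * tdot (pol (extend p.1)) (pol (extend p.1)) / 2)); last first.
    by apply/funext => p; exact: tilt_scale.
  apply: measurableT_comp => //; apply: measurable_funB.
    by apply: measurable_funM => //; exact: measurable_tdot.
  apply: measurable_funM => //; apply: measurable_funM => //; exact: measurable_tdot.
- by move=> c; exact: expR_ge0.
- by move=> c; exact: expR_ge0.
- by move=> c; exact: expR_ge0.
- move=> rlt c; rewrite /hold extend_flow /flow/= /prior/score/info/hist/current/=.
  by rewrite pol_hold.
- move=> c g mg g0; set u := pol (extend c).
  pose G (x : T) : \bar R := g ((tshift t u0 (prior c), (score c - t * info c + tdot u x,
     info c + tdot u u)), (extend c, x)).
  have mG : measurable_fun setT G.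
    apply: (measurableT_comp mg); apply: measurable_fun_pair; apply: measurable_fun_pair => //.
    apply: measurable_fun_pair => //; apply: measurable_funD => //.
    exact: measurable_tdot.
  transitivity (\int[unif]_v G (tshift t u (gvec d v)))%E.
    apply: eq_integral => v _; rewrite /G /flow/renew/= /prior/score/info/hist/current/=.
    rewrite -/u tdot_shift; congr (g ((_, (_, _)), _)).
    by rewrite mulrDr opprD addrACA.
  apply: (eq_trans (integral_gvec_scaled_shift t u mG (fun x => g0 _))).
  by apply: eq_integral => v _; rewrite /q /renew/= !extend_flow -/u.
- move=> c v; rewrite /q tilt_scale /weight -expRD /score/info/=; congr expR; ring.
Qed.

Lemma info_ge0 k u : 0 <= info (state k u).
Proof.
elim: k => [|k IH] /=; first by rewrite /info/= addr_ge0// tdot_ge0.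
by rewrite /advance; case: ifP => _; rewrite /info//= addr_ge0// tdot_ge0.
Qed.

Lemma info_le (B : R) : 0 <= B -> (forall k (h : H k), tdot (pol h) (pol h) <= B) ->
  forall k u, info (state k u) <= tdot u0 u0 + k.+1%:R * B.
Proof.
move=> B0 polB k u; elim: k => [|k IH] /=.
  by rewrite /info/= mul1r lerD2l.
have le1 : info (state k u) <= tdot u0 u0 + k.+2%:R * B.
  by apply: (le_trans IH); rewrite lerD2l ler_wpM2r// ler_nat.
rewrite /advance; case: ifP => _ //.
rewrite [info _]/(info _ + _).
apply: (le_trans (lerD IH (polB _ _))).
by rewrite -addrA lerD2l -[k.+2]addn1 natrD mulrDl mul1r.
Qed.

(** The squared length of the translation planned for call [k]. *)
Definition spent k (u : RM) : R :=
  let p := pol (history (gvec d (even_part u)) (odd_part u) k) in tdot p p.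

Lemma measurable_spent k : measurable_fun setT (spent k).
Proof.
rewrite /spent; under eq_fun do rewrite -state_hist.
have mp : measurable_fun setT (fun u => pol (hist (state k u))).
  apply: (measurableT_comp (@mpol k)).
  exact: measurableT_comp (@measurable_hist k) (@measurable_state k).
exact: measurable_tdot.
Qed.

Lemma measurable_info_state k : measurable_fun setT (fun u => (info (state k u))%:E).
Proof.
apply/measurable_EFinP; exact: measurableT_comp (@measurable_info k) (@measurable_state k).
Qed.

(** The next noise vector is redrawn with probability [rho], independently
    of the answers that determine the length of its translation. *)
Lemma integral_infoS k :
  (\int[unif]_u (info (state k.+1 u))%:E =
   \int[unif]_u (info (state k u))%:E + rho%:E * \int[unif]_u (spent k.+1 u)%:E)%E.
Proof.
have /andP[r0 r1] := rho01.
pose f (p : state_of k * (bool * RM)) : \bar R :=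
  (`|info (advance (@hold k) (@renew k) p)|)%:E.
have mf : measurable_fun setT f.
  apply/measurable_EFinP; apply: measurableT_comp => //.
  apply: (measurableT_comp (@measurable_info k.+1)).
  exact: measurable_advance (@measurable_hold k) (@measurable_renew k).
have f0 p : (0 <= f p)%E by rewrite lee_fin.
transitivity (\int[unif]_u f (state k u, (draw rho (tail k u)).1))%E.
  by apply: eq_integral => u _; rewrite /f ger0_norm//; exact: (info_ge0 k.+1).
apply: (eq_trans (integral_fresh_draw rho01 (@fresh_state k) mf f0)).
rewrite -ge0_integralZl//; last 2 first.
- by apply/measurable_EFinP; exact: measurable_spent.
- by move=> u _; rewrite lee_fin tdot_ge0.
rewrite -ge0_integralD//; last 4 first.
- by move=> u _; rewrite lee_fin info_ge0.
- exact: measurable_info_state.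
- by move=> u _; rewrite mule_ge0// lee_fin tdot_ge0.
- by apply: emeasurable_funM => //; apply/measurable_EFinP; exact: measurable_spent.
apply: eq_integral => u _.
rewrite [X in (_ * X + _)%E](_ : _ = (info (state k u))%:E); last first.
  apply: (eq_trans (integral_prob_cst unif (`|info (hold (state k u))|)%:E)).
  by rewrite ger0_norm//; exact: info_ge0.
rewrite [X in (_ + _ * X)%E](_ : _ = (info (state k u) + spent k.+1 u)%:E); last first.
  apply: (eq_trans _ (integral_prob_cst unif (info (state k u) + spent k.+1 u)%:E)).
  apply: eq_integral => v _; rewrite /f /advance /= /info /=.
  rewrite /spent [history _ _ k.+1]/= -state_hist -(state_prior k) -state_current ger0_norm//.
  by rewrite addr_ge0 ?tdot_ge0//; exact: info_ge0.
by rewrite -!EFinM -!EFinD; congr (_%:E); ring.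
Qed.

Lemma integral_info0 :
  (\int[unif]_u (info (state 0 u))%:E =
   (tdot u0 u0 + tdot (pol (k := 0) [tuple]) (pol (k := 0) [tuple]))%:E)%E.
Proof. exact: (integral_prob_cst unif (_ + _)%:E). Qed.

Variables (N : nat) (psi : T * H N -> R).
Hypothesis mpsi : measurable_fun setT psi.
Hypothesis psi_shift : forall t g h, psi (tshift t u0 g, h) = psi (g, h) - t.

(** Here [psi] is the error of an estimator computed from the prior draw
    and the answers; only the prior draw moves, which shifts the error by
    [- t]. *)
Lemma adaptive_van_trees (B t al : R) : 0 <= B ->
  (forall k (h : H k), tdot (pol h) (pol h) <= B) -> 0 < t -> 0 < al ->
  t ^+ 2 * (tdot u0 u0 + N.+1%:R * B) <= 2^-1 ->
  (t%:E <= (al / 2)%:E * (\int[unif]_u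
      ((psi (gvec d (even_part u), history (gvec d (even_part u)) (odd_part u) N)) ^+ 2)%:E)
    + (t ^+ 2 / al)%:E * (\int[unif]_u (info (state N u))%:E))%E.
Proof.
move=> B0 polB t0 al0 tB.
pose err u := psi (prior (state N u), hist (state N u)).
have merr' : measurable_fun setT (fun c : state_of N => psi (prior c, hist c)).
  apply: (measurableT_comp mpsi).
  by apply: measurable_fun_pair; [exact: measurable_prior|exact: measurable_hist].
have mst := @measurable_state N.
rewrite (_ : (\int[unif]_u _)%E = \int[unif]_u ((err u) ^+ 2)%:E)%E; last first.
  by apply: eq_integral => u _; rewrite /err state_prior state_hist.
apply: (@van_trees _ _ _ unif err (fun u => score (state N u))
  (fun u => info (state N u)) (tdot u0 u0 + N.+1%:R * B)) => //.
- exact: measurableT_comp merr' mst.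
- exact: measurableT_comp (@measurable_score N) mst.
- exact: measurableT_comp (@measurable_info N) mst.
- by move=> u; exact: info_ge0.
- by move=> u; exact: info_le.
- move=> f mf f0.
  rewrite -(tilt_state t (f := fun c => f (psi (prior c, hist c)))).
  + by apply: eq_integral => u _; rewrite /flow/= /prior/hist/= psi_shift.
  + exact: measurableT_comp mf merr'.
  + by move=> c; exact: f0.
- rewrite -(tilt_state (2 * t) (f := fun c => (expR (t ^+ 2 * info c))%:E)).
  + by [].
  + apply/measurable_EFinP; apply: measurableT_comp => //.
    by apply: measurable_funM => //; exact: measurable_info.
  + by move=> c; rewrite lee_fin expR_ge0.
Qed.

End process.

(** * The subspace seen by a query *)

Section query_plane.
Context {R : realType} {d : nat}.
Implicit Types (u v x y : 'rV[R]_d).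

Lemma dotp_eq0 u : dotp u u = 0 -> u = 0.
Proof.
move=> u0; apply/rowP => i; rewrite mxE; apply/eqP; rewrite -sqrf_eq0.
have : (u 0 i) ^+ 2 <= dotp u u.
  rewrite /dotp (bigD1 i)//= expr2 lerDl; apply: sumr_ge0 => j _.
  by rewrite -expr2 sqr_ge0.
by rewrite u0 => h; rewrite eq_le h sqr_ge0.
Qed.

(** The projection of the i-th basis vector on the line of [v]; it vanishes
    for [v = 0], because the inverse of 0 is 0. *)
Definition line_proj v i : 'rV[R]_d := (v 0 i * (dotp v v)^-1) *: v.

(** Gram--Schmidt: the part of [y] orthogonal to [x]. *)
Definition residual x y := y - (dotp y x * (dotp x x)^-1) *: x.

(** The projection of the i-th basis vector on the span of [x] and [y],
    whatever the rank of that pair. *)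
Definition plane_proj x y i := line_proj x i + line_proj (residual x y) i.

Lemma dotp_line_proj v i : dotp (line_proj v i) v = v 0 i.
Proof.
rewrite dotpZl; have [v0|v0] := eqVneq (dotp v v) 0; last by rewrite divfK.
by rewrite (dotp_eq0 v0) mxE !mul0r.
Qed.

Lemma dotp_residual x y : dotp (residual x y) x = 0.
Proof.
rewrite dotpDl dotpNl dotpZl; have [x0|x0] := eqVneq (dotp x x) 0.
  by rewrite (dotp_eq0 x0) -(scale0r 0) dotpZr !mul0r subr0.
by rewrite divfK// subrr.
Qed.

Lemma plane_proj1 x y i : dotp (plane_proj x y i) x = x 0 i.
Proof.
by rewrite dotpDl dotp_line_proj dotpZl dotp_residual mulr0 addr0.
Qed.

Lemma plane_proj2 x y i : dotp (plane_proj x y i) y = y 0 i.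
Proof.
have {2 3}-> : y = residual x y + (dotp y x * (dotp x x)^-1) *: x by rewrite subrK.
rewrite dotpDr dotpZr plane_proj1 !mxE; congr (_ + _).
rewrite dotpDl dotp_line_proj dotpZl [dotp x (residual _ _)]dotpC dotp_residual mulr0 add0r.
by rewrite !mxE.
Qed.

(** The sum is the trace of the projection, that is its rank. *)
Lemma line_proj_le1 v : \sum_(i < d) dotp (line_proj v i) (line_proj v i) <= 1.
Proof.
rewrite (eq_bigr (fun i => v 0 i * v 0 i * (dotp v v)^-1)); last first.
  by move=> i _; rewrite dotpZr dotp_line_proj; ring.
rewrite -mulr_suml -/(dotp v v).
have [->|v0] := eqVneq (dotp v v) 0; first by rewrite mul0r.
by rewrite divff.
Qed.

Lemma plane_proj_le2 x y :
  \sum_(i < d) dotp (plane_proj x y i) (plane_proj x y i) <= 2.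
Proof.
rewrite (eq_bigr (fun i => dotp (line_proj x i) (line_proj x i) +
    dotp (line_proj (residual x y) i) (line_proj (residual x y) i))); last first.
  move=> i _; rewrite !(dotpDl, dotpDr).
  have o : dotp (line_proj x i) (line_proj (residual x y) i) = 0.
    by rewrite dotpZl dotpZr [dotp x (residual _ _)]dotpC dotp_residual !mulr0.
  by rewrite o [dotp (line_proj (residual x y) i) _]dotpC o addr0 add0r.
by rewrite big_split -[2]/(1 + 1) lerD// line_proj_le1.
Qed.

Section measurability.
Context d' (T : measurableType d').
Implicit Types f g : T -> 'rV[R]_d.

Lemma measurable_dotp f g : measurable_rV f -> measurable_rV g ->
  measurable_fun setT (fun t => dotp (f t) (g t)).
Proof. by move=> mf mg; apply: measurable_sum => i; exact: measurable_funM. Qed.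

Lemma measurable_rVZ (a : T -> R) f : measurable_fun setT a -> measurable_rV f ->
  measurable_rV (fun t => a t *: f t).
Proof.
by move=> ma mf i; under eq_fun do rewrite mxE; exact: measurable_funM.
Qed.

Lemma measurable_rVD f g : measurable_rV f -> measurable_rV g ->
  measurable_rV (fun t => f t + g t).
Proof.
by move=> mf mg i; under eq_fun do rewrite mxE; exact: measurable_funD.
Qed.

Lemma measurable_rVB f g : measurable_rV f -> measurable_rV g ->
  measurable_rV (fun t => f t - g t).
Proof.
by move=> mf mg i; under eq_fun do rewrite !mxE; exact: measurable_funB.
Qed.

(** On nonnegative numbers inversion is the power function of exponent -1,
    which also sends 0 to 0. *)
Lemma measurable_inv_dotp f : measurable_rV f ->
  measurable_fun setT (fun t => (dotp (f t) (f t))^-1).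
Proof.
move=> mf; under eq_fun do rewrite -powR_inv1 ?dotp_ge0//.
apply: (@measurableT_comp _ _ _ _ _ _ (fun z : R => z `^ (-1))).
  exact: measurable_powR.
exact: measurable_dotp.
Qed.

Lemma measurable_line_proj f i : measurable_rV f ->
  measurable_rV (fun t => line_proj (f t) i).
Proof.
move=> mf; apply: measurable_rVZ => //.
by apply: measurable_funM => //; exact: measurable_inv_dotp.
Qed.

Lemma measurable_plane_proj f g i : measurable_rV f -> measurable_rV g ->
  measurable_rV (fun t => plane_proj (f t) (g t) i).
Proof.
move=> mf mg; apply: measurable_rVD; first exact: measurable_line_proj.
apply: measurable_line_proj; apply: measurable_rVB => //; apply: measurable_rVZ => //.
by apply: measurable_funM; [exact: measurable_dotp|exact: measurable_inv_dotp].
Qed.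

Lemma measurable_quad mu f g : measurable_rV f -> measurable_rV g ->
  measurable_fun setT (fun t => quad mu (f t) (g t)).
Proof.
move=> mf mg; apply: measurable_funB; last exact: measurable_dotp.
by apply: measurable_funM => //; exact: measurable_dotp.
Qed.

End measurability.
End query_plane.

(** * Summing over the coordinates *)

Section coordinates.
Context {R : realType} {d : nat} (rho : R).
Hypotheses (rho01 : 0 <= rho <= 1) (d0 : (0 < d)%N).
Local Notation RM := (measurableTypeR R).
Local Notation unif := (unif R).
Local Notation T := (d.-tuple R).
Local Notation H k := (k.-tuple (R * R)).
Variable obs : forall k, T * (H k * T) -> R * R.
Hypothesis mobs : forall k, measurable_fun setT (@obs k).
Variables (vs B : R) (pol : 'I_d -> forall k, H k -> T).
Hypotheses (vs0 : 0 < vs) (B0 : 0 <= B).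

(** Translating the prior draw by [t] along this vector lowers the error of
    coordinate [i] by exactly [t]. *)
Definition prior_shift (i : 'I_d) : T := [tuple - ((j == i)%:R / vs) | j < d].

Hypothesis mpol : forall i k, measurable_fun setT (@pol i k).
Hypothesis obs_shift : forall i k t g h w,
  @obs k (tshift t (prior_shift i) g, (h, tshift t (pol i h) w)) = obs (g, (h, w)).
Hypothesis pol_hold : rho < 1 -> forall i k (h : H k) q,
  pol i [tuple of rcons h q] = pol i h.
Hypothesis polB : forall k (h : H k), \sum_(i < d) tdot (pol i h) (pol i h) <= B.
Variables (N : nat) (est : H N -> 'rV[R]_d).
Hypothesis mest : measurable_rV est.

Let st i := @state R d rho obs (prior_shift i) (pol i) N.

Lemma tdot_prior_shift i : tdot (prior_shift i) (prior_shift i) = vs ^- 2.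
Proof.
rewrite /tdot (bigD1 i)//= tnth_mktuple eqxx big1 ?addr0.
  by rewrite mulrNN mul1r -expr2 exprVn.
by move=> j /negbTE ji; rewrite tnth_mktuple ji mul0r oppr0 mul0r.
Qed.

Lemma pol_le i k (h : H k) : tdot (pol i h) (pol i h) <= B.
Proof.
apply: le_trans (polB h); rewrite (bigD1 i)//= lerDl.
by apply: sumr_ge0 => j _; exact: tdot_ge0.
Qed.

(** A single coordinate may receive the whole of [B] at a call, but [polB]
    prevents all of them from doing so at once; this is what makes the
    final bound grow with the dimension. *)
Lemma sum_integral_info k :
  (\sum_(i < d) \int[unif]_u
     (info (@state R d rho obs (prior_shift i) (pol i) k u))%:E
   <= (d%:R * vs ^- 2 + (1 + rho * k%:R) * B)%:E)%E.
Proof.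
have /andP[r0 r1] := rho01.
elim: k => [|k IH].
  under eq_bigr do rewrite integral_info0 tdot_prior_shift.
  rewrite sumEFin lee_fin big_split/= sumr_const card_ord mulr_natl mulr0 addr0 mul1r.
  by rewrite lerD2l polB.
under eq_bigr do rewrite (integral_infoS rho01 mobs _ (mpol _)).
rewrite big_split/= [leRHS](_ : _ = ((d%:R * vs ^- 2 + (1 + rho * k%:R) * B)%:E +
  (rho * B)%:E)%E); last first.
  by rewrite -EFinD -[k.+1]addn1 natrD; congr (_%:E); ring.
apply: leeD => //.
rewrite -ge0_sume_distrr; last first.
  by move=> i _; apply: integral_ge0 => u _; rewrite lee_fin tdot_ge0.
rewrite EFinM lee_wpmul2l ?lee_fin//.
rewrite -ge0_integral_sum//; last 2 first.
- move=> i; apply/measurable_EFinP.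
  exact: (measurable_spent rho mobs (prior_shift i) (mpol i) k.+1).
- by move=> i u _; rewrite lee_fin tdot_ge0.
rewrite -[leRHS](integral_prob_cst unif).
apply: ge0_le_integral => //.
- by move=> u _; apply: sume_ge0 => i _; rewrite lee_fin tdot_ge0.
- apply: emeasurable_sum => i; apply/measurable_EFinP.
  exact: (measurable_spent rho mobs (prior_shift i) (mpol i) k.+1).
- by move=> u _; rewrite sumEFin lee_fin; exact: polB.
Qed.

(** The prior contributes [vs ^- 2] per coordinate, and the calls
    contribute at most [B] at the start and then [B] per expected redraw. *)
Definition info_budget : R := d%:R * vs ^- 2 + (1 + rho * N%:R) * B.

(** Summing the inequality [adaptive_van_trees] over coordinates gives d t
    <= al/2 A + (t^2 / al) J, with A the risk and J the budget. The choice
    al = 2 t J / d absorbs half of the left side, and t cancels; it only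
    has to be small enough for the second moment of the likelihood. *)
Lemma bayes_risk_ge :
  ((d%:R ^+ 2 / (2 * info_budget))%:E <=
   \sum_(i < d) \int[unif]_u ((est (history rho obs (gvec d (even_part u)) (odd_part u) N) 0 i
     - vs * tnth (gvec d (even_part u)) i) ^+ 2)%:E)%E.
Proof.
have /andP[r0 r1] := rho01.
have dR : 0 < d%:R :> R by rewrite ltr0n.
have vs2 : 0 < vs ^- 2 by rewrite invr_gt0 exprn_gt0.
pose J := info_budget.
have J0 : 0 < J.
  by rewrite ltr_pwDl ?mulr_gt0// mulr_ge0// addr_ge0// mulr_ge0.
pose M := vs ^- 2 + N.+1%:R * B.
have M0 : 0 <= M by rewrite addr_ge0 ?mulr_ge0// ltW.
pose t : R := (2 * (1 + M))^-1.
have t0 : 0 < t by rewrite invr_gt0 mulr_gt0// ltr_wpDr.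
pose al := 2 * t * J / d%:R.
have al0 : 0 < al by rewrite divr_gt0// !mulr_gt0.
have tM : t ^+ 2 * M <= 2^-1.
  have tE : t * (2 * (1 + M)) = 1 by rewrite mulVf// gt_eqF// mulr_gt0// ltr_wpDr.
  nra.
set A := (X in (_ <= X)%E).
have step i : (t%:E <= (al / 2)%:E * (\int[unif]_u
     ((est (history rho obs (gvec d (even_part u)) (odd_part u) N) 0 i
     - vs * tnth (gvec d (even_part u)) i) ^+ 2)%:E)
    + (t ^+ 2 / al)%:E * (\int[unif]_u (info (st i u))%:E))%E.
  pose psi (p : T * H N) : R := est p.2 0 i - vs * tnth p.1 i.
  have mpsi : measurable_fun setT psi.
    apply: measurable_funB; first exact: measurableT_comp (mest i) measurable_snd.
    apply: measurable_funM => //.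
    exact: measurableT_comp (@measurable_tnth _ _ _ i) measurable_fst.
  apply: (@adaptive_van_trees R d rho rho01 obs mobs (prior_shift i) (pol i)
    (mpol i) (@obs_shift i) _ N psi mpsi _ B) => //.
  - by move=> rlt k h q; exact: pol_hold.
  - move=> t' g h; rewrite /psi/= !tnth_mktuple eqxx mulrN opprK mulrDr.
    by rewrite (mulrCA vs) div1r mulfV ?gt_eqF// mulr1 opprD addrA.
  - by move=> k h; exact: pol_le.
  - by rewrite tdot_prior_shift.
have : ((d%:R * t)%:E <= (al / 2)%:E * A + (t ^+ 2 / al * J)%:E)%E.
  rewrite [leLHS](_ : _ = \sum_(i < d) t%:E)%E; last first.
    by rewrite sumEFin sumr_const card_ord mulr_natl.
  apply: (le_trans (lee_sum _ (fun i _ => step i))).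
  rewrite big_split/= -!ge0_sume_distrr; last 2 first.
  - move=> i _; apply: integral_ge0 => u _; rewrite lee_fin; exact: info_ge0.
  - by move=> i _; apply: integral_ge0 => u _; rewrite lee_fin sqr_ge0.
  rewrite -[leLHS]/((al / 2)%:E * A + (t ^+ 2 / al)%:E *
    \sum_(i < d) \int[unif]_u (info (st i u))%:E)%E.
  rewrite (EFinM _ J); apply: (leeD (lexx _)); apply: lee_wpmul2l.
    by rewrite lee_fin divr_ge0 ?sqr_ge0// ltW.
  exact: sum_integral_info.
have A0 : (0 <= A)%E.
  by apply: sume_ge0 => i _; apply: integral_ge0 => u _; rewrite lee_fin sqr_ge0.
move: A A0 => [A| |]// A0; last by rewrite leey.
rewrite -EFinM -EFinD !lee_fin => key.
have e1 : t ^+ 2 / al * J = d%:R * t / 2.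
  by rewrite /al; field; rewrite !gt_eqF.
have e2 : al / 2 = t * J / d%:R by rewrite /al; field; rewrite gt_eqF.
rewrite ler_pdivrMr ?mulr_gt0//.
move: key; rewrite e1 e2 => key.
have : t * (d%:R / 2) <= t * (J / d%:R * A) by lra.
rewrite ler_pM2l// => h.
have : d%:R * (d%:R / 2) <= d%:R * (J / d%:R * A) by rewrite ler_pM2l.
rewrite [X in _ <= X](_ : _ = J * A); last by field; rewrite gt_eqF.
rewrite -/J; lra.
Qed.

End coordinates.

(** * From Bayes risk to a hard instance *)

Section minimax.
Context {R : realType} {d tau N : nat} (mu sigma : R) (a : algorithm R d N) (rho : R).
Hypotheses (d0 : (0 < d)%N) (tau0 : (0 < tau)%N) (mu0 : 0 < mu) (sigma0 : 0 < sigma).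
Hypotheses (rho0 : 0 < rho) (rho1 : rho <= 1) (rhotau : (1 - rho) ^+ tau <= 1 / 4).
Local Notation RM := (measurableTypeR R).
Local Notation unif := (unif R).
Local Notation T := (d.-tuple R).
Local Notation H k := (k.-tuple (R * R)).
Local Notation sc := (noise_scale d sigma).

Let rho01 : 0 <= rho <= 1. Proof. by rewrite ltW. Qed.

Variable vs : R.

Definition linear_term (g w : T) : 'rV[R]_d :=
  \row_j (vs * tnth g j + sc * (tnth w j - gmean R)).

Definition response (s : seed a) k (p : T * (H k * T)) : R * R :=
  let xy := query (s, p.2.1) in let b := linear_term p.1 p.2.2 in
  (quad mu b xy.1, quad mu b xy.2).

Definition theta (v : RM) : 'rV[R]_d := vs *: \row_j tnth (gvec d v) j.

Local Notation inst v :=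
  (hard_instance (theta v) d0 tau0 mu0 sigma0 rho0 rho1 rhotau).
Local Notation hist s v w k := (history rho (response s) (gvec d v) w k).

(** The interaction with the instance of parameter [theta v] is the
    abstract transcript for the answers [response]. *)
Lemma answers_hard_instance s v (w : RM) k :
  @answers R d tau N mu sigma a (inst v) s w k = hist s v w k.
Proof.
elim: k => //= k ->; set h := hist s v w k.
rewrite /response /= (_ : linear_term _ _ = theta v + sc *: noise d (lazy_state rho k w))//.
by apply/rowP => j; rewrite !mxE.
Qed.

Lemma measurable_response d' (X : measurableType d') (f : X -> seed a) (g w : X -> T)
    k (h : X -> H k) :
  measurable_fun setT f -> measurable_fun setT g -> measurable_fun setT w ->
  measurable_fun setT h ->
  measurable_fun setT (fun x => response (f x) (g x, (h x, w x))).
Proof.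
move=> mf mg mw mh.
have mb : measurable_rV (fun x => linear_term (g x) (w x)).
  move=> i; under eq_fun do rewrite mxE.
  apply: measurable_funD; apply: measurable_funM => //; last apply: measurable_funB => //.
    exact: measurableT_comp (@measurable_tnth _ _ _ i) mg.
  exact: measurableT_comp (@measurable_tnth _ _ _ i) mw.
have mfh : measurable_fun setT (fun x => (f x, h x)) by exact: measurable_fun_pair.
apply: measurable_fun_pair; apply: measurable_quad => // i.
  exact: measurableT_comp (@measurable_query1 _ _ _ a k i) mfh.
exact: measurableT_comp (@measurable_query2 _ _ _ a k i) mfh.
Qed.

Local Notation joint := ((seed a * RM) * RM)%type.

Lemma measurable_joint_history k :
  measurable_fun setT (fun p : joint => hist p.1.1 p.1.2 p.2 k).
Proof.
elim: k => [|k IH] /=; first exact: measurable_cst.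
have mg : measurable_fun setT (fun p : joint => gvec d p.1.2).
  by apply: measurable_gvec_comp; exact: measurableT_comp measurable_snd measurable_fst.
have mw : measurable_fun setT (fun p : joint => gvec d (lazy_state rho k p.2)).
  apply: measurable_gvec_comp; apply: measurableT_comp measurable_fst _.
  exact: measurableT_comp (@measurable_lazy_path R rho k) measurable_snd.
apply: measurable_rcons => //; apply: measurable_response => //.
exact: measurableT_comp measurable_fst measurable_fst.
Qed.

Definition sq_error (p : joint) : R :=
  enorm (output (p.1.1, hist p.1.1 p.1.2 p.2 N) - mu^-1 *: theta p.1.2) ^+ 2.

Lemma measurable_sq_error : measurable_fun setT sq_error.
Proof.
have mo : measurable_rV (fun p : joint => output (p.1.1, hist p.1.1 p.1.2 p.2 N)).
  move=> i; apply: (measurableT_comp (@measurable_output _ _ _ a i)).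
  apply: measurable_fun_pair; last exact: measurable_joint_history.
  exact: measurableT_comp measurable_fst measurable_fst.
have mt : measurable_rV (fun p : joint => mu^-1 *: theta p.1.2).
  apply: measurable_rVZ => //; apply: measurable_rVZ => // i.
  under eq_fun do rewrite mxE.
  apply: (measurableT_comp (@measurable_tnth _ _ _ i)).
  by apply: measurable_gvec_comp; exact: measurableT_comp measurable_snd measurable_fst.
rewrite /sq_error; under eq_fun do rewrite enorm_sqr.
by apply: measurable_dotp; exact: measurable_rVB.
Qed.

Let sq_error0 p : (0 <= (sq_error p)%:E)%E. Proof. by rewrite lee_fin sqr_ge0. Qed.

(** By Tonelli the error averaged over the prior is the average over seeds
    of Bayes risks, so it is at least [K]; hence the error cannot stay
    below [K / 2] for every parameter. *)
Lemma hard_instance_of_bayes (K : R) : 0 < K ->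
  (forall s, (K%:E <= \int[unif]_u (sq_error ((s, even_part u), odd_part u))%:E)%E) ->
  exists (I : two_point_instance d tau mu sigma) (xstar : 'rV[R]_d),
    minimizer (objective I) xstar /\ ((K / 2)%:E <= mean_square_error a I xstar)%E.
Proof.
move=> K0 bayes.
pose mse v := @mean_square_error R d tau N mu sigma a (inst v) (mu^-1 *: theta v).
suff [v mseK] : exists v, ((K / 2)%:E <= mse v)%E.
  by exists (inst v), (mu^-1 *: theta v); split => //; exact: minimizer_hard_instance.
apply: contrapT => /forallNP noV.
have {noV} small v : (mse v <= (K / 2)%:E)%E.
  by have /negP := noV v; rewrite -ltNge => /ltW.
have mE : measurable_fun setT (fun p => (sq_error p)%:E).
  by apply/measurable_EFinP; exact: measurable_sq_error.
pose G (p : RM * seed a) := (\int[unif]_w (sq_error ((p.2, p.1), w))%:E)%E.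
have mG : measurable_fun setT G.
  apply: (measurable_integral_unif (h := fun q : (RM * seed a) * RM =>
    (sq_error ((q.1.2, q.1.1), q.2))%:E)) => //.
  apply: (measurableT_comp mE); apply: measurable_fun_pair => //.
  apply: measurable_fun_pair.
    exact: measurableT_comp measurable_snd measurable_fst.
  exact: measurableT_comp measurable_fst measurable_fst.
have G0 p : (0 <= G p)%E by exact: integral_ge0.
have mseE v : mse v = (\int[seed_law a]_s G (v, s))%E.
  have mEv : measurable_fun setT (fun sw : seed a * RM => (sq_error ((sw.1, v), sw.2))%:E).
    apply: (measurableT_comp mE); apply: measurable_fun_pair => //.
    exact: measurable_fun_pair.
  transitivity (\int[seed_law a \x unif]_sw (sq_error ((sw.1, v), sw.2))%:E)%E.
    apply: eq_integral => -[s w] _.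
    by rewrite /sq_error /= /estimate answers_hard_instance.
  exact: (fubini_tonelli1 _ mEv (fun _ => sq_error0 _)).
have : (K%:E <= (K / 2)%:E :> \bar R)%E.
  apply: (@le_trans _ _ (\int[unif]_v mse v)%E); last first.
    rewrite -[leRHS](integral_prob_cst unif); apply: ge0_le_integral => //.
    - by move=> v _; rewrite mseE; exact: integral_ge0.
    - rewrite (funext mseE).
      exact: (@measurable_fun_fubini_tonelli_F _ _ _ _ _ (seed_law a) G).
  under eq_integral do rewrite mseE.
  rewrite (fubini_tonelli G mG G0).
  rewrite -[leLHS](integral_prob_cst (seed_law a)); apply: ge0_le_integral => //.
  - by move=> s _; rewrite lee_fin ltW.
  - exact: (@measurable_fun_fubini_tonelli_G _ _ _ _ _ unif G).
  - move=> s _; apply: (le_trans (bayes s)).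
    rewrite (integral_bisect (f := fun p => (sq_error ((s, p.1), p.2))%:E))//.
    apply: (measurableT_comp mE); apply: measurable_fun_pair => //.
    exact: measurable_fun_pair.
rewrite lee_fin; lra.
Qed.

Variables (plan : 'I_d -> forall k, seed a -> H k -> 'rV[R]_d) (B : R).
Hypothesis mplan : forall i k s, measurable_rV (@plan i k s).
(** Seen from either query, the direction [plan i] cannot be told from the
    i-th basis vector. *)
Hypothesis plan_query : forall i k s (h : H k),
  dotp (plan i s h) (query (s, h)).1 = (query (s, h)).1 0 i /\
  dotp (plan i s h) (query (s, h)).2 = (query (s, h)).2 0 i.
Hypothesis plan_hold : rho < 1 -> forall i k s (h : H k) q,
  plan i s [tuple of rcons h q] = plan i s h.
Hypothesis B0 : 0 < B.
Hypothesis planB : forall k s (h : H k),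
  \sum_(i < d) dotp (plan i s h) (plan i s h) <= B.
Hypothesis vs0 : 0 < vs.

Definition noise_shift s (i : 'I_d) k (h : H k) : T :=
  [tuple sc^-1 * plan i s h 0 j | j < d].

Let sc0 : 0 < sc. Proof. exact: noise_scale_gt0. Qed.

Lemma tdot_noise_shift s i k (h : H k) : tdot (noise_shift s i h) (noise_shift s i h) =
  sc ^- 2 * dotp (plan i s h) (plan i s h).
Proof.
rewrite /tdot /dotp mulr_sumr; apply: eq_bigr => j _; rewrite tnth_mktuple.
by rewrite -exprVn; ring.
Qed.

(** The linear term moves along the difference of a basis vector and of
    [plan i], which is orthogonal to both queries. *)
Lemma response_shift s i k t g h w :
  @response s k (tshift t (prior_shift vs i) g, (h, tshift t (noise_shift s i h) w)) =
  response s (g, (h, w)).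
Proof.
rewrite /response /=; set xy := query (s, h).
have [px py] := plan_query i s h; rewrite -/xy in px py.
have bE : linear_term (tshift t (prior_shift vs i) g) (tshift t (noise_shift s i h) w) =
    linear_term g w + t *: (delta_mx 0 i - plan i s h).
  apply/rowP => j; rewrite !mxE !tnth_mktuple eqxx /=.
  have e1 : vs * (t * - ((j == i)%:R / vs)) = - (t * (j == i)%:R).
    by rewrite !mulrN (mulrCA vs t) (mulrCA vs) divff ?mulr1// gt_eqF.
  have e2 : sc * (t * (sc^-1 * plan i s h 0 j)) = t * plan i s h 0 j.
    by rewrite mulrCA mulVKf// gt_eqF.
  rewrite mulrBr e1 opprK (addrAC (tnth w j)) (mulrBr sc) e2; ring.
have shift x : dotp (plan i s h) x = x 0 i ->
    quad mu (linear_term g w + t *: (delta_mx 0 i - plan i s h)) x =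
    quad mu (linear_term g w) x.
  move=> ex; rewrite /quad dotpDl dotpZl dotpDl dotpNl ex dotpC dotpC.
  by rewrite [dotp (delta_mx _ _) _]dotpC dotp_delta subrr mulr0 addr0.
by rewrite bE !shift.
Qed.

Lemma bayes_sq_error s :
  ((d%:R ^+ 2 / (2 * @info_budget R d rho vs (sc ^- 2 * B) N) / mu ^+ 2)%:E <=
   \int[unif]_u (sq_error ((s, even_part u), odd_part u))%:E)%E.
Proof.
have sc2 : 0 < sc ^- 2 by rewrite invr_gt0 exprn_gt0.
have B00 : 0 <= sc ^- 2 * B by rewrite mulr_ge0// ltW.
have mr k : measurable_fun setT (@response s k).
  rewrite (_ : @response s k = fun p : T * (H k * T) => response s (p.1, (p.2.1, p.2.2))).
    apply: measurable_response => //.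
    - exact: measurableT_comp measurable_snd measurable_snd.
    - exact: measurableT_comp measurable_fst measurable_snd.
  by apply/funext => -[g [h w]].
have mp i k : measurable_fun setT (@noise_shift s i k).
  apply/measurable_fun_tnthP => j.
  rewrite (_ : _ \o _ = fun h => sc^-1 * plan i s h 0 j).
    by apply: measurable_funM => //; exact: mplan.
  by apply/funext => h /=; rewrite tnth_mktuple.
have mo : measurable_rV (fun h : H N => mu *: output (s, h)).
  apply: measurable_rVZ => // i.
  exact: measurableT_comp (@measurable_output _ _ _ a i) (@measurable_pair1 _ _ _ _ s).
have ph : rho < 1 -> forall i k (h : H k) q,
    noise_shift s i [tuple of rcons h q] = noise_shift s i h.
  by move=> rlt i k h q; apply: eq_from_tnth => j; rewrite !tnth_mktuple plan_hold.
have pB k (h : H k) : \sum_(i < d) tdot (noise_shift s i h) (noise_shift s i h) <= sc ^- 2 * B.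
  under eq_bigr do rewrite tdot_noise_shift.
  by rewrite -mulr_sumr ler_wpM2l// ltW.
have := bayes_risk_ge rho01 d0 mr vs0 B00 mp (response_shift s) ph pB mo.
set D := (X in (X%:E <= _)%E) => h.
have mE : measurable_fun setT (fun u : RM => (sq_error ((s, even_part u), odd_part u))%:E).
  apply/measurable_EFinP; apply: (measurableT_comp measurable_sq_error).
  apply: measurable_fun_pair; last exact: measurable_odd_part.
  apply: measurable_fun_pair => //; exact: measurable_even_part.
have {}h : (D%:E <= (mu ^+ 2)%:E *
    \int[unif]_u (sq_error ((s, even_part u), odd_part u))%:E)%E.
  apply: (le_trans h); rewrite -ge0_integralZl//; last first.
    by rewrite lee_fin sqr_ge0.
  rewrite -ge0_integral_sum//; last 2 first.
  - move=> i; apply/measurable_EFinP; apply: measurable_funX; apply: measurable_funB.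
      have mh : measurable_fun setT (fun u : RM => hist s (even_part u) (odd_part u) N).
        apply: (@measurableT_comp _ _ _ _ _ _ (fun p : joint => hist p.1.1 p.1.2 p.2 N) _
          (fun u : RM => ((s, even_part u), odd_part u))).
          exact: measurable_joint_history.
        apply: measurable_fun_pair; last exact: measurable_odd_part.
        apply: measurable_fun_pair => //; exact: measurable_even_part.
      exact: (measurableT_comp (mo i) mh).
    apply: measurable_funM => //; apply: (measurableT_comp (@measurable_tnth _ _ _ i)).
    by apply: measurable_gvec_comp; exact: measurable_even_part.
  - by move=> i u _; rewrite lee_fin sqr_ge0.
  rewrite le_eqVlt; apply/orP; left; apply/eqP; apply: eq_integral => u _.
  rewrite sumEFin -EFinM; congr (_%:E); rewrite /sq_error enorm_sqr /dotp mulr_sumr.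
  apply: eq_bigr => i _; rewrite !mxE /=; set x := output _; field.
  by rewrite gt_eqF.
rewrite -(@lee_pmul2l _ (mu ^+ 2)%:E)//; last by rewrite lte_fin exprn_gt0.
by rewrite -EFinM mulrC divfK// gt_eqF// exprn_gt0.
Qed.

End minimax.

(** * Choice of the chain and of the directions *)

Section lower_bound.
Context {R : realType} {d tau N : nat} (mu sigma : R) (a : algorithm R d N).
Hypotheses (d0 : (0 < d)%N) (tau0 : (0 < tau)%N) (mu0 : 0 < mu) (sigma0 : 0 < sigma).
Local Notation H k := (k.-tuple (R * R)).

(** The scale of the prior is chosen so that prior and calls contribute
    equally to the information budget. *)
Lemma minimax_of_plan (rho : R) (plan : 'I_d -> forall k, seed a -> H k -> 'rV[R]_d)
    (B : R) : 0 < rho -> rho <= 1 -> (1 - rho) ^+ tau <= 1 / 4 ->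
  (forall i k s, measurable_rV (@plan i k s)) ->
  (forall i k s (h : H k),
    dotp (plan i k s h) (query (s, h)).1 = (query (s, h)).1 0 i /\
    dotp (plan i k s h) (query (s, h)).2 = (query (s, h)).2 0 i) ->
  (rho < 1 -> forall i k s (h : H k) q,
    plan i _ s [tuple of rcons h q] = plan i _ s h) ->
  0 < B ->
  (forall k s (h : H k), \sum_(i < d) dotp (plan i k s h) (plan i k s h) <= B) ->
  exists (I : two_point_instance d tau mu sigma) (xstar : 'rV[R]_d),
    minimizer (objective I) xstar /\
    ((d%:R * sigma ^+ 2 / (8 * gvar_bound R * (1 + rho * N%:R) * B * mu ^+ 2))%:E
      <= mean_square_error a I xstar)%E.
Proof.
move=> rho0 rho1 rhotau mplan plan_query plan_hold B0 planB.
have dR : 0 < d%:R :> R by rewrite ltr0n.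
have sc0 : 0 < noise_scale d sigma by exact: noise_scale_gt0.
have n0 : 0 < 1 + rho * N%:R by rewrite ltr_pwDl// mulr_ge0// ltW.
set sc := noise_scale d sigma in sc0.
pose J := (1 + rho * N%:R) * (sc ^- 2 * B).
have J0 : 0 < J by rewrite !mulr_gt0// invr_gt0 exprn_gt0.
pose vs := Num.sqrt (d%:R / J).
have vs0 : 0 < vs by rewrite sqrtr_gt0 divr_gt0.
have vs2 : d%:R * vs ^- 2 = J.
  by rewrite sqr_sqrtr ?ltW ?divr_gt0// invf_div mulrC divfK// gt_eqF.
have K0 : 0 < d%:R ^+ 2 / (2 * @info_budget R d rho vs (sc ^- 2 * B) N) / mu ^+ 2.
  rewrite /info_budget vs2 -/J.
  by do 2 (rewrite divr_gt0 ?exprn_gt0//); rewrite mulr_gt0// addr_gt0.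
have bayes := bayes_sq_error d0 mu0 sigma0 rho0 rho1 mplan plan_query plan_hold B0 planB vs0.
have [I [x [Ix le]]] := hard_instance_of_bayes d0 tau0 mu0 sigma0 rho0 rho1 rhotau K0 bayes.
exists I, x; split => //; apply: le_trans le; rewrite lee_fin /info_budget vs2 -/J.
have := noise_scale_sqr sigma d0; rewrite -/sc => scE.
have g0 := gvar_bound_gt0 R.
rewrite -scE /J le_eqVlt; apply/orP; left; apply/eqP; field.
by rewrite !gt_eqF// addr_gt0// mulr_gt0.
Qed.

(** The state is redrawn at every call, and the noise is translated inside
    the span of the two queries. *)
Lemma lower_bound_dimension :
  exists (I : two_point_instance d tau mu sigma) (xstar : 'rV[R]_d),
    minimizer (objective I) xstar /\
    ((d%:R * sigma ^+ 2 / (16 * gvar_bound R * mu ^+ 2 * (N + 1)%:R))%:E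
      <= mean_square_error a I xstar)%E.
Proof.
have [|i k s|i k s h|||k s h|I [x [Ix le]]] := @minimax_of_plan 1
  (fun i k s h => plane_proj (query (s, h)).1 (query (s, h)).2 i) 2 ltr01 (lexx _).
- by rewrite subrr expr0n gtn_eqF// divr_ge0.
- apply: measurable_plane_proj => j.
  + exact: measurableT_comp (@measurable_query1 _ _ _ a k j) (@measurable_pair1 _ _ _ _ s).
  + exact: measurableT_comp (@measurable_query2 _ _ _ a k j) (@measurable_pair1 _ _ _ _ s).
- by rewrite plane_proj1 plane_proj2.
- by rewrite ltxx.
- by [].
- exact: plane_proj_le2.
- exists I, x; split => //; apply: le_trans le; rewrite lee_fin.
  have g0 := gvar_bound_gt0 R; have N0 : 0 < (N + 1)%:R :> R by rewrite ltr0n addn1.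
  rewrite natrD in N0 *.
  rewrite le_eqVlt; apply/orP; left; apply/eqP; field.
  by rewrite !gt_eqF// mul1r addrC.
Qed.

(** The state is redrawn with probability 3 / tau, and the noise is
    translated along a fixed basis vector, which is compatible with
    holding. *)
Lemma lower_bound_mixing :
  exists (I : two_point_instance d tau mu sigma) (xstar : 'rV[R]_d),
    minimizer (objective I) xstar /\
    ((tau%:R * sigma ^+ 2 / (24 * gvar_bound R * mu ^+ 2 * (N + tau)%:R))%:E
      <= mean_square_error a I xstar)%E.
Proof.
have tR : 0 < tau%:R :> R by rewrite ltr0n.
have dR : 0 < d%:R :> R by rewrite ltr0n.
pose rho : R := Num.min 1 (3 / tau%:R).
have rho0 : 0 < rho by rewrite lt_min ltr01 divr_gt0.
have rho1 : rho <= 1 by rewrite ge_min lexx.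
have rho3 : rho <= 3 / tau%:R by rewrite ge_min lexx orbT.
have rhotau : (1 - rho) ^+ tau <= 1 / 4.
  (* As (1 - rho) (1 + 3 / tau) <= 1, Bernoulli's inequality for 1 + 3 / tau,
     with exponent tau, gives the factor 4 required by mixing. *)
  have bern n : 1 + n%:R * (3 / tau%:R) <= (1 + 3 / tau%:R) ^+ n :> R.
    elim: n => [|n IH]; first by rewrite mul0r addr0 expr0.
    rewrite exprS -[n.+1]addn1 natrD.
    have x0 : 0 < 3 / tau%:R :> R by rewrite divr_gt0.
    have n0 : 0 <= n%:R :> R by [].
    move: IH; set x := 3 / tau%:R in x0 *; set y := _ ^+ n; nra.
  have four : 4 <= (1 + 3 / tau%:R) ^+ tau :> R.
    apply: le_trans (bern tau).
    by rewrite mulrCA divff ?gt_eqF// mulr1; lra.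
  have prod1 : (1 - rho) ^+ tau * (1 + 3 / tau%:R) ^+ tau <= 1.
    rewrite -exprMn exprn_ile1//.
      by rewrite mulr_ge0 ?subr_ge0// addr_ge0// divr_ge0.
    rewrite /rho; case: (lerP 1 (3 / tau%:R)) => h; first by rewrite subrr mul0r.
    have : 0 <= (3 / tau%:R) ^+ 2 :> R by exact: sqr_ge0.
    move: h; set x := 3 / tau%:R; nra.
  have : (1 - rho) ^+ tau * 4 <= 1.
    apply: le_trans prod1; rewrite ler_wpM2l// exprn_ge0// subr_ge0//.
  by lra.
have [|i k s|i k s h|||k s h|I [x [Ix le]]] := @minimax_of_plan rho
  (fun i k s h => delta_mx 0 i) d%:R rho0 rho1.
- by [].
- by move=> j; exact: measurable_cst.
- by rewrite !(dotpC (delta_mx _ _)) !dotp_delta.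
- by [].
- by [].
- rewrite (eq_bigr (fun=> 1)); first by rewrite sumr_const card_ord.
  by move=> i _; rewrite dotp_delta mxE !eqxx.
- exists I, x; split => //; apply: le_trans le; rewrite lee_fin.
  have g0 := gvar_bound_gt0 R; have N0 : 0 < (N + tau)%:R :> R by rewrite ltr0n addn_gt0 tau0 orbT.
  have nn : 0 <= N%:R :> R by [].
  have n0 : 0 < 1 + rho * N%:R by rewrite ltr_pwDl// mulr_ge0// ltW.
  have len : (1 + rho * N%:R) * tau%:R <= 3 * (N + tau)%:R.
    have : rho * tau%:R <= 3 by rewrite -ler_pdivlMr.
    rewrite natrD; nra.
  rewrite natrD in N0 len *.
  have -> : d%:R * sigma ^+ 2 / (8 * gvar_bound R * (1 + rho * N%:R) * d%:R * mu ^+ 2) =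
      (sigma ^+ 2 / (8 * gvar_bound R * mu ^+ 2)) * (1 + rho * N%:R)^-1.
    by field; rewrite !gt_eqF.
  have -> : tau%:R * sigma ^+ 2 / (24 * gvar_bound R * mu ^+ 2 * (N%:R + tau%:R)) =
      (sigma ^+ 2 / (8 * gvar_bound R * mu ^+ 2)) * (tau%:R / (3 * (N%:R + tau%:R))).
    by field; rewrite !gt_eqF.
  rewrite ler_wpM2l//.
    by rewrite divr_ge0 ?sqr_ge0// !mulr_ge0 ?sqr_ge0// ltW.
  rewrite ler_pdivrMr ?mulr_gt0// mulrC ler_pdivlMr// mulrC//.
Qed.

(** According to which of [d] and [tau] is larger, the first or the second
    bound is within a constant factor of the sum. *)
Lemma lower_bound :
  exists (I : two_point_instance d tau mu sigma) (xstar : 'rV[R]_d),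
    minimizer (objective I) xstar /\
    (((48 * gvar_bound R)^-1 * ((d + tau)%:R * sigma ^+ 2 / (mu ^+ 2 * (N + tau)%:R)))%:E
      <= mean_square_error a I xstar)%E.
Proof.
have g0 := gvar_bound_gt0 R.
have tR : 1 <= tau%:R :> R by rewrite ler1n.
have dR : 1 <= d%:R :> R by rewrite ler1n.
have nn : 0 <= N%:R :> R by [].
have m2 : 0 < mu ^+ 2 by rewrite exprn_gt0.
have s2 : 0 < sigma ^+ 2 by rewrite exprn_gt0.
pose c := sigma ^+ 2 / (48 * gvar_bound R * mu ^+ 2).
have c0 : 0 < c by rewrite divr_gt0// !mulr_gt0.
have N0 : 0 < N%:R + tau%:R :> R by lra.
have N1 : 0 < N%:R + 1 :> R by lra.
rewrite !natrD.
have -> : (48 * gvar_bound R)^-1 * ((d%:R + tau%:R) * sigma ^+ 2 / (mu ^+ 2 * (N%:R + tau%:R))) =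
    c * ((d%:R + tau%:R) / (N%:R + tau%:R)).
  by rewrite /c; field; rewrite !gt_eqF.
have [dtau|taud] := leP tau%:R (d%:R : R).
- have [I [x [Ix le]]] := lower_bound_dimension.
  exists I, x; split => //; apply: le_trans le; rewrite lee_fin natrD.
  have -> : d%:R * sigma ^+ 2 / (16 * gvar_bound R * mu ^+ 2 * (N%:R + 1)) =
      c * (3 * d%:R / (N%:R + 1)) by rewrite /c; field; rewrite !gt_eqF.
  rewrite ler_pM2l// ler_pdivrMr// mulrAC ler_pdivlMr//; nra.
- have [I [x [Ix le]]] := lower_bound_mixing.
  exists I, x; split => //; apply: le_trans le; rewrite lee_fin natrD.
  have -> : tau%:R * sigma ^+ 2 / (24 * gvar_bound R * mu ^+ 2 * (N%:R + tau%:R)) =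
      c * (2 * tau%:R / (N%:R + tau%:R)) by rewrite /c; field; rewrite !gt_eqF.
  rewrite ler_pM2l// ler_pM2r ?invr_gt0//; lra.
Qed.

End lower_bound.

Theorem theorem7 (R : realType) :
  (exists2 c : R, 0 < c &
    forall (d tau : nat) (mu sigma2 : R),
      (1 <= d)%N -> (1 <= tau)%N -> 0 < mu -> 0 < sigma2 ->
    exists N0 : nat, forall N : nat, (N0 <= N)%N ->
    forall a : algorithm R d N,
    exists (I : two_point_instance d tau mu sigma2) (xstar : 'rV[R]_d),
      minimizer (objective I) xstar /\
      ((c * ((d + tau)%:R * sigma2 ^+ 2 / (mu ^+ 2 * N%:R)))%:E
         <= mean_square_error a I xstar)%E)
  /\
  (exists2 c : R, 0 < c &
    forall (d tau : nat) (mu sigma2 : R),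
      (1 <= d)%N -> (1 <= tau)%N -> 0 < mu -> 0 < sigma2 ->
    exists2 eps0 : R, 0 < eps0 &
    forall eps : R, 0 < eps -> eps <= eps0 ->
    forall (N : nat) (a : algorithm R d N),
      (forall (I : two_point_instance d tau mu sigma2) (xstar : 'rV[R]_d),
         minimizer (objective I) xstar -> (mean_square_error a I xstar <= eps%:E)%E) ->
      c * ((d + tau)%:R * sigma2 ^+ 2 / (mu ^+ 2 * eps)) <= N%:R).
Proof.
have g0 := gvar_bound_gt0 R.
pose c : R := (48 * gvar_bound R)^-1.
have c0 : 0 < c by rewrite invr_gt0 mulr_gt0.
split; exists (c / 2); rewrite ?divr_gt0// => d tau mu sigma d1 tau1 mu0 sigma0.
  have tR : 1 <= tau%:R :> R by rewrite ler1n.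
  (* For N >= tau the denominator N + tau is at most 2 N. *)
  exists tau => N tauN a.
  have [I [x [Ix le]]] := @lower_bound R d tau N mu sigma a d1 tau1 mu0 sigma0.
  exists I, x; split => //; apply: le_trans le; rewrite lee_fin -/c.
  have NR : tau%:R <= N%:R :> R by rewrite ler_nat.
  have N0 : 0 < N%:R :> R by lra.
  pose K : R := c * ((d + tau)%:R * sigma ^+ 2 / mu ^+ 2).
  have K0 : 0 <= K by rewrite mulr_ge0 ?divr_ge0 ?mulr_ge0 ?sqr_ge0// ltW.
  have -> : c / 2 * ((d + tau)%:R * sigma ^+ 2 / (mu ^+ 2 * N%:R)) = K * (2 * N%:R)^-1.
    by rewrite /K; field; rewrite !gt_eqF.
  have Nt : 0 < N%:R + tau%:R :> R by lra.
  rewrite (natrD _ N tau).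
  have -> : c * ((d + tau)%:R * sigma ^+ 2 / (mu ^+ 2 * (N%:R + tau%:R))) =
      K * (N%:R + tau%:R)^-1 by rewrite /K; field; rewrite !gt_eqF.
  rewrite ler_wpM2l// lef_pV2 ?posrE ?mulr_gt0//; lra.
pose K : R := c * ((d + tau)%:R * sigma ^+ 2 / mu ^+ 2).
have tR : 1 <= tau%:R :> R by rewrite ler1n.
have K0 : 0 < K.
  rewrite mulr_gt0// divr_gt0 ?exprn_gt0// mulr_gt0 ?exprn_gt0// ltr0n.
  by rewrite addn_gt0 d1.
(* Below this accuracy, K <= eps (N + tau) and eps tau <= K / 2 leave K / 2 <=
   eps N. *)
exists (K / (2 * tau%:R)); first by rewrite divr_gt0// mulr_gt0//; lra.
move=> eps eps0 epsK N a small.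
have [I [x [Ix le]]] := @lower_bound R d tau N mu sigma a d1 tau1 mu0 sigma0.
have := le_trans le (small I x Ix); rewrite lee_fin -/c.
have Nt : 0 < N%:R + tau%:R :> R by rewrite ltr_wpDl//; lra.
rewrite (natrD _ N tau).
have -> : c * ((d + tau)%:R * sigma ^+ 2 / (mu ^+ 2 * (N%:R + tau%:R))) =
    K / (N%:R + tau%:R) by rewrite /K; field; rewrite !gt_eqF.
rewrite ler_pdivrMr// => h.
have -> : c / 2 * ((d + tau)%:R * sigma ^+ 2 / (mu ^+ 2 * eps)) = K / 2 / eps.
  by rewrite /K; field; rewrite !gt_eqF.
rewrite ler_pdivrMr//.
move: epsK; rewrite ler_pdivlMr ?mulr_gt0//; last by lra.
nra.
Qed.
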